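(* Let $\Gamma$ be an infinite, locally finite tree rooted at $0$, and let $(X_\sigma)_{\sigma\ne0}$ be real-valued i.i.d. random variables, one for each edge $e(\sigma)$ of $\Gamma$, with the law of a random variable $X$. Let $S_\sigma:=\sum_{0<\tau\le\sigma}X_\tau$, and let $m$ and $m_1$ be the functions associated with $X$ in the context. Unless $\mathrm{br}\,\Gamma=1$ and $m\equiv1$, we have $$\inf_{s\in\partial\Gamma}\ \limsup_{\sigma\in s}\frac{S_\sigma}{|\sigma|}=\inf\Big\{\lim_{\sigma\in s}\frac{S_\sigma}{|\sigma|}:\ s\in\partial\Gamma \text{ and } \lim_{\sigma\in s}\frac{S_\sigma}{|\sigma|}\text{ exists}\Big\}=m_1\big((\mathrm{br}\,\Gamma)^{-1}\big)\quad\text{a.s.},$$ and, for every real $y$ with $m_1\big((\mathrm{br}\,\Gamma)^{-1}\big)\le y<\sup_n\mathbf{E}[X\wedge n]$, $$\dim\Big\{s\in\partial\Gamma:\ \limsup_{\sigma\in s}\frac{S_\sigma}{|\sigma|}\le y\Big\}=\dim\Big\{s\in\partial\Gamma:\ \lim_{\sigma\in s}\frac{S_\sigma}{|\sigma|}=y\Big\}=\log\big(m(y)\,\mathrm{br}\,\Gamma\big)\quad\text{a.s.}$$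
   Context: Tree notation. $\Gamma$ is identified with its vertex set. $|\sigma|$ is the number of edges on the shortest path from $0$ to $\sigma$. Write $\sigma\le\tau$ if $\sigma$ lies on the shortest path from $0$ to $\tau$, and $\sigma<\tau$ if in addition $\sigma\neq\tau$. For $\sigma\ne0$, $e(\sigma)$ is the edge joining $\sigma$ to the preceding vertex on the path from $0$. A cutset $\Pi$ is a finite set of vertices not including $0$ such that every infinite path from $0$ (going through no vertex more than once) intersects $\Pi$ and such that there is no pair $\sigma,\tau\in\Pi$ with $\sigma<\tau$. The branching number is $$\mathrm{br}\,\Gamma:=\inf\Big\{\lambda>0:\ \inf_{\Pi}\sum_{\sigma\in\Pi}\lambda^{-|\sigma|}=0\Big\},$$ the inner infimum being over all cutsets. Boundary. $\partial\Gamma$ is the space of infinite paths beginning at $0$ which go through no vertex more than once, with metric $d(s,t)=e^{-n}$, where $n$ is the number of edges common to $s$ and $t$. $\dim$ denotes Hausdorff dimension for this metric (with $\dim\emptyset=0$). For $s\in\partial\Gamma$, $\limsup_{\sigma\in s}$ and $\lim_{\sigma\in s}$ are taken as $\sigma$ runs along the vertices of $s$ with $|\sigma|\to\infty$; limits are taken in $[-\infty,+\infty]$. Rate functions. For $y\in\mathbf{R}$, $$m(y):=\inf_{x\le0}\mathbf{E}\big[e^{x(X-y)}\big]\in[0,1],$$ a non-decreasing function, and $m_1(z):=\sup\{y\in\mathbf{R}:\ m(y)<z\}$ for $z>0$, with $\sup\emptyset=-\infty$. For $z=0$ (relevant only when $\mathrm{br}\,\Gamma=\infty$, with $\infty^{-1}=0$),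 $m_1(0):=\inf\{y\in\mathbf{R}:\ m(y)>0\}$. The dimension formula is asserted only for those $y$ for which the product $m(y)\,\mathrm{br}\,\Gamma$ is not of the indeterminate form $0\cdot\infty$. Finally, $X\wedge n:=\min(X,n)$. *)

(* Defs.v *)
From HB Require Import structures.
From mathcomp Require Import all_boot all_order all_algebra finmap.
From mathcomp Require Import all_classical all_reals all_analysis.

Set Implicit Arguments.
Unset Strict Implicit.
Unset Printing Implicit Defensive.

Import Order.TTheory GRing.Theory Num.Theory.
Import numFieldNormedType.Exports.

Local Open Scope classical_set_scope.
Local Open Scope ring_scope.

(* A tree is a loopless undirected graph in which any two vertices are joined
   by exactly one path without repeated vertices.  In [path adj x p] the start
   [x] is not listed in [p], so [size p] is the number of edges. *)
Record rooted_tree := RootedTree {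
  vertex :> choiceType;
  adj : rel vertex;
  origin : vertex;
  adj_sym : symmetric adj;
  adj_irr : irreflexive adj;
  adj_tree : forall x y : vertex,
    exists! p : seq vertex, [/\ path adj x p, last x p = y & uniq (x :: p)] }.

Arguments origin {r}.

Definition locally_finite (T : rooted_tree) : Prop :=
  forall v : T, finite_set [set w : T | adj v w].

Section Tree.
Variable T : rooted_tree.
Implicit Types (u v : T).

Definition shortest_path u v (p : seq T) : Prop :=
  [/\ path (@adj T) u p, last u p = v &
      forall q, path (@adj T) u q -> last u q = v -> (size p <= size q)%N].

Definition root_path v : seq T := xget [::] [set p | shortest_path origin v p].

Definition depth v : nat := size (root_path v).

Definition tree_le u v : Prop := u \in origin :: root_path v.

Definition tree_lt u v : Prop := tree_le u v /\ u <> v.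

Record boundary := Boundary {
  ray :> nat -> T;
  ray_root : ray 0%N = origin;
  ray_adj : forall n, adj (ray n) (ray n.+1);
  ray_inj : injective ray }.

Definition ray_edges (s : boundary) : set (set T) :=
  [set [set s n; s n.+1] | n in [set: nat]].

Definition cutset (C : set T) : Prop :=
  [/\ finite_set C,
      ~ C origin,
      forall s : boundary, exists n, C (s n) &
      forall u v, C u -> C v -> ~ tree_lt u v].

End Tree.

(* The value is +oo when no such l exists. *)
Definition branching_number (R : realType) (T : rooted_tree) : \bar R :=
  ereal_inf [set l%:E | l in [set l : R | 0 < l /\
    ereal_inf [set (\sum_(v \in C) l ^- depth v)%:E | C in @cutset T]
      = 0%E]].

(* Number of edges common to s and t is +oo exactly when s = t, and then
   expeR (- +oo) = 0. *)
Definition boundary_dist (R : realType) (T : rooted_tree)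
    (s t : boundary T) : R :=
  fine (expeR (- counting (ray_edges s `&` ray_edges t))%E).

Section Hausdorff.
Variables (R : realType) (M : Type) (dist : M -> M -> R).
Implicit Types (E A : set M).
Local Open Scope ereal_scope.

(* Adjoining 0 gives the empty set diameter 0. *)
Definition diameter A : \bar R :=
  ereal_sup (0 |` [set r | exists x y, [/\ A x, A y & r = (dist x y)%:E]]).

Definition hausdorff_premeasure (a delta : R) E : \bar R :=
  ereal_inf [set \sum_(0 <= i <oo) poweR (diameter (U i)) a | U in
    [set U : nat -> set M |
       E `<=` \bigcup_i U i /\ forall i, diameter (U i) <= delta%:E]].

Definition hausdorff_measure (a : R) E : \bar R :=
  ereal_sup [set hausdorff_premeasure a delta E
            | delta in [set delta : R | (0 < delta)%R]].

(* Restricting to a > 0 avoids 0 `^ 0; the empty set gets dimension 0. *)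
Definition hausdorff_dim E : \bar R :=
  ereal_inf [set a%:E | a in
    [set a : R | (0 < a)%R /\ hausdorff_measure a E = 0]].

End Hausdorff.

Section Probability.
Local Open Scope ereal_scope.
Context d (Omega : measurableType d) (R : realType) (P : probability Omega R).

Definition mutually_independent (I : choiceType) (D : set I)
    (X : I -> {RV P >-> R}) : Prop :=
  forall (J : {fset I}) (B : I -> set R),
    [set` J] `<=` D -> (forall i, measurable (B i)) ->
    P (\bigcap_(i in [set` J]) (X i @^-1` B i)) =
    \prod_(i <- J) P (X i @^-1` B i).

Definition same_law d' (Omega' : measurableType d') (P' : probability Omega' R)
    (X : {RV P >-> R}) (Y : {RV P' >-> R}) : Prop :=
  forall B : set R, measurable B -> distribution P X B = distribution P' Y B.

Variable X : {RV P >-> R}.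

Definition rate (y : R) : \bar R :=
  ereal_inf [set 'E_P[fun w => expR (x * (X w - y))%R]
            | x in [set x : R | (x <= 0)%R]].

Definition rate_inv (z : \bar R) : \bar R :=
  if z == 0 then ereal_inf [set y%:E | y in [set y : R | 0 < rate y]]
  else ereal_sup [set y%:E | y in [set y : R | rate y < z]].

Definition sup_truncated_mean : \bar R :=
  ereal_sup [set 'E_P[fun w => Num.min (X w) n%:R] | n in [set: nat]].

End Probability.

Section Walk.
Variables (R : realType) (T : rooted_tree).
Implicit Types (x : T -> R) (s : boundary T).

Definition partial_sum x (v : T) : R :=
  \sum_(u \in [set u | tree_lt origin u /\ tree_le u v]) x u.

(* The 0-th term is the junk value 0 / 0; it affects neither limit. *)
Definition ray_average x s : (\bar R)^nat :=
  fun n => (partial_sum x (s n) / (depth (s n))%:R)%:E.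

Definition rays_limsup_le x (y : \bar R) : set (boundary T) :=
  [set s | (limn_esup (ray_average x s) <= y)%E].

Definition rays_lim_eq x (y : \bar R) : set (boundary T) :=
  [set s | ray_average x s @ \oo --> y].

End Walk.

(* Main.v *)
Require Import Defs.
From HB Require Import structures.
From mathcomp Require Import all_boot all_order all_algebra finmap.
From mathcomp Require Import all_classical all_reals all_analysis.
From mathcomp Require Import measurable_realfun ring lra zify.

(* Upper bounds are first moment estimates.  By Chernoff, P(S_v <= y |v|) <= m(y)^|v|; summing
   over cutsets that are cheap for some parameter above br, Borel-Cantelli rules out slow rays,
   or covers them cheaply.

   Lower bounds come from a percolation.  If y < sup_n E[min(X, n)] and u < m(y), tilting the law of
   X restricted to a bounded set shows that a block of k edges has average within e of y and
   bounded increments with probability at least u^k, for k large.  Cut the tree into blocks of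
   slowly growing length and keep those that are typical in this sense.  The truncated flow
     F_{n+1}(v) = min(1, c^{-k} sum over typical blocks vw of F_n(w))
   has, by a second moment bound, an expectation comparable to the deterministic flow with
   parameter c / u, which is bounded below when c / u < br.  As the vertices of one level are
   independent, a.s. some vertex carries a positive limiting flow, and then every countable cover
   of the rays through typical blocks is expensive: these rays, along which S_v / |v| tends to y,
   form a set of dimension at least log c.

   If m_1(1/br) >= E X, a fixed ray is good by the strong law of large numbers.  If
   sup_n E[min(X, n)] = -oo, then m = 1, and truncating X gives bounded laws of arbitrarily low mean
   and almost full mass, to which the percolation applies. *)

Set Implicit Arguments.
Unset Strict Implicit.
Unset Printing Implicit Defensive.

Import Order.TTheory GRing.Theory Num.Theory.
Import numFieldNormedType.Exports.

Local Open Scope classical_set_scope.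
Local Open Scope ring_scope.

(** * Ancestors and rays *)

(** No measure is put on the set of slow rays. A capped flow is combined with a greedy descent: if
    the flow at a vertex exceeds the cost of the part of a cover below it, the same holds at some
    descendant through an open block; a covering vertex is never reached, since its own cost is at
    least 1 and the flow is at most 1. Three constraints fix the blocks. Their lengths tend to
    infinity, so that the tolerance can tend to 0 and the limit be exactly [y]. They are small
    compared with the level, so that averages inside a block are harmless and a covering vertex may
    be moved up to the start of its block, a loss absorbed by going from the exponent [a] to
    [b < a]. They grow by one edge at a time, which makes the loss of expectation from block to
    block an explicit power of [u]. Bounded increments control the averages inside blocks and the
    second-order behaviour of the transform. They are the reason for restricting the law of [X]
    before tilting, and the work is to restrict it without losing the minimum of the transform. *)

Section RootPath.
Variable T : rooted_tree.
Implicit Types (u v w : T) (p q : seq T).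

(** Removing loops from an arbitrary walk leaves a walk without repetitions, which by uniqueness is
    [p]; so the unique simple path is a shortest one. *)
Lemma tree_path_shortest v p : path (@adj T) origin p -> last origin p = v ->
  uniq (origin :: p) -> forall q, path (@adj T) origin q -> last origin q = v ->
  {subset p <= q}.
Proof.
move=> pp pl pu q qp ql.
have [r [_ puniq]] := adj_tree (origin : T) v.
have /puniq <- : [/\ path (@adj T) origin p, last origin p = v & uniq (origin :: p)] by [].
case/shortenP: qp ql => s sp su sq sl x.
have /puniq -> : [/\ path (@adj T) origin s, last origin s = v & uniq (origin :: s)] by [].
exact: sq.
Qed.

Lemma root_path_spec v :
  [/\ path (@adj T) origin (root_path v), last origin (root_path v) = v &
      uniq (origin :: root_path v)].
Proof.
have [p [[pp pl pu] _]] := adj_tree (origin : T) v.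
have pshort : shortest_path origin v p.
  split=> // q qp ql; apply: uniq_leq_size; first by case/andP: pu.
  exact: (tree_path_shortest pp pl pu).
have /= [rp rl rshort] : shortest_path origin v (root_path v).
  by rewrite /root_path; apply: (@xgetPex _ [::] [set p | shortest_path origin v p]); exists p.
have h : {subset origin :: p <= origin :: root_path v}.
  move=> x; rewrite !inE => /orP[->//|xp]; apply/orP; right.
  exact: (tree_path_shortest pp pl pu).
(* A shortest walk contains all vertices of the simple path and is no longer, hence has no
   repetition itself. *)
split=> //; apply: (leq_size_uniq pu h).
by rewrite /= ltnS; apply: rshort.
Qed.

Lemma root_path_eq v p : path (@adj T) origin p -> last origin p = v ->
  uniq (origin :: p) -> root_path v = p.
Proof.
move=> pp pl pu; have [r [_ puniq]] := adj_tree (origin : T) v.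
by rewrite -(puniq p) // -(puniq (root_path v)) //; exact: root_path_spec.
Qed.

(* The vertex at depth n on the path to v, or v itself when n exceeds the depth of v. *)
Definition anc n v : T := last origin (take n (root_path v)).

Lemma root_path_anc n v : root_path (anc n v) = take n (root_path v).
Proof.
have [vp vl vu] := root_path_spec v.
apply: root_path_eq => //.
- by move: vp; rewrite -{1}(cat_take_drop n (root_path v)) cat_path => /andP[].
- move: vu; rewrite -{1}(cat_take_drop n (root_path v)) -cat_cons cat_uniq.
  by case/andP.
Qed.

Lemma depth_anc n v : depth (anc n v) = minn n (depth v).
Proof. by rewrite /depth root_path_anc size_take_min. Qed.

Lemma root_path_inj : injective (@root_path T).
Proof.
move=> u v uv; have [_ ul _] := root_path_spec u.
by have [_ vl _] := root_path_spec v; rewrite -ul uv.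
Qed.

Lemma anc_id n v : (depth v <= n)%N -> anc n v = v.
Proof.
move=> h; apply: root_path_inj; rewrite root_path_anc.
by apply: take_oversize.
Qed.

Lemma anc_anc m n v : anc m (anc n v) = anc (minn m n) v.
Proof.
apply: root_path_inj; rewrite !root_path_anc.
by rewrite take_min.
Qed.

Lemma depth_origin : depth (origin : T) = 0%N.
Proof. by rewrite /depth (@root_path_eq origin [::]). Qed.

Lemma depth0 v : depth v = 0%N -> v = origin.
Proof.
move=> /size0nil v0; apply: root_path_inj; rewrite v0.
by rewrite (@root_path_eq origin [::]).
Qed.

Lemma anc0 v : anc 0 v = origin.
Proof. by rewrite /anc take0. Qed.

Lemma origin_notin_root_path v : origin \notin root_path v.
Proof. by have [_ _ /andP[]] := root_path_spec v. Qed.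

Lemma uniq_root_path v : uniq (root_path v).
Proof. by have [_ _ /andP[]] := root_path_spec v. Qed.

Lemma nth_root_path v i : (i < depth v)%N ->
  nth origin (root_path v) i = anc i.+1 v.
Proof.
move=> iv; rewrite /anc (take_nth origin) //.
by rewrite last_rcons.
Qed.

Lemma tree_leP u v : tree_le u v <-> anc (depth u) v = u.
Proof.
split=> [|h].
  rewrite /tree_le inE => /orP[/eqP->|]; first by rewrite depth_origin anc0.
  move=> /(nthP origin)[i iv <-]; rewrite nth_root_path // depth_anc.
  by rewrite (minn_idPl iv).
rewrite /tree_le -h /anc.
case: (depth u) => [|n]; first by rewrite take0 inE eqxx.
have := mem_last origin (take n.+1 (root_path v)).
rewrite !inE => /orP[->//|hx]; apply/orP; right.
exact: (mem_take hx).
Qed.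

Lemma tree_le_depth u v : tree_le u v -> (depth u <= depth v)%N.
Proof. by move/tree_leP => <-; rewrite depth_anc geq_minr. Qed.

Lemma mem_root_path u v : (u \in root_path v) = (u != origin) && (anc (depth u) v == u).
Proof.
have h := tree_leP u v; rewrite /tree_le inE in h.
case: eqVneq => [->|u0] /=; first exact/negbTE/origin_notin_root_path.
rewrite (negbTE u0) /= in h.
by apply/idP/eqP => /h.
Qed.

Lemma adj_depthS u v : adj u v -> depth v = (depth u).+1 -> anc (depth u) v = u.
Proof.
move=> uv duv; have [up ul uu] := root_path_spec u.
have vu : v \notin origin :: root_path u.
  rewrite -/(tree_le v u); apply/negP => /tree_le_depth; rewrite duv ltnn //.
have rv : root_path v = rcons (root_path u) v.
  apply: root_path_eq; rewrite ?last_rcons //.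
    by rewrite rcons_path up ul.
  by rewrite -rcons_cons rcons_uniq vu uu.
apply: root_path_inj; rewrite root_path_anc rv -cats1 take_size_cat //.
Qed.

Lemma adj_anc n v : (n < depth v)%N -> adj (anc n v) (anc n.+1 v).
Proof.
move=> nv; have [vp _ _] := root_path_spec v.
have := pathP origin vp; move/(_ n nv).
rewrite nth_root_path //.
case: n nv => [|n] nv /=; first by rewrite anc0.
by rewrite nth_root_path // ltnW.
Qed.

End RootPath.

Section Rays.
Variable T : rooted_tree.
Implicit Types (s t : boundary T) (v : T).

Lemma root_path_ray s n : root_path (s n) = [seq s i | i <- iota 1 n].
Proof.
apply: root_path_eq.
- apply/(pathP origin) => i; rewrite size_map size_iota => ilt.
  rewrite (nth_map 0%N) ?size_iota // nth_iota // add1n.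
  case: i ilt => [|i] ilt /=; first by rewrite -(ray_root s); exact: ray_adj.
  rewrite (nth_map 0%N) ?size_iota // 1?ltnW // nth_iota 1?ltnW // add1n.
  exact: ray_adj.
- case: n => [|n]; first by rewrite /= ray_root.
  by rewrite -[in iota _ _](addn1 n) iotaD map_cat last_cat /= add1n.
- rewrite -(ray_root s) -(map_cons s) map_inj_uniq; last exact: ray_inj.
  exact: (iota_uniq 0 n.+1).
Qed.

Lemma depth_ray s n : depth (s n) = n.
Proof. by rewrite /depth root_path_ray size_map size_iota. Qed.

Lemma anc_ray s m n : (m <= n)%N -> anc m (s n) = s m.
Proof.
move=> mn; apply: root_path_inj; rewrite root_path_anc !root_path_ray.
by rewrite -map_take take_iota (minn_idPl mn).
Qed.

Lemma ray_neq0 s n : s n.+1 <> origin.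
Proof. by move/(congr1 (@depth T)); rewrite depth_ray depth_origin. Qed.

End Rays.

(** Both constructions of rays, from an infinite subtree and from the greedy descent, end here. *)
Lemma ray_of_chain (T : rooted_tree) (g : nat -> T) :
  (forall n, depth (g n) = n) -> (forall n, anc n (g n.+1) = g n) ->
  exists s : boundary T, forall n, s n = g n.
Proof.
move=> gd ga.
have g0 : g 0%N = origin by apply: depth0.
have gadj n : adj (g n) (g n.+1).
  by have := @adj_anc T n (g n.+1); rewrite gd ltnSn ga anc_id ?gd //; apply.
have ginj : injective g by move=> m n /(congr1 (@depth T)); rewrite !gd.
by exists (Boundary g0 gadj ginj).
Qed.

(** * Levels, cutsets and the branching number *)

Section Levels.
Variable T : rooted_tree.
Hypothesis lf : locally_finite T.
Implicit Types (u v w : T) (s : boundary T).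

Lemma finite_level n : finite_set [set v : T | depth v = n].
Proof.
elim: n => [|n IH].
  by apply: (sub_finite_set _ (finite_set1 (origin : T))) => v /= /depth0.
apply: (@sub_finite_set _ _ (\bigcup_(u in [set v : T | depth v = n]) [set w | adj u w])).
  move=> v /= dv; exists (anc n v) => /=; first by rewrite depth_anc dv (minn_idPl _).
  by have := @adj_anc T n v; rewrite dv ltnSn -dv (anc_id (leqnn _)); apply.
by apply: bigcup_finite => // v _; exact: lf.
Qed.

Definition lvl n : seq T := fset_set [set v : T | depth v = n].

Lemma mem_lvl n v : (v \in lvl n) = (depth v == n).
Proof.
rewrite /lvl in_fset_set; last exact: finite_level.
by apply/idP/eqP; rewrite inE.
Qed.

Lemma uniq_lvl n : uniq (lvl n). Proof. exact: fset_uniq. Qed.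

Definition desc k v : seq T := [seq w <- lvl (depth v + k) | anc (depth v) w == v].

Lemma mem_desc k v w : (w \in desc k v) = (anc (depth v) w == v) && (depth w == depth v + k)%N.
Proof. by rewrite mem_filter mem_lvl. Qed.

Lemma uniq_desc k v : uniq (desc k v).
Proof. exact/filter_uniq/uniq_lvl. Qed.

Lemma konig : infinite_set [set: T] -> exists s : boundary T, True.
Proof.
move=> Tinf.
pose big v := infinite_set [set w : T | tree_le v w].
have step v : exists w, big v -> big w /\ (adj v w /\ depth w = (depth v).+1).
  case: (pselect (big v)) => [bv|]; last by move=> nb; exists v.
  (* If no child had an infinite subtree, the subtree of [v] would be [v] together with finitely
     many finite sets. *)
  apply: contrapT => /forallNP nw; apply: bv.
  apply: (@sub_finite_set _ _ ([set v] `|`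
     \bigcup_(u in [set u | adj v u /\ depth u = (depth v).+1]) [set w | tree_le u w])).
    move=> w /= vw; have [e|ne] := eqVneq w v; [by left|right].
    move/tree_leP: (vw) => aw.
    have lt : (depth v < depth w)%N.
      rewrite ltn_neqAle tree_le_depth // andbT; apply: contra ne => /eqP e.
      by rewrite -aw e anc_id.
    exists (anc (depth v).+1 w) => /=.
      split; first by rewrite -{1}aw; exact: adj_anc.
      by rewrite depth_anc (minn_idPl lt).
    by apply/tree_leP; rewrite depth_anc (minn_idPl lt).
  rewrite finite_setU; split; first exact: finite_set1.
  apply: bigcup_finite; first by apply: (sub_finite_set _ (lf v)) => u [].
  move=> u /= vu; apply: contrapT => bu; apply: (nw u); move=> _; split => //.
have /choice[nx nxP] := step.
pose g n := iter n nx (origin : T).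
have gb n : big (g n).
  elim: n => [|n IH]; last by case: (nxP _ IH).
  rewrite /big /g /=; suff -> : [set w : T | tree_le origin w] = setT by [].
  by apply/seteqP; split => // w _ /=; apply/tree_leP; rewrite depth_origin anc0.
have gd n : depth (g n) = n.
  elim: n => [|n IH]; first exact: depth_origin.
  by have [_ [_ ->]] := nxP _ (gb n); rewrite IH.
have [||s _] := @ray_of_chain T g; [by []| |by exists s].
move=> n; have [_ [ad de]] := nxP _ (gb n).
by rewrite -(adj_depthS ad de) gd.
Qed.

End Levels.

Lemma ler_sum_sub (R : numDomainType) (I : eqType) (r s : seq I) (F : I -> R) :
  (forall i, 0 <= F i) -> uniq r -> {subset r <= s} ->
  \sum_(i <- r) F i <= \sum_(i <- s) F i.
Proof.
move=> F0; elim: r s => [|x r IH] s /=; first by move=> _ _; rewrite big_nil sumr_ge0.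
move=> /andP[xr ur] rs.
have xs : x \in s by apply: rs; rewrite inE eqxx.
rewrite big_cons (big_rem x xs) /= lerD2l; apply: IH => // i ir.
have : i \in x :: rem x s by rewrite -(perm_mem (perm_to_rem xs)); apply: rs; rewrite inE ir orbT.
by rewrite inE => /orP[/eqP e|//]; rewrite -e ir in xr.
Qed.

Section Branching.
Variables (R : realType) (T : rooted_tree).
Implicit Types (A : seq T) (s : boundary T) (l : R).

(** Cutsets without the antichain condition, so that concatenations of lists qualify; passing to
    minimal vertices restores the condition. *)
Definition hits A := forall s, exists n, s n \in A.

Lemma cutset_of_hits A (F : T -> R) : origin \notin A -> hits A -> (forall v, 0 <= F v) ->
  exists C : set T, cutset C /\ \sum_(v \in C) F v <= \sum_(v <- A) F v.
Proof.
move=> oA hA F0.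
pose C := [set v : T | v \in A /\ forall u, u \in A -> tree_le u v -> u = v].
have fC : finite_set C.
  by apply: (@sub_finite_set _ _ [set` A]); [move=> v /= []|exact: finite_seq].
exists C; split.
  split => //.
  - by move=> /= [oA' _]; rewrite oA' in oA.
  - move=> s; have [n nA minA] := ex_minnP (hA s).
    (* The first vertex of [s] in [A] is minimal in [A]: an ancestor of it in [A] would lie earlier
       on [s]. *)
    exists n; split=> // u uA /tree_leP; have [le|/ltnW le] := leqP (depth u) n.
      rewrite anc_ray // => su; rewrite -su; congr (s _).
      by apply/eqP; rewrite eqn_leq le minA // su.
    by rewrite anc_id // depth_ray.
  - move=> u v [uA _] [_ vm] [uv]; apply; exact: vm.
rewrite fsbig_finite //=; apply: ler_sum_sub => // v.
by rewrite in_fset_set // inE => -[].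
Qed.

Lemma cutset_seq (C : set T) (F : T -> R) : cutset C -> exists A,
  [/\ origin \notin A, hits A, uniq A & \sum_(v \in C) F v = \sum_(v <- A) F v].
Proof.
move=> [fC oC hC _]; exists (fset_set C); split.
- by rewrite in_fset_set // notin_setE.
- by move=> s; have [n Cn] := hC s; exists n; rewrite in_fset_set // inE.
- exact: fset_uniq.
- by rewrite fsbig_finite.
Qed.

Let cost l := [set (\sum_(v \in C) l ^- depth v)%:E | C in @cutset T].

Lemma cost_inf_ge0 l : 0 < l -> (0 <= ereal_inf (cost l))%E.
Proof.
move=> l0; apply: le_ereal_inf_tmp => _ [C cC <-]; rewrite lee_fin.
by have [A [_ _ _ ->]] := cutset_seq (fun v => l ^- depth v) cC; apply: sumr_ge0 => v _; rewrite invr_ge0 exprn_ge0 // ltW.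
Qed.

(** Every cutset meets the ray [s0], and for [l < 1] the single term of that vertex is already at
    least 1. *)
Lemma branching_ge1 (s0 : boundary T) : (1 <= branching_number R T)%E.
Proof.
apply: le_ereal_inf_tmp => _ [l [l0 lI] <-]; rewrite lee_fin leNgt; apply/negP => l1.
suff : (1 <= ereal_inf (cost l))%E by rewrite /cost lI lee_fin ler10.
apply: le_ereal_inf_tmp => _ [C cC <-].
have [A [_ hA _ ->]] := cutset_seq (fun v => l ^- depth v) cC.
have [n nA] := hA s0; rewrite lee_fin (big_rem _ nA) /=.
rewrite -[leLHS]addr0 lerD //; last by apply: sumr_ge0 => v _; rewrite invr_ge0 exprn_ge0 // ltW.
by rewrite invf_ge1 ?exprn_gt0 // exprn_ile1 // ltW.
Qed.

Lemma branching_flow l : 0 < l -> (l%:E < branching_number R T)%E ->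
  exists2 dl : R, 0 < dl & forall A, origin \notin A -> hits A ->
    dl <= \sum_(v <- A) l ^- depth v.
Proof.
move=> l0 lb; have i0 := cost_inf_ge0 l0.
have ipos : (0 < ereal_inf (cost l))%E.
  rewrite lt_neqAle i0 andbT; apply/eqP => e0.
  have : (branching_number R T <= l%:E)%E by apply: ereal_inf_lbound; exists l => //; split.
  by rewrite leNgt lb.
have [e e0 ei] : exists2 e : R, 0 < e & (e%:E <= ereal_inf (cost l))%E.
  case: (ereal_inf (cost l)) ipos => [r| |] //; last by exists 1; rewrite ?leey.
  by rewrite lte_fin => r0; exists r.
exists e => // A oA hA.
have F0 (v : T) : 0 <= l ^- depth v by rewrite invr_ge0 exprn_ge0 // ltW.
have [C [cC]] := cutset_of_hits oA hA F0; apply: le_trans.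
by rewrite -lee_fin (le_trans ei) //; apply: ereal_inf_lbound; exists C.
Qed.

Lemma branching_cut l : 0 < l -> (branching_number R T < l%:E)%E ->
  forall e : R, 0 < e -> exists A, [/\ origin \notin A, hits A, uniq A &
    \sum_(v <- A) l ^- depth v < e].
Proof.
move=> l0 bl e e0.
(* The definition provides only some [m < l] with vanishing infimum; passing to [l] decreases each
   term. *)
have [_ [m [m0 mI] <-]] : exists2 x, [set r%:E | r in [set r : R | 0 < r /\
    ereal_inf (cost r) = 0%E]] x & (x < l%:E)%E by apply: ereal_inf_lt.
rewrite lte_fin => ml.
have [_ [C cC <-]] : exists2 x, cost m x & (x < e%:E)%E by apply: ereal_inf_lt; rewrite mI lte_fin.
have [A [oA hA uA ->]] := cutset_seq (fun v => m ^- depth v) cC.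
rewrite lte_fin => Ae; exists A; split => //; apply: le_lt_trans Ae.
apply: ler_sum => v _; rewrite lef_pV2 ?posrE ?exprn_gt0 //.
by apply: lerXn2r; rewrite ?nnegrE ltW.
Qed.

End Branching.

(** * Independent families *)

Lemma mfun_of d d' (S : measurableType d) (S' : measurableType d') (f : S -> S') :
  measurable_fun setT f -> exists g : {mfun S >-> S'}, g = f :> (S -> S').
Proof. by move=> mf; exists (mfun_Sub (mem_set mf)). Qed.

Section Independence.
Context d (Omega : measurableType d) (R : realType) (P : probability Omega R).
Variables (I : choiceType) (D : set I) (X : I -> {RV P >-> R}).
Hypothesis X_indep : mutually_independent D X.
Implicit Types (A B : set I) (E F : set Omega).

(** The pi-system generating the events that depend on the variables indexed by [A]; stability under
    intersection is what the uniqueness theorem for measures requires. *)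
Definition cyl A : set (set Omega) :=
  [set E | exists (J : {fset I}) (B : I -> set R), [/\ [set` J] `<=` A,
     (forall i, measurable (B i)) & E = \bigcap_(i in [set` J]) (X i @^-1` B i)]].

Definition sigma A : set (set Omega) := <<s cyl A >>.

Definition measurable_in A (U : Omega -> R) :=
  measurable_fun setT (U : g_sigma_algebraType (cyl A) -> R).

Lemma measurable_preimage_rv i (B : set R) : measurable B -> measurable (X i @^-1` B).
Proof. by move=> mB; rewrite -[X in measurable X]setTI; exact: measurable_funP. Qed.

Lemma cyl_measurable A : cyl A `<=` measurable.
Proof.
move=> _ [J [B [_ mB ->]]]; apply: fin_bigcap_measurable; first exact: finite_fset.
by move=> i _; apply: measurable_preimage_rv.
Qed.

Lemma sigma_measurable A : sigma A `<=` measurable.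
Proof. by apply: smallest_sub; [exact: sigma_algebra_measurable|exact: cyl_measurable]. Qed.

Lemma cyl_setI A : setI_closed (cyl A).
Proof.
move=> _ _ [J [B [JA mB ->]]] [J' [B' [JA' mB' ->]]].
exists (J `|` J')%fset, (fun i => (if i \in J then B i else setT) `&`
   (if i \in J' then B' i else setT)); split.
- by move=> i /=; rewrite in_fsetU => /orP[/JA|/JA'].
- by move=> i; apply: measurableI; case: ifP.
apply/seteqP; split => w /=.
  move=> [h h'] i /=; rewrite in_fsetU => _; split.
    by case: ifPn => // iJ; exact: h.
  by case: ifPn => // iJ; exact: h'.
move=> h; split => i /= iJ.
  by have [] := h i; rewrite /= ?in_fsetU iJ.
by have [] := h i; rewrite /= ?in_fsetU iJ ?orbT.
Qed.

Lemma cylT A : cyl A setT.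
Proof.
exists fset0, (fun=> setT); split => //.
by apply/seteqP; split => // w _ i /=.
Qed.

Lemma sigma_sub A B : A `<=` B -> sigma A `<=` sigma B.
Proof.
move=> AB; apply: sub_smallest2r; first exact: smallest_sigma_algebra.
move=> E [J [C [JA mC ->]]].
by exists J, C; split => //; exact: subset_trans AB.
Qed.

Lemma sigma_rv A i (B : set R) : A i -> measurable B -> sigma A (X i @^-1` B).
Proof.
move=> Ai mB; apply: sub_sigma_algebra; exists [fset i]%fset, (fun=> B); split => //.
  by move=> j /=; rewrite in_fset1 => /eqP ->.
apply/seteqP; split => w /=.
  by move=> h j /=; rewrite in_fset1 => /eqP ->.
by move=> /(_ i); apply; rewrite /= in_fset1.
Qed.

Lemma measurable_in_rv A i : A i -> measurable_in A (X i).
Proof. by move=> Ai _ B mB; rewrite setTI; exact: sigma_rv. Qed.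

Lemma measurable_inE A U : measurable_in A U -> measurable_fun setT U.
Proof.
move=> mU _ B mB; apply: (@sigma_measurable A); exact: mU.
Qed.

Lemma measurable_in_sub A B U : A `<=` B -> measurable_in A U -> measurable_in B U.
Proof. by move=> AB mU _ C mC; apply: (sigma_sub AB); exact: mU. Qed.

Lemma measurable_in_sigma A U (B : set R) : measurable_in A U -> measurable B -> sigma A (U @^-1` B).
Proof. by move=> mU mB; rewrite -[X in sigma _ X]setTI; exact: mU. Qed.

Lemma indep_cyl A B E F : A `<=` D -> B `<=` D -> A `&` B = set0 -> cyl A E -> cyl B F ->
  P (E `&` F) = (P E * P F)%E.
Proof.
move=> AD BD AB [J [C [JA mC ->]]] [J' [C' [JB mC' ->]]].
have dis i : i \in J -> i \in J' -> False.
  by move=> /JA Ai /JB Bi; have : (A `&` B) i by []; rewrite AB.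
pose C2 i := if i \in J then C i else C' i.
have -> : (\bigcap_(i in [set` J]) X i @^-1` C i) `&` (\bigcap_(i in [set` J']) X i @^-1` C' i)
    = \bigcap_(i in [set` (J `|` J')%fset]) X i @^-1` C2 i.
  apply/seteqP; split => w /=.
    move=> [h h'] i /=; rewrite in_fsetU /C2; case: ifPn => [iJ _|iJ /= iJ']; first exact: h.
    exact: h'.
  move=> h; split => i /= iJ; have := h i; rewrite /C2 /= in_fsetU iJ ?orbT => /(_ isT) //.
  by case: ifPn => // /dis /(_ iJ).
rewrite !X_indep //.
- rewrite (perm_big (enum_fset J ++ enum_fset J')) /=.
    rewrite big_cat /=; congr (_ * _)%E; rewrite big_seq_cond [RHS]big_seq_cond;
      apply: eq_bigr => i; rewrite andbT /C2 => iJ; first by rewrite iJ.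
    by case: ifPn => // /dis /(_ iJ).
  apply: uniq_perm; rewrite ?fset_uniq //.
    rewrite cat_uniq !fset_uniq andbT /=; apply/hasPn => i iJ'; apply/negP => iJ.
    exact: dis iJ iJ'.
  by move=> i; rewrite in_fsetU mem_cat.
- by move=> i /JB /BD.
- by move=> i /JA /AD.
- by move=> i /=; rewrite in_fsetU => /orP[/JA/AD|/JB/BD].
- by move=> i; rewrite /C2; case: ifP.
Qed.

(** For fixed [F] both sides are finite measures in [E] that agree on a pi-system. Used once in each
    argument, this carries independence from cylinders to sigma-algebras. *)
Lemma indep_sigma_of_cyl A (F : set Omega) : measurable F ->
  (forall E, cyl A E -> P (E `&` F) = (P E * P F)%E) ->
  forall E, sigma A E -> P (E `&` F) = (P E * P F)%E.
Proof.
move=> mF h E sE.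
have PF : P F = (fine (P F))%:E by rewrite fineK // fin_num_measure.
have F0 : 0 <= fine (P F) by apply: fine_ge0; exact: measure_ge0.
pose m1 := mrestr P mF; pose m2 := mscale (NngNum F0) P.
have -> : (P E * P F)%E = m2 E by rewrite /m2 /mscale /= muleC -PF.
apply: (@g_sigma_algebra_measure_unique _ R Omega (cyl A) (@cyl_measurable A)
  (fun=> setT) _ _ m1 m2) => //.
- by move=> _; exact: cylT.
- by apply/seteqP; split => // w _; exists 0%N.
- exact: cyl_setI.
- by move=> G cG; rewrite [LHS](h G cG) [X in (_ * X)%E]PF muleC.
- move=> _; change (P (setT `&` F) < +oo)%E; rewrite setTI.
  by apply: le_lt_trans (probability_le1 P mF) _; exact: ltry.
Qed.

Lemma indep_sigma A B E F : A `<=` D -> B `<=` D -> A `&` B = set0 ->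
  sigma A E -> sigma B F -> P (E `&` F) = (P E * P F)%E.
Proof.
move=> AD BD AB sE sF; apply: (indep_sigma_of_cyl (sigma_measurable sF) _ sE) => G cG.
rewrite setIC muleC; apply: (indep_sigma_of_cyl (cyl_measurable cG) _ sF) => G' cG'.
by apply: (indep_cyl BD AD _ cG' cG); rewrite setIC.
Qed.

(** Independence of the sigma-algebras makes the joint law of [(U, V)] the product of the two laws;
    the rest is Tonelli's theorem. The general [G] is needed for the recursion of the running
    maximum. *)
Lemma indep_integral A B U V (G : R * R -> \bar R) : A `<=` D -> B `<=` D -> A `&` B = set0 ->
  measurable_in A U -> measurable_in B V -> measurable_fun setT G -> (forall z, (0 <= G z)%E) ->
  (\int[P]_w G (U w, V w) = \int[P]_w \int[P]_w' G (U w, V w'))%E.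
Proof.
move=> AD BD AB mU mV mG G0.
have [u uE] := mfun_of (measurable_inE mU); have [v vE] := mfun_of (measurable_inE mV).
have [z zE] := mfun_of (measurable_fun_pair (measurable_inE mU) (measurable_inE mV)).
have joint (C : set (R * R)) : measurable C ->
    (distribution P u \x distribution P v)%E C = distribution P z C.
  move=> mC; apply: product_measure_unique => // C1 C2 mC1 mC2.
  change (P (z @^-1` (C1 `*` C2)) = (P (u @^-1` C1) * P (v @^-1` C2))%E).
  rewrite uE vE zE.
  rewrite -(@indep_sigma A B) //; try exact: measurable_in_sigma.
transitivity (\int[distribution P z]_c G c)%E.
  by rewrite ge0_integral_distribution //; apply: eq_integral => w _; rewrite /= zE.
transitivity (\int[distribution P u \x distribution P v]_c G c)%E.
  by apply: eq_measure_integral => C mC _; first [exact: joint|exact: esym (joint C mC)].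
rewrite fubini_tonelli1 // ge0_integral_distribution.
- apply: eq_integral => w _; rewrite /= /fubini_F ge0_integral_distribution /=.
  + by apply: eq_integral => w' _; rewrite /= uE vE.
  + by apply: measurableT_comp => //; exact: measurable_pair1.
  + by move=> y.
- exact: measurable_fun_fubini_tonelli_F.
- by move=> y; apply: integral_ge0.
Qed.

Lemma indep_mul A B U V : A `<=` D -> B `<=` D -> A `&` B = set0 ->
  measurable_in A U -> measurable_in B V -> (forall w, 0 <= U w) -> (forall w, 0 <= V w) ->
  (\int[P]_w (U w * V w)%:E = (\int[P]_w (U w)%:E) * (\int[P]_w (V w)%:E))%E.
Proof.
move=> AD BD AB mU mV U0 V0.
(* The absolute value makes [G] nonnegative on the whole plane; on the values taken by [U] and [V]
   it changes nothing. *)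
pose G (z : R * R) := `|(z.1 * z.2)%:E|%E.
transitivity (\int[P]_w G (U w, V w))%E.
  by apply: eq_integral => w _; rewrite /G /= ger0_norm // mulr_ge0.
rewrite (indep_integral AD BD AB mU mV); last first.
- by move=> z; rewrite /G abse_ge0.
- by apply: measurableT_comp => //; apply/measurable_EFinP; apply: measurable_funM.
have mU' := measurable_inE mU; have mV' := measurable_inE mV.
rewrite -ge0_integralZr //; last 3 first.
- exact/measurable_EFinP.
- by move=> w _; rewrite lee_fin.
- by apply: integral_ge0 => w _; rewrite lee_fin.
apply: eq_integral => w _; rewrite -ge0_integralZl //; last 3 first.
- exact/measurable_EFinP.
- by move=> w' _; rewrite lee_fin.
- by rewrite lee_fin.
by apply: eq_integral => w' _; rewrite /G /= ger0_norm ?mulr_ge0 // EFinM.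
Qed.

End Independence.

(** * Bounded random variables *)

Lemma measurable_ge d (S : measurableType d) (R : realType) (f : S -> R) (c : R) :
  measurable_fun setT f -> measurable [set w | c <= f w].
Proof.
move=> mf; have := mf measurableT `[c, +oo[%classic (measurable_itv _); rewrite setTI.
congr measurable; apply/seteqP; split => w /=; rewrite in_itv /= andbT //.
Qed.

Lemma measurable_le d (S : measurableType d) (R : realType) (f : S -> R) (c : R) :
  measurable_fun setT f -> measurable [set w | f w <= c].
Proof.
move=> mf; have := mf measurableT `]-oo, c]%classic (measurable_itv _); rewrite setTI.
congr measurable; apply/seteqP; split => w /=; rewrite in_itv //.
Qed.

Lemma measurable_gt d (S : measurableType d) (R : realType) (f : S -> R) (c : R) :
  measurable_fun setT f -> measurable [set w | c < f w].
Proof.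
move=> mf; have -> : [set w | c < f w] = ~` [set w | f w <= c].
  by apply/seteqP; split => w /=; rewrite ltNge => /negP.
exact/measurableC/measurable_le.
Qed.

Lemma measurable_lt d (S : measurableType d) (R : realType) (f : S -> R) (c : R) :
  measurable_fun setT f -> measurable [set w | f w < c].
Proof.
move=> mf; have -> : [set w | f w < c] = ~` [set w | c <= f w].
  by apply/seteqP; split => w /=; rewrite ltNge => /negP.
exact/measurableC/measurable_ge.
Qed.

Section Mean.
Context d (Omega : measurableType d) (R : realType) (P : probability Omega R).
Implicit Types (f g : Omega -> R).

Definition bounded_rv f := measurable_fun setT f /\ exists C, forall w, `|f w| <= C.

Definition mean f : R := fine (\int[P]_w (f w)%:E)%E.

Lemma bounded_integrable f : bounded_rv f -> P.-integrable setT (EFin \o f).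
Proof.
move=> [mf [C fC]]; apply: measurable_bounded_integrable => //.
  by rewrite [X in (X < _)%E]probability_setT ltry.
exists C; split; first exact: num_real.
by move=> x Cx w _; apply: le_trans (fC w) (ltW Cx).
Qed.

Lemma bounded_rvE f : bounded_rv f -> (\int[P]_w (f w)%:E)%E = (mean f)%:E.
Proof.
by move=> bf; rewrite /mean fineK //; exact: (integrable_fin_num measurableT (bounded_integrable bf)).
Qed.

Lemma bounded_cst c : bounded_rv (cst c).
Proof. by split; [exact: measurable_cst|exists `|c|]. Qed.

Lemma bounded_add f g : bounded_rv f -> bounded_rv g -> bounded_rv (fun w => f w + g w).
Proof.
move=> [mf [C fC]] [mg [C' gC]]; split; first exact: measurable_funD.
by exists (C + C') => w; apply: le_trans (ler_normD _ _) _; apply: lerD.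
Qed.

Lemma bounded_mul f g : bounded_rv f -> bounded_rv g -> bounded_rv (fun w => f w * g w).
Proof.
move=> [mf [C fC]] [mg [C' gC]]; split; first exact: measurable_funM.
by exists (C * C') => w; rewrite normrM; apply: ler_pM.
Qed.

Lemma bounded_scale c f : bounded_rv f -> bounded_rv (fun w => c * f w).
Proof. exact: (bounded_mul (bounded_cst c)). Qed.

Lemma bounded_sum (I : eqType) (s : seq I) (F : I -> Omega -> R) :
  (forall i, i \in s -> bounded_rv (F i)) -> bounded_rv (fun w => \sum_(i <- s) F i w).
Proof.
elim: s => [_|i s IH h].
  by rewrite (_ : (fun _ => _) = cst 0) //; [exact: bounded_cst|apply/funext => w; rewrite big_nil].
rewrite (_ : (fun _ => _) = fun w => F i w + \sum_(j <- s) F j w); last first.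
  by apply/funext => w; rewrite big_cons.
apply: bounded_add; first by apply: h; rewrite inE eqxx.
by apply: IH => j js; apply: h; rewrite inE js orbT.
Qed.

Lemma bounded_indic (E : set Omega) : measurable E -> bounded_rv (\1_E).
Proof.
move=> mE; split; first exact: measurable_indic.
by exists 1 => w; rewrite indicE; case: (_ \in _); rewrite ?normr1 ?normr0.
Qed.

Lemma mean_add f g : bounded_rv f -> bounded_rv g -> mean (fun w => f w + g w) = mean f + mean g.
Proof.
by move=> bf bg; apply: (RintegralD measurableT); exact: bounded_integrable.
Qed.

Lemma mean_scale c f : bounded_rv f -> mean (fun w => c * f w) = c * mean f.
Proof. by move=> bf; exact: (RintegralZl c measurableT (bounded_integrable bf)). Qed.

Lemma mean_sub f g : bounded_rv f -> bounded_rv g -> mean (fun w => f w - g w) = mean f - mean g.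
Proof.
by move=> bf bg; apply: (RintegralB measurableT); exact: bounded_integrable.
Qed.

Lemma mean_le f g : bounded_rv f -> bounded_rv g -> (forall w, f w <= g w) -> mean f <= mean g.
Proof.
by move=> bf bg h; apply: (le_Rintegral measurableT) => //; exact: bounded_integrable.
Qed.

Lemma mean_ge0 f : (forall w, 0 <= f w) -> 0 <= mean f.
Proof. by move=> f0; apply: fine_ge0; apply: integral_ge0 => w _; rewrite lee_fin. Qed.

Lemma mean_cst c : mean (cst c) = c.
Proof.
have := integral_cst P measurableT c%:E; rewrite [X in (_ * X)%E]probability_setT mule1.
by rewrite /mean => ->.
Qed.

Lemma mean_sum (I : eqType) (s : seq I) (F : I -> Omega -> R) :
  (forall i, i \in s -> bounded_rv (F i)) ->
  mean (fun w => \sum_(i <- s) F i w) = \sum_(i <- s) mean (F i).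
Proof.
elim: s => [_|i s IH h].
  by rewrite (_ : (fun _ => _) = cst 0) ?mean_cst ?big_nil //; apply/funext => w; rewrite big_nil.
rewrite (_ : (fun _ => _) = fun w => F i w + \sum_(j <- s) F j w); last first.
  by apply/funext => w; rewrite big_cons.
rewrite mean_add ?big_cons ?IH //.
- by move=> j js; apply: h; rewrite inE js orbT.
- by apply: h; rewrite inE eqxx.
- by apply: bounded_sum => j js; apply: h; rewrite inE js orbT.
Qed.

Lemma mean_indic (E : set Omega) : measurable E -> (mean (\1_E))%:E = P E.
Proof. by move=> mE; rewrite -bounded_rvE ?integral_indic ?setIT //; exact: bounded_indic. Qed.

Lemma eq_mean f g : f =1 g -> mean f = mean g.
Proof. by move/funext => ->. Qed.

End Mean.

Section IID.
Context d (Omega : measurableType d) (R : realType) (P : probability Omega R).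
Context d' (Omega' : measurableType d') (P' : probability Omega' R).
Variables (I : choiceType) (D : set I) (X : I -> {RV P >-> R}) (X0 : {RV P' >-> R}).
Hypothesis X_indep : mutually_independent D X.
Hypothesis X_law : forall i, D i -> same_law (X i) X0.
Implicit Types (A B : set I) (s : seq I).

Lemma law_integral i (g : R -> \bar R) : D i -> measurable_fun setT g -> (forall y, (0 <= g y)%E) ->
  (\int[P]_w g (X i w) = \int[P']_w g (X0 w))%E.
Proof.
move=> Di mg g0; rewrite -(ge0_integral_distribution (X i) mg g0).
rewrite -(ge0_integral_distribution X0 mg g0).
by apply: eq_measure_integral => C mC _; exact: (X_law Di mC).
Qed.

Lemma measurable_in_comp A i (g : R -> R) : A i -> measurable_fun setT g ->
  measurable_in X A (fun w => g (X i w)).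
Proof. by move=> Ai mg; apply: measurableT_comp => //; exact: measurable_in_rv. Qed.

Lemma measurable_in_sum A s (g : R -> R) : [set` s] `<=` A -> measurable_fun setT g ->
  measurable_in X A (fun w => \sum_(i <- s) g (X i w)).
Proof.
move=> sA mg; rewrite (_ : (fun _ => _) =
    fun w => \sum_(i <- s) (if i \in s then g (X i w) else 0)); last first.
  by apply/funext => w; apply: eq_big_seq => i ->.
apply: measurable_sum => i; case: (boolP (i \in s)) => is_; first by apply: measurable_in_comp => //; exact: sA.
exact: measurable_cst.
Qed.

Lemma measurable_in_prod A s (g : R -> R) : [set` s] `<=` A -> measurable_fun setT g ->
  measurable_in X A (fun w => \prod_(i <- s) g (X i w)).
Proof.
by move=> sA mg; apply: measurable_prod => i is_; apply: measurable_in_comp => //; exact: sA.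
Qed.

Lemma mean_prod s (g : R -> R) (a : R) : uniq s -> [set` s] `<=` D ->
  measurable_fun setT g -> (forall y, 0 <= g y) -> (\int[P']_w (g (X0 w))%:E)%E = a%:E ->
  (\int[P]_w (\prod_(i <- s) g (X i w))%:E)%E = (a ^+ size s)%:E.
Proof.
move=> + + mg g0 ga; elim: s => [_ _|i s IH /= /andP[is_ us] sD].
  under eq_integral do rewrite big_nil.
  have := integral_cst P measurableT 1%E; rewrite [X in (_ * X)%E]probability_setT mule1.
  by rewrite expr0.
under eq_integral do rewrite big_cons.
have Di : D i by apply: sD; rewrite /= inE eqxx.
have sD' : [set` s] `<=` D by move=> j js; apply: sD; rewrite /= inE js orbT.
rewrite (@indep_mul _ _ _ _ _ _ _ X_indep [set i] [set` s]) //.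
- rewrite IH // (law_integral Di (g := EFin \o g)) //=; last exact/measurable_EFinP.
  by rewrite ga -EFinM exprS.
- by move=> _ ->.
- by apply/seteqP; split => // j [-> js]; rewrite /= js in is_.
- exact: measurable_in_comp.
- exact: measurable_in_prod.
- by move=> w; apply: prodr_ge0.
Qed.

(** Markov's inequality for the exponential of the sum, whose mean factors. A general [h] covers
    both the large deviations of [X] and the truncated variables of the strong law. *)
Lemma chernoff s (h : R -> R) (a : R) : uniq s -> [set` s] `<=` D -> measurable_fun setT h ->
  (\int[P']_w (expR (h (X0 w)))%:E)%E = a%:E ->
  (P [set w | (0 <= \sum_(i <- s) h (X i w))%R] <= (a ^+ size s)%:E)%E.
Proof.
move=> us sD mh xa.
have mg : measurable_fun setT (fun z : R => expR (h z)) by exact: measurableT_comp.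
have mS := measurable_inE (measurable_in_sum sD mh).
rewrite -(mean_prod us sD mg) //.
have mE : measurable [set w | 0 <= \sum_(i <- s) h (X i w)] by exact: measurable_ge.
rewrite -[X in P X]setIT -integral_indic //; apply: ge0_le_integral => //.
- exact/measurable_EFinP/measurable_indic.
- apply/measurable_EFinP; exact: (measurable_inE (measurable_in_prod sD mg)).
move=> w _; rewrite lee_fin indicE -expR_sum.
case: (boolP (w \in _)) => [|_]; last exact: expR_ge0.
by rewrite inE /= => h0; apply: le_trans (expR_ge1Dx _); rewrite lerDl.
Qed.

End IID.

(** * Exponential tilting of bounded laws *)

Lemma geometric_small (R : realType) (r e : R) : 0 <= r -> r < 1 -> 0 < e ->
  exists K, forall k, (K <= k)%N -> r ^+ k <= e.
Proof.
move=> r0 r1 e0.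
have : (fun k => r ^+ k) @ \oo --> (0 : R) by apply: cvg_expr; rewrite ger0_norm.
move/cvgrPdist_le => /(_ e e0)[K _ KP]; exists K => k Kk.
by have := KP k Kk; rewrite /= sub0r normrN ger0_norm // exprn_ge0.
Qed.

(** With [a = expR (x / 2)] and [b = 1 / a] the excess over 2 is [(a - b)^2], and [1 - x <= b^2]
    multiplied by [a] gives [a - b <= a x]. *)
Lemma expR_cosh_le (R : realType) (z L : R) : `|z| <= L -> expR z + expR (- z) <= 2 + L ^+ 2 * expR L.
Proof.
have pos (x : R) : 0 <= x -> x <= L -> expR x + expR (- x) <= 2 + L ^+ 2 * expR L.
  move=> x0 xL; set a := expR (x / 2).
  have a0 : 0 < a by exact: expR_gt0.
  have -> : expR x = a ^+ 2 by rewrite -expRM_natl mulrC divfK.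
  have -> : expR (- x) = a^-1 ^+ 2 by rewrite exprVn -(expRM_natl 2 (x/2)) mulrC divfK // expRN.
  have i1 : 1 - x <= a^-1 ^+ 2.
    by rewrite exprVn -(expRM_natl 2 (x/2)) mulrC divfK // -expRN; exact: expR_ge1Dx.
  have i2 : a ^+ 2 <= expR L by rewrite -expRM_natl mulrC divfK // ler_expR.
  have i3 : a * a^-1 = 1 by rewrite mulfV // gt_eqF.
  set b := a^-1 in i1 i3 *.
  have b1 : b <= 1 by rewrite invf_le1 // -(@expR0 R) ler_expR divr_ge0.
  have i4 : a - b <= a * x.
    have : a * (1 - x) <= a * b ^+ 2 by rewrite ler_wpM2l // ltW.
    by rewrite expr2 mulrA i3 mul1r mulrBr mulr1; lra.
  have i5 : 0 <= a - b.
    by rewrite subr_ge0 (le_trans b1) // -(@expR0 R) ler_expR divr_ge0.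
  have i6 : (a - b) ^+ 2 <= (a * x) ^+ 2 by rewrite lerXn2r ?nnegrE // (le_trans i5).
  have i7 : (a * x) ^+ 2 <= L ^+ 2 * expR L.
    rewrite exprMn mulrC; apply: ler_pM => //; rewrite ?exprn_ge0 ?(ltW a0) //.
    by rewrite lerXn2r ?nnegrE // (le_trans x0).
  have e : a ^+ 2 + b ^+ 2 = 2 + (a - b) ^+ 2 by rewrite sqrrB -mulr_natr i3; lra.
  by rewrite e lerD2l (le_trans i6).
move=> zL; have [z0|z0] := leP 0 z; first by apply: pos => //; exact: le_trans (ler_norm z) zL.
rewrite addrC -{2}(opprK z); apply: pos; first by rewrite oppr_ge0 ltW.
by rewrite -(ltr0_norm z0).
Qed.

Section Box.
Context d' (Omega' : measurableType d') (R : realType) (P' : probability Omega' R).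
Variables (X0 : {RV P' >-> R}) (B : set R) (y L : R).
Hypothesis mB : measurable B.
Hypothesis BL : forall b, B b -> `|b - y| <= L.

(** Integration against the law of [X0] restricted to [B] without renormalization: the lost mass
    enters the probability of a typical block. *)
Definition box_mean (g : R -> R) : R := mean P' (fun w => \1_B (X0 w) * g (X0 w)).

Definition box_mgf x := box_mean (fun z => expR (x * (z - y))).

Lemma measurable_tilt x : measurable_fun setT (fun z : R => expR (x * (z - y))).
Proof.
by apply: measurableT_comp => //; apply: measurable_funM => //; exact: measurable_funB.
Qed.

Lemma box_bounded (g : R -> R) (C : R) : measurable_fun setT g -> (forall b, B b -> `|g b| <= C) ->
  bounded_rv (fun w => \1_B (X0 w) * g (X0 w)).
Proof.
move=> mg gC; split.
  apply: measurable_funM; first exact: (measurableT_comp (measurable_indic mB)).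
  exact: measurableT_comp.
exists `|C| => w; rewrite indicE; case: (boolP (_ \in _)) => [|_].
  by rewrite inE mul1r => /gC; move=> h; apply: le_trans h (ler_norm _).
by rewrite mul0r normr0.
Qed.

Lemma box_mean_le (g h : R -> R) (C : R) : measurable_fun setT g -> measurable_fun setT h ->
  (forall b, B b -> `|g b| <= C) -> (forall b, B b -> `|h b| <= C) ->
  (forall b, B b -> g b <= h b) -> box_mean g <= box_mean h.
Proof.
move=> mg mh gC hC gh; apply: mean_le; [exact: box_bounded gC|exact: box_bounded hC|].
move=> w; rewrite indicE; case: (boolP (_ \in _)) => [|_]; last by rewrite !mul0r.
by rewrite inE !mul1r => /gh.
Qed.

Lemma box_mean_scale c (g : R -> R) (C : R) : measurable_fun setT g -> (forall b, B b -> `|g b| <= C) ->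
  box_mean (fun z => c * g z) = c * box_mean g.
Proof.
move=> mg gC; rewrite /box_mean -mean_scale; last exact: box_bounded gC.
by apply: eq_mean => w; rewrite mulrCA.
Qed.

Lemma box_mean_add (g h : R -> R) (C : R) : measurable_fun setT g -> measurable_fun setT h ->
  (forall b, B b -> `|g b| <= C) -> (forall b, B b -> `|h b| <= C) ->
  box_mean (fun z => g z + h z) = box_mean g + box_mean h.
Proof.
move=> mg mh gC hC; rewrite /box_mean -mean_add; [|exact: box_bounded gC|exact: box_bounded hC].
by apply: eq_mean => w; rewrite mulrDr.
Qed.

Lemma tilt_bound A x b : `|x| <= A -> B b -> `|expR (x * (b - y))| <= expR (A * L).
Proof.
move=> xA Bb; rewrite ger0_norm ?expR_ge0 // ler_expR.
apply: le_trans (ler_norm _) _; rewrite normrM; apply: ler_pM => //; exact: BL.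
Qed.

Lemma box_mgfE x : (\int[P']_w (\1_B (X0 w) * expR (x * (X0 w - y)))%:E)%E = (box_mgf x)%:E.
Proof.
rewrite bounded_rvE //; apply: (@box_bounded (fun z => expR (x * (z - y))) (expR (`|x| * L))); first exact: measurable_tilt.
by move=> b Bb; apply: tilt_bound.
Qed.

Lemma box_mgf_ge0 x : 0 <= box_mgf x.
Proof.
by apply: mean_ge0 => w; rewrite mulr_ge0 ?expR_ge0 // indicE; case: (_ \in _).
Qed.

(** The exponent changes by at most [|h| L] on [B]. Exchanging [x] and [x + h] gives the opposite
    bound, hence continuity. *)
Lemma box_mgf_lip x h : 0 <= L -> expR (- (`|h| * L)) * box_mgf x <= box_mgf (x + h).
Proof.
move=> L0; pose A := `|x| + `|h|.
have xA : `|x| <= A by rewrite lerDl.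
have hA : `|x + h| <= A by exact: ler_normD.
rewrite -(@box_mean_scale _ _ (expR (A * L))); first last.
- by move=> b; apply: tilt_bound.
- exact: measurable_tilt.
apply: (@box_mean_le _ _ (expR (A * L))).
- by apply: measurable_funM => //; exact: measurable_tilt.
- exact: measurable_tilt.
- move=> b Bb; rewrite normrM -[leRHS]mul1r; apply: ler_pM => //; last exact: tilt_bound.
  by rewrite ger0_norm ?expR_ge0 // -(@expR0 R) ler_expR oppr_le0 mulr_ge0.
- by move=> b; apply: tilt_bound.
move=> b Bb; rewrite -expRD ler_expR mulrDl addrC lerD2l -lerNl.
apply: le_trans (ler_norm _) _; rewrite normrN normrM.
by apply: ler_pM => //; exact: BL.
Qed.

Lemma box_mgf_convex x s : 0 <= s -> s <= 1 -> 0 <= L ->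
  box_mgf (x + s) + box_mgf (x - s) <= (2 + s ^+ 2 * (L ^+ 2 * expR L)) * box_mgf x.
Proof.
move=> s0 s1 L0; pose A := `|x| + s.
have xA : `|x| <= A by rewrite lerDl.
have hA : `|x + s| <= A by rewrite /A -{2}(ger0_norm s0); exact: ler_normD.
have hB : `|x - s| <= A by rewrite /A -{2}(ger0_norm s0) -(normrN s); exact: ler_normD.
set c := _ + _ * _.
have c0 : 0 <= c by rewrite addr_ge0 // !mulr_ge0 ?exprn_ge0 ?expR_ge0.
rewrite -(@box_mean_scale _ _ (expR (A * L))); first last.
- by move=> b; apply: tilt_bound.
- exact: measurable_tilt.
rewrite -(@box_mean_add _ _ (expR (A * L))); first last.
- by move=> b; apply: tilt_bound.
- by move=> b; apply: tilt_bound.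
- exact: measurable_tilt.
- exact: measurable_tilt.
apply: (@box_mean_le _ _ (2 * expR (A * L) + c * expR (A * L))).
- by apply: measurable_funD => //; exact: measurable_tilt.
- by apply: measurable_funM => //; exact: measurable_tilt.
- move=> b Bb; apply: le_trans (ler_normD _ _) _.
  have := tilt_bound hA Bb; have := tilt_bound hB Bb => h1 h2.
  have : 0 <= c * expR (A * L) by rewrite mulr_ge0 // expR_ge0.
  by lra.
- move=> b Bb; rewrite normrM (ger0_norm c0).
  have h1 : c * `|expR (x * (b - y))| <= c * expR (A * L) by rewrite ler_wpM2l // tilt_bound.
  have := expR_ge0 (A * L); lra.
move=> b Bb; rewrite (mulrDl x s) (mulrBl _ x s) !expRD -mulrDr [leRHS]mulrC ler_wpM2l ?expR_ge0 //.
have /expR_cosh_le : `|s * (b - y)| <= s * L.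
  by rewrite normrM (ger0_norm s0) ler_wpM2l // BL.
move=> h; apply: le_trans h _; rewrite /c lerD2l exprMn -mulrA ler_wpM2l ?exprn_ge0 //.
by rewrite ler_wpM2l ?exprn_ge0 // ler_expR ler_piMl.
Qed.

End Box.

Lemma bounded_prod d (Omega : measurableType d) (R : realType) (I : eqType) (s : seq I)
  (F : I -> Omega -> R) :
  (forall i, i \in s -> bounded_rv (F i)) -> bounded_rv (fun w => \prod_(i <- s) F i w).
Proof.
elim: s => [_|i s IH h].
  rewrite (_ : (fun _ => _) = cst 1); last by apply/funext => w; rewrite big_nil.
  exact: bounded_cst.
rewrite (_ : (fun _ => _) = fun w => F i w * \prod_(j <- s) F j w); last first.
  by apply/funext => w; rewrite big_cons.
apply: bounded_mul; first by apply: h; rewrite inE eqxx.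
by apply: IH => j js; apply: h; rewrite inE js orbT.
Qed.

Lemma le_of_sum_le (R : realFieldType) (a b c m : R) : m <= a -> m <= b ->
  a + b <= (2 + c) * m -> a <= (1 + c) * m /\ b <= (1 + c) * m.
Proof. by move=> ma mb h; split; lra. Qed.

Lemma exponent_gain (R : realFieldType) (s e C : R) : 0 <= s -> s * C <= e / 2 ->
  - (s * e) + s * s * C <= - (s * e / 2).
Proof. by move=> s0 sC; have := ler_wpM2l s0 sC; lra. Qed.

Lemma half_absorb (R : realFieldType) (a q x y z : R) : a <= q + (x + y) ->
  x <= z -> y <= z -> z <= a * 4^-1 -> a / 2 <= q.
Proof. by lra. Qed.

Section Steady.
Context d (Omega : measurableType d) (R : realType) (P : probability Omega R).
Context d' (Omega' : measurableType d') (P' : probability Omega' R).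
Variables (I : choiceType) (D : set I) (X : I -> {RV P >-> R}) (X0 : {RV P' >-> R}).
Hypothesis X_indep : mutually_independent D X.
Hypothesis X_law : forall i, D i -> same_law (X i) X0.
Implicit Types (l : seq I).

(** The bound on all increments serves the averages at times inside the block, which the first
    condition does not see. *)
Definition typical (y M e : R) l : set Omega :=
  [set w | `|\sum_(i <- l) (X i w - y)| <= e * (size l)%:R /\
           all (fun i => `|X i w| <= M) l].

(** A probability [u] per edge for typical blocks, at every tolerance once the block is long enough;
    [M] does not depend on the tolerance. *)
Definition steady (y u M : R) := forall e, 0 < e -> exists K, forall l,
  uniq l -> [set` l] `<=` D -> (K <= size l)%N ->
  ((u ^+ size l)%:E <= P (typical y M e l))%E.

Lemma typical_sigma y M e l A : [set` l] `<=` A -> sigma X A (typical y M e l).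
Proof.
move=> lA.
pose S w := `|\sum_(i <- l) (X i w - y)|.
have mS : measurable_fun setT (S : g_sigma_algebraType (cyl X A) -> R).
  apply: measurableT_comp => //.
  by apply: (measurable_in_sum (g := fun z => z - y)) => //; exact: measurable_funB.
have -> : typical y M e l = [set w | S w <= e * (size l)%:R] `&`
    \bigcap_(i in [set` l]) [set w | `|X i w| <= M].
  apply/seteqP; split => w [h1 h2]; split => //; first by move=> i /= il; exact: (allP h2).
  by apply/allP => i il; exact: h2.
apply: (@measurableI _ (g_sigma_algebraType (cyl X A))); first exact: measurable_le.
apply: (@fin_bigcap_measurable _ (g_sigma_algebraType (cyl X A))); first exact: finite_seq.
move=> i /lA Ai; apply: (@measurable_le _ (g_sigma_algebraType (cyl X A))).
by apply: measurableT_comp => //; exact: measurable_in_rv.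
Qed.

Lemma typical_measurable y M e l : measurable (typical y M e l).
Proof. exact: sigma_measurable (typical_sigma y M e (@subset_refl _ [set` l])). Qed.

Lemma le_typical y M e e' l : e <= e' -> typical y M e l `<=` typical y M e' l.
Proof.
by move=> ee w [h1 h2]; split => //; apply: le_trans h1 _; rewrite ler_wpM2r.
Qed.

Section Tilt.
Variables (B : set R) (y L : R).
Hypothesis mB : measurable B.
Hypothesis BL : forall b, B b -> `|b - y| <= L.
Hypothesis L0 : 0 <= L.

Let w_ x z := \1_B z * expR (x * (z - y)).

Let mw x : measurable_fun setT (w_ x).
Proof.
by apply: measurable_funM; [exact: measurable_indic|exact: measurable_tilt].
Qed.

Let w0 x z : 0 <= w_ x z.
Proof. by rewrite mulr_ge0 ?expR_ge0 // indicE; case: (_ \in _). Qed.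

Let bw x i : bounded_rv (fun w => w_ x (X i w)).
Proof.
apply: (box_bounded (X i) mB (g := fun z => expR (x * (z - y))) (C := expR (`|x| * L))).
  exact: measurable_tilt.
by move=> b Bb; exact: (tilt_bound BL).
Qed.

Let bprod x l : bounded_rv (fun w => \prod_(i <- l) w_ x (X i w)).
Proof. by apply: bounded_prod => i _; exact: bw. Qed.

Let mprod x l : uniq l -> [set` l] `<=` D ->
  mean P (fun w => \prod_(i <- l) w_ x (X i w)) = box_mgf X0 B y x ^+ size l.
Proof.
move=> ul lD; apply: EFin_inj; rewrite -bounded_rvE //.
by apply: (mean_prod X_indep X_law ul lD (mw x) (w0 x)); exact: (box_mgfE X0 mB BL x).
Qed.

(** A pointwise inequality, integrated; no tilted measure is built. On the typical event
    [expR (t S)] is at most [expR (|t| e k)]; off it [|S| > e k], so one of the two terms shifted by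
    [s] or [- s] dominates. *)
Lemma tilted_typical (t s e : R) l : uniq l -> [set` l] `<=` D -> 0 <= s -> 0 < e ->
  box_mgf X0 B y t ^+ size l <=
  expR (`|t| * e * (size l)%:R) * fine (P (typical y (`|y| + L) e l)) +
  expR (- (s * e * (size l)%:R)) *
    (box_mgf X0 B y (t + s) ^+ size l + box_mgf X0 B y (t - s) ^+ size l).
Proof.
move=> ul lD s0 e0; set k := (size l)%:R : R; set G := typical _ _ _ _.
have mG : measurable G by exact: typical_measurable.
have -> : fine (P G) = mean P (\1_G) by apply: EFin_inj; rewrite mean_indic // fineK // fin_num_measure.
have b1' := bounded_indic R mG.
rewrite -!mprod // mulrDr -(mean_scale P _ b1') -!(mean_scale P _ (bprod _ l)).
have b1 := bounded_scale (expR (`|t| * e * k)) b1'.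
have b2 := bounded_scale (expR (- (s * e * k))) (bprod (t + s) l).
have b3 := bounded_scale (expR (- (s * e * k))) (bprod (t - s) l).
rewrite -(mean_add P b2 b3) -mean_add //; last exact: bounded_add.
apply: mean_le => //; first by apply: bounded_add => //; exact: bounded_add.
move=> w; have pr0 x : 0 <= \prod_(i <- l) w_ x (X i w) by apply: prodr_ge0.
(* Unless all increments lie in [B] the left side is 0, so the bound on increments comes for
   free. *)
have [allB|nallB] := boolP (all (fun i => X i w \in B) l); last first.
  rewrite (_ : \prod_(i <- l) w_ t (X i w) = 0).
    by rewrite !addr_ge0 // mulr_ge0 ?expR_ge0 // indicE; case: (_ \in _).
  move/allPn: nallB => [i il iB]; rewrite (big_rem i il) /= /w_ indicE (negbTE iB).
  by rewrite !mul0r.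
pose S := \sum_(i <- l) (X i w - y).
have prE x : \prod_(i <- l) w_ x (X i w) = expR (x * S).
  rewrite /S mulr_sumr expR_sum; apply: eq_big_seq => i il.
  by rewrite /w_ indicE (allP allB i il) mul1r.
rewrite !prE.
have allM : all (fun i => `|X i w| <= `|y| + L) l.
  apply/allP => i il; have := allP allB i il; rewrite inE => /BL h.
  by rewrite -[X i w](subrK y) addrC; apply: le_trans (ler_normD _ _) _; rewrite lerD2l.
have [hS|hS] := leP `|S| (e * k).
  rewrite indicE mem_set; last by split.
  rewrite mulr1 -[leLHS]addr0; apply: lerD.
    rewrite ler_expR; apply: le_trans (ler_norm _) _; rewrite normrM -mulrA.
    by rewrite ler_wpM2l.
  by rewrite addr_ge0 // mulr_ge0 ?expR_ge0.
apply: (@le_trans _ _ (expR (- (s * e * k)) * expR ((t + s) * S) +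
   expR (- (s * e * k)) * expR ((t - s) * S))); last first.
  by rewrite lerDr mulr_ge0 ?expR_ge0 // indicE; case: (_ \in _).
rewrite -!expRD; move: hS; rewrite lter_normr => /orP[hS|hS].
  rewrite -[leLHS]addr0; apply: lerD; last exact: expR_ge0.
  rewrite ler_expR mulrDl addrCA lerDl -mulrA addrC subr_ge0 ler_wpM2l //; exact: ltW.
rewrite -[leLHS]add0r; apply: lerD; first exact: expR_ge0.
rewrite ler_expR mulrDl addrCA lerDl -mulrA mulNr addrC -mulrN subr_ge0 ler_wpM2l //; exact: ltW.
Qed.

(* On the tilted law use 1_{|D| <= e k} >= 1 - exp(s (D - e k)) - exp(s (- D - e k)); since t
   minimizes the transform, both exponential terms are negligible for small s. *)
Lemma tilted_steady (t u : R) : 0 < u -> u < box_mgf X0 B y t ->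
  (forall x, box_mgf X0 B y t <= box_mgf X0 B y x) -> steady y u (`|y| + L).
Proof.
move=> u0 ut tmin e0 e0pos; set ph := box_mgf X0 B y t in ut tmin.
have ph0 : 0 < ph by exact: lt_trans ut.
(* A smaller tolerance is allowed, since typical events grow with it; a small [e] makes the price
   [expR (|t| e)] per edge of undoing the tilt fit between [u] and the minimum [ph]. *)
have [e [epos ee0 eu]] : exists e, [/\ 0 < e, e <= e0 & u < ph * expR (- (`|t| * e))].
  have q1 : 0 < ln (ph / u) by apply: ln_gt0; rewrite ltr_pdivlMr // mul1r.
  exists (Num.min e0 (ln (ph / u) / (2 * (`|t| + 1)))); split.
  - by rewrite lt_min e0pos divr_gt0 // mulr_gt0.
  - by rewrite ge_min lexx.
  set e := Num.min _ _.
  have he : `|t| * e < ln (ph / u).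
    apply: (@le_lt_trans _ _ ((`|t| + 1) * (ln (ph / u) / (2 * (`|t| + 1))))).
      apply: ler_pM; rewrite ?lerDl // /e ?le_min ?ge_min ?lexx ?orbT //.
      by rewrite (ltW e0pos) divr_ge0 // ?ltW // mulr_gt0.
    rewrite invfM mulrCA [X in _ * X]mulrCA mulfV ?gt_eqF // mulr1.
    by rewrite gtr_pMr // invf_lt1 // ltr1n.
  rewrite expRN ltr_pdivlMr ?expR_gt0 // mulrC -ltr_pdivlMr //.
  by rewrite -[ltRHS]lnK ?posrE ?divr_gt0 // ltr_expR.
pose C := L ^+ 2 * expR L.
have C0 : 0 <= C by rewrite mulr_ge0 ?exprn_ge0 ?expR_ge0.
(* For this [s] the second-order term [s^2 C] is at most half of [s e], so each shifted term decays
   like [(ph rho)^k] with [rho < 1]. *)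
pose s := Num.min 1 (e / (2 * (C + 1))).
have C1 : 0 < 2 * (C + 1) by rewrite mulr_gt0 // ltr_wpDl.
have s0 : 0 < s by rewrite lt_min ltr01 divr_gt0.
have s1 : s <= 1 by rewrite ge_min lexx.
have sC : s * C <= e / 2.
  have : s <= e / (2 * (C + 1)) by rewrite ge_min lexx orbT.
  rewrite ler_pdivlMr // => h; rewrite ler_pdivlMr //.
  by have := ltW s0; nra.
pose rho := expR (- (s * e / 2)).
have rho1 : rho < 1 by rewrite expR_lt1 oppr_lt0 divr_gt0 // mulr_gt0.
have bnd x : (x = t + s \/ x = t - s) -> expR (- (s * e)) * box_mgf X0 B y x <= ph * rho.
  move=> xE; have cv := box_mgf_convex X0 mB BL t (ltW s0) s1 L0.
  have h1 : box_mgf X0 B y x <= (1 + s ^+ 2 * C) * ph.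
    by have [] := le_of_sum_le (tmin (t + s)) (tmin (t - s)) cv; case: xE => ->.
  apply: (@le_trans _ _ (expR (- (s * e)) * (expR (s ^+ 2 * C) * ph))).
    rewrite ler_wpM2l ?expR_ge0 //; apply: le_trans h1 _; rewrite ler_wpM2r ?(ltW ph0) //.
    exact: expR_ge1Dx.
  rewrite mulrA -expRD mulrC ler_wpM2l ?(ltW ph0) // ler_expR expr2.
  exact: exponent_gain (ltW s0) sC.
pose v := ph * expR (- (`|t| * e)).
have v0 : 0 < v by rewrite mulr_gt0 ?expR_gt0.
(* Two error terms of at most a quarter leave half of the main term; the remaining factor 1/2 is
   absorbed by [u < v]. *)
have [K1 K1P] : exists K, forall k, (K <= k)%N -> rho ^+ k <= 4^-1.
  by apply: geometric_small; rewrite ?expR_ge0 ?invr_gt0.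
have [K2 K2P] : exists K, forall k, (K <= k)%N -> (u / v) ^+ k <= 2^-1.
  apply: geometric_small; rewrite ?invr_gt0 // ?divr_ge0 // ?(ltW v0) ?(ltW u0) //.
  by rewrite ltr_pdivrMr // mul1r.
exists (maxn K1 K2) => l ul lD; rewrite geq_max => /andP[k1 k2].
have mG := typical_measurable y (`|y| + L) e l.
apply: (@le_trans _ _ (P (typical y (`|y| + L) e l))); last first.
  by apply: le_measure; rewrite ?inE //; [exact: typical_measurable|exact: le_typical].
have PG : P (typical y (`|y| + L) e l) \is a fin_num by rewrite fin_num_measure.
rewrite -(fineK PG) lee_fin.
have := tilted_typical t ul lD (ltW s0) epos; set p := fine _; rewrite -/ph.
set k := size l in k1 k2 *.
have ek (a : R) : expR (a * k%:R) = expR a ^+ k by rewrite expRM_natr.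
rewrite ek -mulNr ek => main.
have h1 : expR (- (s * e)) ^+ k * box_mgf X0 B y (t + s) ^+ k <= (ph * rho) ^+ k.
  rewrite -exprMn; apply: lerXn2r; rewrite ?nnegrE ?mulr_ge0 ?expR_ge0 ?(ltW ph0) ?box_mgf_ge0 //.
  by apply: bnd; left.
have h2 : expR (- (s * e)) ^+ k * box_mgf X0 B y (t - s) ^+ k <= (ph * rho) ^+ k.
  rewrite -exprMn; apply: lerXn2r; rewrite ?nnegrE ?mulr_ge0 ?expR_ge0 ?(ltW ph0) ?box_mgf_ge0 //.
  by apply: bnd; right.
have h3 : rho ^+ k <= 4^-1 by exact: K1P.
have h4 : (u / v) ^+ k <= 2^-1 by exact: K2P.
have phk : 0 < ph ^+ k by exact: exprn_gt0.
have h5 : ph ^+ k / 2 <= expR (`|t| * e) ^+ k * p.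
  apply: (half_absorb _ h1 h2); first by rewrite -mulrDr.
  by rewrite exprMn ler_wpM2l // ltW.
have h6 : v ^+ k / 2 <= p.
  rewrite /v exprMn expRN exprVn mulrAC ler_pdivrMr ?exprn_gt0 ?expR_gt0 //.
  by rewrite [leRHS]mulrC.
apply: le_trans h6; move: h4; rewrite expr_div_n ler_pdivrMr ?exprn_gt0 //.
by rewrite mulrC.
Qed.

End Tilt.
End Steady.

(** * The rate function *)

Lemma cvge_gt (R : realType) (u : (\bar R)^nat) (a b : \bar R) :
  u @ \oo --> a -> (b < a)%E -> exists n, forall m, (n <= m)%N -> (b < u m)%E.
Proof.
move=> cv ba; have /cv[n _ nP] : nbhs a [set y | (b < y)%E].
  by apply: open_nbhs_nbhs; split => //; exact: open_ereal_gt_ereal.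
by exists n => m nm; exact: nP.
Qed.

Section Rate.
Context d' (Omega' : measurableType d') (R : realType) (P' : probability Omega' R).
Variable X0 : {RV P' >-> R}.

Definition mgf y x : \bar R := (\int[P']_w (expR (x * (X0 w - y)))%:E)%E.

Lemma measurable_mgf y x : measurable_fun setT (fun w => (expR (x * (X0 w - y)))%:E).
Proof.
apply/measurable_EFinP.
exact: (measurableT_comp (measurable_tilt y x) (measurable_funP X0)).
Qed.

Lemma mgf_ge0 y x : (0 <= mgf y x)%E.
Proof. by apply: integral_ge0 => w _; rewrite lee_fin expR_ge0. Qed.

Lemma rateE y : rate X0 y = ereal_inf [set mgf y x | x in [set x : R | x <= 0]].
Proof.
rewrite /rate; congr ereal_inf; apply/seteqP; split => _ [x x0 <-]; exists x => //;
  by rewrite unlock.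
Qed.

Lemma rate_ge0 y : (0 <= rate X0 y)%E.
Proof. by rewrite rateE; apply: le_ereal_inf_tmp => _ [x _ <-]; exact: mgf_ge0. Qed.

Lemma rate_le_mgf y x : x <= 0 -> (rate X0 y <= mgf y x)%E.
Proof. by move=> x0; rewrite rateE; apply: ereal_inf_lbound; exists x. Qed.

Lemma rate_lt_mgf y c : (rate X0 y < c)%E -> exists2 x : R, x <= 0 & (mgf y x < c)%E.
Proof. by rewrite rateE => /ereal_inf_lt[_ [x x0 <-] h]; exists x. Qed.

Lemma mgf0 y : mgf y 0 = 1%E.
Proof.
rewrite /mgf; under eq_integral do rewrite mul0r expR0.
by have := integral_cst P' measurableT 1%E; rewrite [X in (_ * X)%E]probability_setT mule1.
Qed.

Lemma rate_le1 y : (rate X0 y <= 1)%E.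
Proof. by rewrite -(mgf0 y); exact: rate_le_mgf. Qed.

Lemma rate_fin y : (rate X0 y)%E = (fine (rate X0 y))%:E.
Proof.
rewrite fineK // ge0_fin_numE ?rate_ge0 //.
apply: (@le_lt_trans _ _ 1%E); [exact: rate_le1|exact: ltry].
Qed.

Lemma mgf_shift y y' x : mgf y' x = ((expR (x * (y - y')))%:E * mgf y x)%E.
Proof.
rewrite /mgf -ge0_integralZl //; do ?[exact: measurable_mgf |
  by rewrite lee_fin expR_ge0 | by move=> w _; rewrite lee_fin expR_ge0].
apply: eq_integral => w _; rewrite -EFinM -expRD; congr (expR _)%:E; ring.
Qed.

Lemma rate_nd y y' : y <= y' -> (rate X0 y <= rate X0 y')%E.
Proof.
move=> yy; rewrite [leRHS]rateE; apply: le_ereal_inf_tmp => _ [x /= x0 <-].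
apply: le_trans (rate_le_mgf y x0) _; rewrite (mgf_shift y y').
rewrite -[leLHS]mul1e lee_wpmul2r ?mgf_ge0 // lee_fin.
by rewrite -(@expR0 R) ler_expR mulr_le0 // subr_le0.
Qed.

(** An infimum of functions of [y] that are continuous where finite is upper semicontinuous, which
    for a nondecreasing function is right continuity. *)
Lemma rate_rcont y c : (rate X0 y < c)%E -> exists2 y' : R, y < y' & (rate X0 y' < c)%E.
Proof.
move=> /rate_lt_mgf[x x0 xc].
have [a aE] : exists a, mgf y x = a%:E.
  exists (fine (mgf y x)); rewrite fineK // ge0_fin_numE ?mgf_ge0 //.
  by apply: lt_le_trans xc _; exact: leey.
have [b ab bc] : exists2 b, a < b & (b%:E <= c)%E.
  rewrite aE in xc; case: c xc => [r| |] //; first by rewrite lte_fin => ?; exists r.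
  by move=> _; exists (a + 1); rewrite ?leey // ltrDl.
have a0 : 0 <= a by rewrite -lee_fin -aE mgf_ge0.
have b0 : 0 < b by exact: le_lt_trans ab.
(* With this [h] the shift factor is at most [2 b / (a + b)], and [2 a b / (a + b) < b] because
   [a < b]. *)
pose h := ln (2 * b / (a + b)) / (`|x| + 1).
have ab0 : 0 < a + b by rewrite ltr_wpDl.
have q0 : 0 < ln (2 * b / (a + b)).
  by apply: ln_gt0; rewrite ltr_pdivlMr // mul1r; lra.
have h0 : 0 < h by rewrite divr_gt0.
exists (y + h); first by rewrite ltrDl.
apply: lt_le_trans bc; apply: le_lt_trans (rate_le_mgf _ x0) _.
rewrite (mgf_shift y) aE -EFinM lte_fin.
have -> : x * (y - (y + h)) = `|x| * h by rewrite ler0_norm //; ring.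
have : expR (`|x| * h) <= 2 * b / (a + b).
  rewrite -[leRHS]lnK ?posrE ?divr_gt0 ?mulr_gt0 // ler_expR.
  by rewrite /h mulrCA ler_piMr ?(ltW q0) // ler_pdivrMr // mul1r lerDl.
move=> /(ler_wpM2r a0) hh; apply: le_lt_trans hh _.
rewrite mulrAC ltr_pdivrMr //; nra.
Qed.

Lemma rv_ge y : measurable [set w | y <= X0 w].
Proof. exact/measurable_ge/measurable_funP. Qed.

Lemma rv_le y : measurable [set w | X0 w <= y].
Proof. exact/measurable_le/measurable_funP. Qed.

Lemma rv_tight (e : R) : 0 < e -> exists n, forall m, (n <= m)%N ->
  ((1 - e)%:E <= P' [set w | (`|X0 w| <= m%:R)%R])%E.
Proof.
move=> e0; pose F n := [set w | `|X0 w| <= n%:R].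
have mF n : measurable (F n) by apply: measurable_le; apply: measurableT_comp.
have ndF : nondecreasing_seq F.
  by move=> m n mn; apply/subsetPset => w /= h; apply: le_trans h _; rewrite ler_nat.
have UF : \bigcup_n F n = setT.
  apply/seteqP; split => // w _; exists (Num.truncn `|X0 w|).+1 => //=.
  exact/ltW/truncnS_gt.
have := nondecreasing_cvg_mu (mu := P') mF (bigcupT_measurable F mF) ndF.
rewrite UF => cv0; have cv : (P' \o F) n @[n --> \oo] --> 1%E.
  by rewrite -(probability_setT P'); exact: cv0.
have [|n nP] := cvge_gt (b := (1 - e)%:E) cv; first by rewrite lte_fin; lra.
by exists n => m nm; apply: ltW; exact: nP.
Qed.

(** Moving from [y1] to [y] multiplies the transform at [x] by [expR (- x (y - y1))]. For [x] away
    from 0 this gains a fixed factor over [z]; for [x] near 0 tightness keeps the transform close to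
    1, hence above [z]. *)
Lemma rate_increasing y1 y z : y1 < y -> 0 < z -> z < 1 -> (z%:E <= rate X0 y1)%E ->
  (z%:E < rate X0 y)%E.
Proof.
move=> yy z0 z1 zy.
have e0 : 0 < (1 - z) / 4 by rewrite divr_gt0 // subr_gt0.
have [n0 nP] := rv_tight e0.
pose n := maxn n0 (Num.truncn `|y|).+1.
have Pn := nP n (leq_maxl _ _).
pose K : R := n%:R.
have Ky : y < K.
  apply: le_lt_trans (ler_norm y) _; apply: lt_le_trans (truncnS_gt `|y|) _.
  by rewrite ler_nat leq_maxr.
(* Then [c (K - y) = (1 - z) / 8], and the mass outside [[- K, K]] is at most [(1 - z) / 4]; with
   both losses the transform stays above [(1 + z) / 2]. *)
pose c := (1 - z) / (8 * (K - y)).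
have Ky0 : 0 < K - y by rewrite subr_gt0.
have c0 : 0 < c by rewrite divr_gt0 ?subr_gt0 // mulr_gt0 // subr_gt0.
have near x : - c <= x -> x <= 0 -> (((1 + z) / 2)%:E <= mgf y x)%E.
  move=> cx x0.
  have mE : measurable [set w | `|X0 w| <= n%:R] by apply: measurable_le; apply: measurableT_comp.
  apply: (@le_trans _ _ ((expR (- (c * (K - y))))%:E * P' [set w | (`|X0 w| <= n%:R)%R])%E).
    have i1 := expR_ge1Dx (- (c * (K - y))).
    have cK : c * (K - y) = (1 - z) / 8 by rewrite /c invfM mulrA mulfVK // gt_eqF.
    apply: (@le_trans _ _ ((expR (- (c * (K - y))))%:E * (1 - (1 - z) / 4)%:E)%E).
      rewrite -EFinM lee_fin; rewrite cK in i1 *.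
      apply: (@le_trans _ _ ((1 + - ((1 - z) / 8)) * (1 - (1 - z) / 4))); first by nra.
      by rewrite ler_wpM2r //; lra.
    by rewrite lee_pmul2l // lte_fin expR_gt0.
  rewrite -[X in P' X]setIT -integral_indic // -ge0_integralZl //; do ?[exact/measurable_EFinP/measurable_indic |
    by rewrite lee_fin expR_ge0 | by move=> w _; rewrite lee_fin].
  apply: ge0_le_integral => //.
  - apply: measurable_funeM; exact/measurable_EFinP/measurable_indic.
  - exact: measurable_mgf.
  move=> w _; rewrite -EFinM lee_fin indicE; case: (boolP (_ \in _)) => [|_]; last first.
    by rewrite mulr0 expR_ge0.
  rewrite inE /= mulr1 ler_expR ler_norml => /andP[_ XK].
  have [Xy|Xy] := leP (X0 w) y.
    apply: (@le_trans _ _ 0); first by rewrite oppr_le0 mulr_ge0 ?ltW.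
    by rewrite mulr_le0 // subr_le0.
  apply: (@le_trans _ _ (- c * (X0 w - y))).
    by rewrite mulNr lerN2 ler_wpM2l ?(ltW c0) // lerB.
  by rewrite ler_wpM2r // subr_ge0 ltW.
pose g := expR (c * (y - y1)) * z.
have gz : z < g.
  rewrite /g ltr_pMl // -(@expR0 R) ltr_expR mulr_gt0 // subr_gt0 //.
apply: (@lt_le_trans _ _ (Num.min ((1 + z) / 2) g)%:E).
  by rewrite lte_fin lt_min gz andbT; lra.
rewrite [leRHS]rateE; apply: le_ereal_inf_tmp => _ [x /= x0 <-].
have [cx|cx] := leP (- c) x.
  by apply: le_trans (near x cx x0); rewrite lee_fin ge_min lexx.
apply: (@le_trans _ _ g%:E); first by rewrite lee_fin ge_min lexx orbT.
rewrite (mgf_shift y1) /g EFinM; apply: lee_pmul.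
- by rewrite lee_fin expR_ge0.
- by rewrite lee_fin ltW.
- rewrite lee_fin ler_expR; have : 0 < y - y1 by rewrite subr_gt0.
  nra.
- exact: le_trans zy (rate_le_mgf _ x0).
Qed.

End Rate.

Section RateChernoff.
Context d (Omega : measurableType d) (R : realType) (P : probability Omega R).
Context d' (Omega' : measurableType d') (P' : probability Omega' R).
Variables (I : choiceType) (D : set I) (X : I -> {RV P >-> R}) (X0 : {RV P' >-> R}).
Hypothesis X_indep : mutually_independent D X.
Hypothesis X_law : forall i, D i -> same_law (X i) X0.

Lemma sum_le_measurable (y : R) (l : seq I) : measurable [set w | \sum_(i <- l) (X i w - y) <= 0].
Proof.
apply: measurable_le; apply: (@measurable_sum _ _ _ setT _ l (fun i w => X i w - y)) => i.
exact: measurable_funB.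
Qed.

Lemma rate_chernoff (y u : R) (l : seq I) : (rate X0 y < u%:E)%E -> uniq l -> [set` l] `<=` D ->
  (P [set w | (\sum_(i <- l) (X i w - y) <= 0)%R] <= (u ^+ size l)%:E)%E.
Proof.
move=> /rate_lt_mgf[x x0 xu] ul lD.
have xE : mgf X0 y x = (fine (mgf X0 y x))%:E.
  rewrite fineK // ge0_fin_numE ?mgf_ge0 //; apply: lt_trans xu _; exact: ltry.
have mh : measurable_fun setT (fun z : R => x * (z - y)).
  by apply: measurable_funM => //; exact: measurable_funB.
have h := chernoff X_indep X_law ul lD mh xE.
apply: (@le_trans _ _ (P [set w | (0 <= \sum_(i <- l) x * (X i w - y))%R])).
  apply: le_measure; rewrite ?inE.
  - exact: sum_le_measurable.
  - by apply: measurable_ge; exact: (measurable_inE (measurable_in_sum lD mh)).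
  - by move=> w /= hw; rewrite -mulr_sumr mulr_le0.
apply: le_trans h _; rewrite lee_fin lerXn2r ?nnegrE //.
- by apply: fine_ge0; exact: mgf_ge0.
- by rewrite -lee_fin; apply: le_trans (ltW xu); exact: mgf_ge0.
- by rewrite -lee_fin -xE ltW.
Qed.

End RateChernoff.

(** * Restricting the law to a box without losing the minimum of the transform *)

Lemma contraction_close (R : realFieldType) (E a e : R) : a + e / 2 <= E * (a + e) ->
  (1 - E) * a <= (1 - E) * (a + e) -> 0 <= e -> a <= e + E * a.
Proof. by lra. Qed.

(** The positive part is bounded, and a negative part of infinite integral would make the integral
    [-oo]. This is for [min(X, n)], which in general is bounded only above. *)
Lemma integrable_of_bounded_above d (S : measurableType d) (R : realType) (P : probability S R)
  (f : S -> R) (C : R) (a : \bar R) : measurable_fun setT f -> (forall w, f w <= C) ->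
  (a < \int[P]_w (f w)%:E)%E -> P.-integrable setT (EFin \o f).
Proof.
move=> mf fC af.
have mE : measurable_fun setT (EFin \o f) by exact/measurable_EFinP.
have ip : (\int[P]_w (EFin \o f)^\+ w < +oo)%E.
  apply: (@le_lt_trans _ _ (\int[P]_w `|C|%:E)%E).
    apply: ge0_le_integral => //; first exact: measurable_funepos.
    move=> w _; rewrite funeposE /= -EFin_max lee_fin ge_max normr_ge0 andbT.
    by apply: le_trans (fC w) (ler_norm _).
  rewrite [X in (X < _)%E](integral_cst P measurableT `|C|%:E).
  by rewrite [X in (_ * X)%E](probability_setT P) mule1 ltry.
have im : (\int[P]_w (EFin \o f)^\- w < +oo)%E.
  rewrite ltey; apply/eqP => e; move: af; rewrite integralE [X in (_ - X)%E]e.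
  have fin : (\int[P]_w (EFin \o f)^\+ w)%E \is a fin_num.
    by rewrite ge0_fin_numE //; apply: integral_ge0.
  by rewrite -(fineK fin) /= ltNge leNye.
apply/integrableP; split => //.
rewrite (_ : (fun x => `|(EFin \o f) x|%E) = ((EFin \o f)^\+ \+ (EFin \o f)^\-)%E); last first.
  by rewrite -fune_abse.
rewrite ge0_integralD //; [exact: lte_add_pinfty|exact: measurable_funepos|exact: measurable_funeneg].
Qed.

Section Tiltable.
Context d' (Omega' : measurableType d') (R : realType) (P' : probability Omega' R).
Variable X0 : {RV P' >-> R}.

(* The minimizer t makes y the mean of the law of X0 restricted to B and tilted by t. *)
Definition tiltable (y u : R) := exists (B : set R) (t L : R), [/\ measurable B,
  (forall b, B b -> `|b - y| <= L), 0 <= L, u < box_mgf X0 B y t &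
  forall x, box_mgf X0 B y t <= box_mgf X0 B y x].

Definition box (n : nat) : set R := [set z | `|z| <= n%:R].

Lemma measurable_box n : measurable (box n).
Proof. by apply: measurable_le; exact: normr_measurable. Qed.

Lemma box_width y n b : box n b -> `|b - y| <= n%:R + `|y|.
Proof.
by rewrite /box /= => h; apply: le_trans (ler_normB _ _) _; rewrite lerD2r.
Qed.

Lemma box_indic_cvg (g : R -> R) (w : Omega') :
  (fun n => (\1_(box n) (X0 w) * g (X0 w))%:E) @ \oo --> (g (X0 w))%:E.
Proof.
apply: cvg_near_cst; exists (Num.truncn `|X0 w|).+1 => // n /= nx.
rewrite indicE mem_set ?mul1r //= /box /=; apply: ltW.
by apply: lt_le_trans (truncnS_gt _) _; rewrite ler_nat.
Qed.

Lemma box_mgf_cvg y x (a : R) : (a%:E < mgf X0 y x)%E ->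
  exists n, forall m, (n <= m)%N -> a < box_mgf X0 (box m) y x.
Proof.
move=> ay.
pose g n w := (\1_(box n) (X0 w) * expR (x * (X0 w - y)))%:E.
have mg n : measurable_fun setT (g n).
  apply/measurable_EFinP/measurable_funM.
    exact: (measurableT_comp (measurable_indic (measurable_box n))).
  exact: (measurableT_comp (measurable_tilt y x)).
have g0 n w : setT w -> (0 <= g n w)%E.
  by move=> _; rewrite lee_fin mulr_ge0 ?expR_ge0 // indicE; case: (_ \in _).
have ndg w : setT w -> nondecreasing_seq (g ^~ w).
  move=> _ m n mn; rewrite lee_fin ler_wpM2r ?expR_ge0 // !indicE ler_nat.
  case: (boolP (_ \in box m)) => // ; rewrite inE /box /= => h.
  by rewrite mem_set //= /box /=; apply: le_trans h _; rewrite ler_nat.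
have /= cv := cvg_monotone_convergence (mu := P') measurableT mg g0 ndg.
have E : (\int[P']_w limn (g ^~ w) = mgf X0 y x)%E.
  apply: eq_integral => w _; apply/cvg_lim => //.
  exact: (@box_indic_cvg (fun z => expR (x * (z - y)))).
rewrite E in cv; have [n nP] := cvge_gt cv ay.
exists n => m nm; rewrite -lte_fin -(box_mgfE X0 (measurable_box m) (@box_width y m)).
exact: nP.
Qed.

Lemma truncated_mean_gt (y : R) : (y%:E < sup_truncated_mean X0)%E ->
  exists n : nat, (y%:E < \int[P']_w (Num.min (X0 w) n%:R)%:E)%E.
Proof.
by move=> /ereal_sup_gt[_ [n _ <-]]; rewrite unlock => h; exists n.
Qed.

Lemma measurable_min_rv (n : R) : measurable_fun setT (fun w => Num.min (X0 w) n).
Proof. exact: measurable_minr. Qed.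

(** Dominated convergence from the one-sided truncation. A nonnegative drift keeps the transform of
    the box at least its value at 0 for [x >= 0], so the minimum may be sought among [x <= 0], where
    [rate] takes its infimum. *)
Lemma box_drift y : (y%:E < sup_truncated_mean X0)%E -> exists n, forall m, (n <= m)%N ->
  0 <= box_mean X0 (box m) (fun z => z - y).
Proof.
move=> /truncated_mean_gt[n nP].
pose f z := Num.min z n%:R - y.
have fi : P'.-integrable setT (EFin \o (fun w => Num.min (X0 w) n%:R)).
  apply: (integrable_of_bounded_above (C := n%:R) (measurable_min_rv n%:R) _ nP).
  by move=> w; rewrite ge_min lexx orbT.
have fyi : P'.-integrable setT (EFin \o (fun w => f (X0 w))).
  rewrite (_ : _ \o _ = ((EFin \o (fun w => Num.min (X0 w) n%:R)) \- (EFin \o cst y))%E) //.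
  by apply: integrableB => //; exact: (bounded_integrable P' (bounded_cst _ y)).
have fpos : (0 < \int[P']_w (f (X0 w))%:E)%E.
  rewrite (_ : (\int[P']_w _)%E = (\int[P']_w ((EFin \o (fun w => Num.min (X0 w) n%:R)) w - (EFin \o cst y) w))%E) //.
  rewrite integralB //; last exact: (bounded_integrable P' (bounded_cst _ y)).
  rewrite [X in (_ - X)%E](integral_cst P' measurableT y%:E).
  by rewrite [X in (_ * X)%E](probability_setT P') mule1 sube_gt0.
have mf : measurable_fun setT f.
  by apply: measurable_funB => //; exact: measurable_minr.
pose g m w := (\1_(box m) (X0 w) * f (X0 w))%:E.
have cv : (\int[P']_w g m w)%E @[m --> \oo] --> (\int[P']_w (f (X0 w))%:E)%E.
  apply: (@dominated_cvg _ _ _ P' setT measurableT g _ (fun w => `|(f (X0 w))%:E|%E)) => //.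
  - move=> m; apply/measurable_EFinP/measurable_funM.
      exact: (measurableT_comp (measurable_indic (measurable_box m))).
    exact: measurableT_comp.
  - by move=> w _; exact: box_indic_cvg.
  - exact: integrable_abse.
  - move=> m w _; rewrite /g /= lee_fin normrM ler_piMl // indicE.
    by case: (_ \in _); rewrite ?normr1 ?normr0.
have [N NP] := cvge_gt cv fpos; exists N => m Nm.
have fb b : box m b -> `|f b| <= m%:R + n%:R + `|y|.
  rewrite /box /f /= => hb; apply: le_trans (ler_normB _ _) _; rewrite lerD2r.
  rewrite ler_norml; move: hb; rewrite ler_norml => /andP[h1 h2].
  by rewrite le_min ge_min; have := ler0n R n; have := ler0n R m; lra.
have fb' b : box m b -> `|b - y| <= m%:R + n%:R + `|y|.
  by move=> /(@box_width y) h; apply: le_trans h _; rewrite lerD2r lerDl.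
apply: (@le_trans _ _ (box_mean X0 (box m) f)).
  rewrite -lee_fin -bounded_rvE; first exact: ltW (NP m Nm).
  exact: (box_bounded X0 (measurable_box m) mf fb).
apply: (box_mean_le X0 (measurable_box m) mf _ fb fb'); first exact: measurable_funB.
by move=> b _; rewrite lerD2r ge_min lexx.
Qed.

Lemma box_mgf_mono m n y x : (m <= n)%N -> box_mgf X0 (box m) y x <= box_mgf X0 (box n) y x.
Proof.
move=> mn; have bd k : bounded_rv (fun w => \1_(box k) (X0 w) * expR (x * (X0 w - y))).
  apply: (box_bounded X0 (measurable_box k) (measurable_tilt y x) (C := expR (`|x| * (k%:R + `|y|)))).
  by move=> b; apply: (tilt_bound (@box_width y k)).
apply: mean_le => // w; rewrite ler_wpM2r ?expR_ge0 // !indicE ler_nat.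
case: (boolP (_ \in box m)) => //; rewrite inE /box /= => h.
by rewrite mem_set //= /box /=; apply: le_trans h _; rewrite ler_nat.
Qed.

(** Integrate [1 + z <= expR z] with [z = x (b - y)]. *)
Lemma box_mgf_ge0_drift (B : set R) (y L x : R) : measurable B -> (forall b, B b -> `|b - y| <= L) ->
  0 <= L -> 0 <= x * box_mean X0 B (fun z => z - y) -> box_mgf X0 B y 0 <= box_mgf X0 B y x.
Proof.
move=> mb BL L0 dr.
have b1 b : B b -> `|expR (0 * (b - y))| <= 1 + `|x| * L.
  by move=> _; rewrite mul0r expR0 normr1 lerDl mulr_ge0.
have mB : measurable_fun setT (fun z : R => z - y) by exact: measurable_funB.
have b2 b : B b -> `|x * (b - y)| <= 1 + `|x| * L.
  move=> bb; rewrite normrM -[leLHS]add0r lerD // ler_wpM2l //.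
  exact: BL.
have mB2 : measurable_fun setT (fun z : R => x * (z - y)) by exact: measurable_funM.
have h : box_mgf X0 B y 0 <= box_mean X0 B (fun z => expR (0 * (z - y)) + x * (z - y)).
  rewrite (box_mean_add X0 mb (measurable_tilt y 0) mB2 b1 b2).
  rewrite (box_mean_scale X0 mb x mB BL).
  by rewrite lerDl.
apply: le_trans h _.
apply: (box_mean_le X0 mb (C := (1 + `|x| * L) + (1 + `|x| * L) + expR (`|x| * L))).
- by apply: measurable_funD => //; exact: measurable_tilt.
- exact: measurable_tilt.
- move=> b bb; apply: le_trans (ler_normD _ _) _.
  rewrite -[leLHS]addr0; apply: lerD (expR_ge0 _); apply: lerD; [exact: b1|exact: b2].
- move=> b bb; rewrite -[leLHS]add0r; apply: lerD; last exact: (tilt_bound BL).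
  by rewrite !addr_ge0 // mulr_ge0.
by move=> b _; rewrite mul0r expR0; exact: expR_ge1Dx.
Qed.

Lemma box_mgf_pos m y x : 0 <= box_mean X0 (box m) (fun z => z - y) -> 0 <= x ->
  box_mgf X0 (box m) y 0 <= box_mgf X0 (box m) y x.
Proof.
move=> dr x0; apply: (box_mgf_ge0_drift (measurable_box m) (@box_width y m)).
  by rewrite addr_ge0.
exact: mulr_ge0.
Qed.

Lemma box_mgf_continuous m y : continuous (box_mgf X0 (box m) y).
Proof.
pose f := box_mgf X0 (box m) y.
pose L : R := m%:R + `|y|.
have L0 : 0 <= L by rewrite addr_ge0.
have lip x h : expR (- (`|h| * L)) * f x <= f (x + h).
  exact: (box_mgf_lip X0 (measurable_box m) (@box_width y m)).
move=> x; apply/cvgrPdist_le => e e0.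
have f0 : 0 <= f x by exact: box_mgf_ge0.
have fe : 0 < f x + e by rewrite ltr_wpDl.
have L1 : 0 < L + 1 by rewrite ltr_wpDl.
pose k := e / 2 / ((f x + e) * (L + 1)).
have k0 : 0 < k by rewrite !divr_gt0 // mulr_gt0.
near=> t.
have hk : `|x - t| * L <= e / 2 / (f x + e).
  apply: (@le_trans _ _ (k * (L + 1))); first by apply: ler_pM => //; rewrite lerDl.
  by rewrite /k invfM mulrA mulfVK ?gt_eqF.
pose E := expR (- (`|x - t| * L)).
have E1 : E <= 1 by rewrite -(@expR0 R) ler_expR oppr_le0 mulr_ge0.
have ex : f x + e / 2 <= E * (f x + e).
  rewrite -ler_pdivrMr //; apply: le_trans (expR_ge1Dx _).
  rewrite ler_pdivrMr // mulrDl mul1r mulNr.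
  have := ler_wpM2r (ltW fe) hk; rewrite mulfVK ?gt_eqF //; lra.
have h1 : E * f x <= f t by have := lip x (t - x); rewrite subrKC distrC.
have h2 : E * f t <= f x by have := lip t (x - t); rewrite subrKC.
have E0 : 0 < E by exact: expR_gt0.
rewrite -/f ler_norml; apply/andP; split.
  rewrite lerNl opprB lerBlDl.
  rewrite -(ler_pM2l E0); apply: le_trans h2 (le_trans _ ex).
  by rewrite lerDl divr_ge0 // ltW.
rewrite lerBlDr; apply: le_trans (_ : e + E * f x <= _); last by rewrite lerD2l.
by apply: (contraction_close ex _ (ltW e0)); rewrite ler_wpM2l ?subr_ge0 // lerDl ltW.
Unshelve. all: by end_near.
Qed.

End Tiltable.

Section TiltableRate.
Context d' (Omega' : measurableType d') (R : realType) (P' : probability Omega' R).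
Variable X0 : {RV P' >-> R}.

(** With no mass below [y] the transform decreases to the mass at [y] as [x] tends to [-oo], and its
    infimum need not be attained. Restricting to the point [y] makes the transform constant, so any
    [t] is a minimizer. *)
Lemma tiltable_atom (y u : R) : P' [set w | (X0 w < y)%R] = 0%E -> (u%:E < rate X0 y)%E ->
  tiltable X0 y u.
Proof.
move=> Py uy; pose p := mean P' (fun w => \1_[set y] (X0 w)).
have bE (x : R) : box_mgf X0 [set y] y x = p.
  apply: eq_mean => w; rewrite indicE; case: (boolP (_ \in _)) => [|_]; last by rewrite mul0r.
  by rewrite inE => -> ; rewrite subrr mulr0 expR0 mulr1.
exists [set y], 0, 0; split => //; [by move=> _ ->; rewrite subrr normr0| |by move=> x; rewrite !bE].
rewrite bE -lte_fin; apply: lt_le_trans uy _.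
have pE : (\int[P']_w (\1_[set y] (X0 w))%:E)%E = p%:E.
  rewrite bounded_rvE //; split; first exact: (measurableT_comp (measurable_indic _)).
  by exists 1 => w; rewrite indicE; case: (_ \in _); rewrite ?normr1 ?normr0.
pose g n w := (expR (- n%:R * (X0 w - y)))%:E.
have mg n : measurable_fun setT (g n) by exact: measurable_mgf.
have ml : measurable [set w | X0 w < y] by exact/measurable_lt/measurable_funP.
have ae : {ae P', forall w, y <= X0 w}.
  exists [set w | X0 w < y]; split => //.
  by move=> w /= /negP; rewrite -ltNge.
have [_ _ cv] : [/\ P'.-integrable setT (fun w => (\1_[set y] (X0 w))%:E),
  [sequence (\int[P']_w `|g n w - (\1_[set y] (X0 w))%:E|)%E]_n @ \oo --> 0%E &
  [sequence (\int[P']_w (g n w))%E]_n @ \oo --> (\int[P']_w (\1_[set y] (X0 w))%:E)%E].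
  apply: (@dominated_convergence _ _ _ P' setT measurableT g _ (EFin \o cst 1)) => //.
  - exact/measurable_EFinP/(measurableT_comp (measurable_indic _)).
  - apply: filterS ae => w yw _; rewrite /g indicE.
    case: (boolP (_ \in _)) => [|]; rewrite ?inE ?notin_setE /=.
      by move=> ->; apply: cvg_near_cst; apply: nearW => n; rewrite subrr mulr0 expR0.
    move=> /eqP ne; have yw' : 0 < X0 w - y by rewrite subr_gt0 lt_neqAle eq_sym ne.
    apply: cvg_EFin; first exact: nearW.
    rewrite (_ : fine \o _ = fun n => expR (- (X0 w - y)) ^+ n); last first.
      by apply/funext => n; rewrite /= -expRM_natl mulrN mulNr.
    by apply: cvg_expr; rewrite ger0_norm ?expR_ge0 // expR_lt1 oppr_lt0.
  - exact: (bounded_integrable P' (bounded_cst _ 1)).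
  - apply: filterS ae => w yw n _; rewrite /g /= lee_fin ger0_norm ?expR_ge0 //.
    by rewrite -(@expR0 R) ler_expR mulr_le0_ge0 ?oppr_le0 // subr_ge0.
rewrite -pE; apply: (cvge_ge _ cv); apply: nearW => n.
by apply: rate_le_mgf; rewrite oppr_le0.
Qed.

Lemma tiltable_rate (y u : R) : (y%:E < sup_truncated_mean X0)%E -> 0 < u -> (u%:E < rate X0 y)%E ->
  tiltable X0 y u.
Proof.
move=> ymu u0 uy.
have [Py|Py] := eqVneq (P' [set w | (X0 w < y)%R]) 0%E; first exact: tiltable_atom.
(* These sets exhaust the event [X0 < y]; one of them has positive mass, and its values are bounded
   away from [y] and lie in all large boxes. *)
pose A m := [set w | - m%:R <= X0 w] `&` [set w | X0 w <= y - m.+1%:R^-1].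
have mA m : measurable (A m) by apply: measurableI; [exact: rv_ge|exact: rv_le].
have [m Am] : exists m, P' (A m) != 0%E.
  apply: contrapT => /forallNP nA.
  have : P'.-negligible (\bigcup_m A m).
    apply: negligible_bigcup => m; exists (A m); split => //.
    by apply/eqP; move/negP: (nA m); rewrite negbK.
  have -> : \bigcup_m A m = [set w | X0 w < y].
    apply/seteqP; split => w /=.
      move=> [k _ [_ h]]; apply: le_lt_trans h _.
      by rewrite ltrBlDr ltrDl invr_gt0.
    move=> Xy; have yx : 0 < y - X0 w by rewrite subr_gt0.
    pose k := maxn (Num.truncn `|X0 w|).+1 (Num.truncn (y - X0 w)^-1).
    exists k => //; split => /=.
      rewrite lerNl; apply: le_trans (ler_norm _) _; rewrite normrN.
      by apply: ltW; apply: lt_le_trans (truncnS_gt _) _; rewrite ler_nat leq_maxl.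
    rewrite lerBrDr addrC -lerBrDr -[leRHS]invrK lef_pV2 ?posrE ?invr_gt0 //.
    by apply: ltW; apply: lt_le_trans (truncnS_gt _) _; rewrite ler_nat ltnS leq_maxr.
  move=> [N [mN N0 sub]]; move/eqP: Py; apply.
  apply/eqP; rewrite -measure_le0 -N0; apply: le_measure; rewrite ?inE //.
  exact/measurable_lt/measurable_funP.
pose p := fine (P' (A m)).
have pE : P' (A m) = p%:E by rewrite fineK // fin_num_measure.
have p0 : 0 < p by rewrite lt_neqAle eq_sym -(@eqe R) -pE Am /= -lee_fin -pE.
have up : u < fine (rate X0 y) by rewrite -lte_fin -rate_fin.
pose v := (u + fine (rate X0 y)) / 2.
have uv : u < v by rewrite /v; lra.
have vy : (v%:E < rate X0 y)%E by rewrite rate_fin lte_fin /v; lra.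
pose ep : R := m.+1%:R^-1.
have ep0 : 0 < ep by rewrite invr_gt0.
(* Far out on the negative axis the mass below y - ep keeps the transform large; on the
   remaining compact interval the truncated transforms exceed v simultaneously. *)
have big n (x : R) : (m <= n)%N -> `|y| <= n%:R -> x <= 0 -> p * expR (- x * ep) <= box_mgf X0 (box n) y x.
  move=> mn yn x0; rewrite mulrC -lee_fin EFinM -pE -(box_mgfE X0 (measurable_box n) (@box_width _ y n)).
  rewrite -[X in P' X]setIT -integral_indic // -ge0_integralZl //; do ?[exact/measurable_EFinP/measurable_indic |
    by rewrite lee_fin expR_ge0 | by move=> w _; rewrite lee_fin].
  apply: ge0_le_integral => //.
  - by apply: measurable_funeM; exact/measurable_EFinP/measurable_indic.
  - apply/measurable_EFinP/measurable_funM.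
      exact: (measurableT_comp (measurable_indic (measurable_box n))).
    exact: (measurableT_comp (measurable_tilt y x)).
  move=> w _; rewrite -EFinM lee_fin [X in _ * X]indicE; case: (boolP (w \in A m)) => [|_]; last first.
    by rewrite mulr0 mulr_ge0 ?expR_ge0 // indicE; case: (_ \in _).
  rewrite inE => -[/= h1 h2]; rewrite indicE mem_set; last first.
    rewrite /box /= ler_norml; apply/andP; split.
      by apply: le_trans h1; rewrite lerN2 ler_nat.
    by apply: le_trans h2 _; rewrite lerBlDr; apply: le_trans (ler_norm y) (le_trans yn _); rewrite lerDl invr_ge0.
  rewrite mulr1 mul1r ler_expR mulNr -mulrN ler_wnM2l //.
  by rewrite lerBlDr addrC.
(* Chosen so that [p * expR (Aa * ep) = 2]: to the left of [- Aa] the transform exceeds 1, hence its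
   value at 0. *)
pose Aa := ln (2 / p) / ep.
have Ap : 0 <= Aa.
  apply: divr_ge0; last exact: ltW.
  apply: ln_ge0; rewrite ler_pdivlMr // mul1r.
  by rewrite -lee_fin -pE; apply: le_trans (probability_le1 P' (mA m)) _; rewrite lee_fin ler1n.
have [n1 n1P] := box_drift ymu.
(* A Dini argument: the truncated transforms are continuous and increase with the box, and at each
   point they eventually exceed [v], so compactness gives one box for the whole interval. *)
have [n2 n2P] : exists n, forall k, (n <= k)%N -> forall x, - Aa <= x -> x <= 0 ->
    v < box_mgf X0 (box k) y x.
  have cK := @segment_compact R (- Aa) 0.
  move/compact_near_coveringP: cK => /(_ nat \oo (fun n x => forall k, (n <= k)%N -> v < box_mgf X0 (box k) y x)).
  case=> [x|n _ nP].
    rewrite /= in_itv /= => /andP[_ x0].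
    have [n nP] := box_mgf_cvg (lt_le_trans vy (rate_le_mgf X0 y x0)).
    have vn := nP n (leqnn n).
    have cn := @box_mgf_continuous _ _ _ P' X0 n y x.
    have nb : \forall x' \near x, v < box_mgf X0 (box n) y x' by exact: (cvgr_gt _ cn).
    exists ([set x' | v < box_mgf X0 (box n) y x'], [set i | (n <= i)%N]) => /=.
      by split => //; exists n.
    move=> [x' i] /= [h1 h2] k ik; apply: lt_le_trans h1 _.
    by apply: box_mgf_mono; exact: leq_trans ik.
  exists n => k nk x Ax x0; have /= := nP n (leqnn n) x; apply => //.
  by rewrite /= in_itv /= Ax x0.
pose n := maxn (maxn m n1) (maxn n2 (Num.truncn `|y|).+1).
have nm : (m <= n)%N by rewrite !leq_max leqnn.
have nn1 : (n1 <= n)%N by rewrite !leq_max leqnn orbT.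
have nn2 : (n2 <= n)%N by rewrite !leq_max leqnn !orbT.
have yn : `|y| <= n%:R.
  by apply: ltW; apply: lt_le_trans (truncnS_gt _) _; rewrite ler_nat !leq_max leqnn !orbT.
pose f := box_mgf X0 (box n) y.
have [t tA tmin] : exists2 c, c \in `[- Aa, 0] & forall x, x \in `[- Aa, 0] -> f c <= f x.
  apply: EVT_min; first by rewrite oppr_le0.
  by apply: continuous_subspaceT => x; exact: box_mgf_continuous.
move: (tA); rewrite in_itv /= => /andP[tA1 tA2].
have f01 : f 0 <= 1.
  rewrite -(mean_cst P' 1); apply: mean_le.
  - apply: (box_bounded X0 (measurable_box n) (measurable_tilt y 0) (C := 1)).
    by move=> b _; rewrite mul0r expR0 normr1.
  - exact: bounded_cst.
  - by move=> w; rewrite mul0r expR0 mulr1 indicE; case: (_ \in _).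
have t0 : f t <= f 0 by apply: tmin; rewrite in_itv /= lexx oppr_le0 Ap.
exists (box n), t, (n%:R + `|y|); split.
- exact: measurable_box.
- exact: box_width.
- by rewrite addr_ge0.
- by apply: lt_trans uv _; apply: n2P.
move=> x; rewrite -/(f t) -/(f x); have [x0|x0] := leP 0 x.
  by apply: le_trans t0 _; apply: box_mgf_pos => //; exact: n1P.
have [xA|xA] := leP (- Aa) x; first by apply: tmin; rewrite in_itv /= xA ltW.
apply: le_trans (le_trans t0 f01) _; apply: le_trans (big n x nm yn (ltW x0)).
have e2 : 2 / p <= expR (- x * ep).
  rewrite -[leLHS]lnK ?posrE ?divr_gt0 // ler_expR -ler_pdivrMr // -/Aa lerNr; exact: ltW.
have := ler_wpM2l (ltW p0) e2; rewrite mulrCA mulfV ?gt_eqF // mulr1; lra.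
Qed.

Let measurable_preimage_rv0 (B : set R) : measurable B -> measurable (X0 @^-1` B).
Proof. by move=> mB; rewrite -[X in measurable X]setTI; exact: measurable_funP. Qed.

Let neg_part w := - Num.min (X0 w) 0.

Let neg_ge0 w : 0 <= neg_part w.
Proof. by rewrite oppr_ge0 ge_min lexx orbT. Qed.

Let neg_measurable : measurable_fun setT neg_part.
Proof. by apply: measurableT_comp => //; exact: measurable_min_rv. Qed.

Let neg_infinite : sup_truncated_mean X0 = -oo%E -> (\int[P']_w (neg_part w)%:E = +oo)%E.
Proof.
move=> mu; have : ('E_P'[fun w => Num.min (X0 w) 0%:R] <= sup_truncated_mean X0)%E.
  by apply: ereal_sup_ubound; exists 0%N.
rewrite mu leeNy_eq unlock => /eqP h.
have : (\int[P']_w (- (neg_part w)%:E) = - (\int[P']_w (neg_part w)%:E))%E.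
  by rewrite integral_ge0N // => w _; rewrite lee_fin.
under eq_integral do rewrite /neg_part EFinN oppeK.
by rewrite h => /(congr1 (@oppe R)); rewrite oppeK => <-.
Qed.

(** [1 + z <= expR z] bounds a multiple of the negative part of [X0] by the exponential plus a
    constant, so an infinite mean of the negative part makes every transform with [x < 0]
    infinite. *)
Lemma rate_heavy y : sup_truncated_mean X0 = -oo%E -> rate X0 y = 1%E.
Proof.
move=> mu; apply/eqP; rewrite eq_le rate_le1 /= rateE; apply: le_ereal_inf_tmp => _ [x /= x0 <-].
have [->|xn0] := eqVneq x 0; first by rewrite mgf0.
have xl0 : x < 0 by rewrite lt_neqAle xn0.
suff -> : mgf X0 y x = +oo%E by rewrite leey.
apply/eqP; rewrite -leye_eq leNgt; apply/negP => fin.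
have : (\int[P']_w ((- x)%:E * (neg_part w)%:E) < +oo)%E.
  apply: (@le_lt_trans _ _ (\int[P']_w ((expR (x * (X0 w - y)))%:E + (cst `|x * y|%:E w)))%E).
    apply: ge0_le_integral => //.
    - by move=> w _; rewrite -EFinM lee_fin mulr_ge0 // oppr_ge0.
    - by apply: measurable_funeM; exact/measurable_EFinP.
    - by apply: emeasurable_funD => //; exact: measurable_mgf.
    move=> w _; rewrite -EFinM -EFinD lee_fin /neg_part mulrNN.
    have := normr_ge0 (x * y); have := ler_norm (x * y); have := expR_ge0 (x * (X0 w - y)).
    have := expR_ge1Dx (x * (X0 w - y)); rewrite mulrBr.
    by case: (leP (X0 w) 0) => _; rewrite ?mulr0; lra.
  rewrite ge0_integralD //; do ?[exact: measurable_mgf | by move=> w _; rewrite lee_fin expR_ge0 |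
    by move=> w _; rewrite /= lee_fin].
  apply: lte_add_pinfty => //.
  rewrite [X in (X < _)%E](integral_cst P' measurableT).
  by rewrite [X in (_ * X)%E](probability_setT P') mule1 ltry.
have -> : (\int[P']_w ((- x)%:E * (neg_part w)%:E) = (- x)%:E * \int[P']_w (neg_part w)%:E)%E.
  by apply: ge0_integralZl => //; do ?[exact/measurable_EFinP | rewrite lee_fin oppr_ge0 |
    move=> w _; rewrite lee_fin].
by rewrite neg_infinite // mulry gtr0_sg ?oppr_gt0 // mul1e ltxx.
Qed.

(* Truncating to [-M, n] and recentering at the truncated mean makes x = 0 a minimizer;
   the truncated means tend to -oo since the negative part of X0 is not integrable. *)
Lemma tiltable_heavy (y u : R) : sup_truncated_mean X0 = -oo%E -> 0 < u -> u < 1 ->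
  exists2 y', y' <= y & tiltable X0 y' u.
Proof.
move=> mu u0 u1.
have e0 : 0 < (1 - u) / 2 by rewrite divr_gt0 // subr_gt0.
have [n nP] := rv_tight X0 e0.
pose B (M : nat) : set R := [set z | - M%:R <= z] `&` [set z | z <= n%:R].
have mB M : measurable (B M).
  by apply: measurableI; [exact: (@measurable_ge _ _ _ id)|exact: (@measurable_le _ _ _ id)].
pose g M w := (\1_(B M) (X0 w) * neg_part w)%:E.
have mg M : measurable_fun setT (g M).
  by apply/measurable_EFinP/measurable_funM => //; exact: (measurableT_comp (measurable_indic (mB M))).
have g0 M w : setT w -> (0 <= g M w)%E.
  by move=> _; rewrite lee_fin mulr_ge0 // indicE; case: (_ \in _).
have ndg w : setT w -> nondecreasing_seq (g ^~ w).
  move=> _ m m' mn; rewrite lee_fin ler_wpM2r // !indicE ler_nat.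
  case: (boolP (_ \in B m)) => // ; rewrite inE => -[/= h h'].
  by rewrite mem_set //; split => //=; apply: le_trans h; rewrite lerN2 ler_nat.
have /= cv := cvg_monotone_convergence (mu := P') measurableT mg g0 ndg.
have E : (\int[P']_w limn (g ^~ w) = +oo)%E.
  rewrite -(neg_infinite mu); apply: eq_integral => w _; apply/cvg_lim => //.
  have [Xn|Xn] := leP (X0 w) n%:R; last first.
    have -> : g ^~ w = fun=> 0%:E.
      by apply/funext => M; rewrite /g /neg_part min_r ?oppr0 ?mulr0 // (le_trans _ (ltW Xn)).
    have -> : neg_part w = 0 by rewrite /neg_part min_r ?oppr0 // (le_trans _ (ltW Xn)).
    exact: cvg_cst.
  apply: cvg_near_cst; exists (Num.truncn `|X0 w|).+1 => // M /= Mx.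
  rewrite /g indicE mem_set ?mul1r //=; split => //=.
  rewrite lerNl; apply: le_trans (ler_norm _) _; rewrite normrN; apply: ltW.
  by apply: lt_le_trans (truncnS_gt _) _; rewrite ler_nat.
rewrite E in cv; have [M0 M0P] := cvge_gt (b := (n%:R + `|y|)%:E) cv (ltry _).
pose M := maxn M0 n.
have nM : ((n%:R + `|y|)%:E < \int[P']_w g M w)%E by apply: M0P; exact: leq_maxl.
have Bb b : B M b -> `|b| <= M%:R.
  move=> [/= h1 h2]; rewrite ler_norml h1 /=; apply: le_trans h2 _.
  by rewrite ler_nat leq_maxr.
have mid : measurable_fun setT (fun z : R => z) by exact: measurable_id.
have nb : bounded_rv (fun w => \1_(B M) (X0 w) * neg_part w).
  apply: (box_bounded X0 (mB M) (g := fun z => - Num.min z 0) (C := M%:R)).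
    by apply: measurableT_comp => //; exact: measurable_minr.
  move=> b /Bb; rewrite normrN; case: (leP b 0) => // _ _.
  by rewrite normr0.
pose a := box_mean X0 (B M) (fun z => z).
have b1 : bounded_rv (fun w => \1_(B M) (X0 w) * X0 w) by exact: (box_bounded X0 (mB M) mid Bb).
(* Positive values contribute at most [n], and the truncated negative part was chosen to have mean
   above [n + |y|]. *)
have ay : a <= - `|y|.
  have nM2 : n%:R + `|y| < mean P' (fun w => \1_(B M) (X0 w) * neg_part w).
    by rewrite -lte_fin -bounded_rvE.
  have : a <=
      mean P' (fun w => cst n%:R w + (-1) * (\1_(B M) (X0 w) * neg_part w)).
    apply: mean_le => //; first by apply: bounded_add; [exact: bounded_cst|exact: bounded_scale].
    move=> w; rewrite indicE; case: (boolP (_ \in _)); rewrite ?mul0r ?mulr0 ?addr0 //.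
    rewrite inE => -[/= _ h]; rewrite !mul1r mulN1r opprK /=.
    have := ler0n R n; by case: (leP (X0 w) 0) => _; lra.
  rewrite mean_add ?mean_scale ?mean_cst //; [|exact: bounded_cst|exact: bounded_scale].
  by move: nM2; set q := mean _ _; lra.
pose p := box_mgf X0 (B M) 0 0.
have pE : p%:E = P' (X0 @^-1` B M).
  rewrite -mean_indic; last exact: measurable_preimage_rv0.
  congr (_%:E); apply: eq_mean => w; rewrite mul0r expR0 mulr1 !indicE.
  by congr (_%:R); apply: asbool_equiv_eq.
have p1 : p <= 1 by rewrite -lee_fin pE probability_le1 //; exact: measurable_preimage_rv0.
have up : u < p.
  rewrite -lte_fin pE; apply: (@lt_le_trans _ _ (1 - (1 - u) / 2)%:E); first by rewrite lte_fin; lra.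
  apply: le_trans (nP n (leqnn n)) _; apply: le_measure; rewrite ?inE.
  - by apply: measurable_le; exact: measurableT_comp.
  - exact: measurable_preimage_rv0.
  - move=> w /=; rewrite ler_norml => /andP[h1 h2]; split => //=.
    by apply: le_trans h1; rewrite lerN2 ler_nat leq_maxr.
have p0 : 0 < p by exact: lt_trans up.
(* The mean of the normalized truncated law. Since [a <= - |y|] and [p <= 1] it is at most [y], and
   recentering there gives drift 0. *)
pose c := a / p.
have one b : B M b -> `|(1 : R)| <= M%:R + 1 by rewrite normr1 lerDr.
have Bb1 b : B M b -> `|b| <= M%:R + 1 by move=> /Bb h; rewrite (le_trans h) // lerDl.
have mgfE x : box_mgf X0 (B M) x 0 = p.
  by apply: eq_mean => w; rewrite !mul0r.
have oneE : box_mean X0 (B M) (fun=> 1) = p.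
  by apply: eq_mean => w; rewrite !mul0r expR0.
have mone : measurable_fun setT (fun _ : R => 1 : R) by exact: measurable_cst.
have ccB b : B M b -> `|- c * 1| <= M%:R + 1 + `|c|.
  by move=> _; rewrite mulr1 normrN lerDr addr_ge0.
have idB b : B M b -> `|b| <= M%:R + 1 + `|c|.
  by move=> /Bb1 h; rewrite (le_trans h) // lerDl.
have drift : box_mean X0 (B M) (fun z => z - c) = 0.
  rewrite (_ : (fun z : R => z - c) = fun z => z + (- c) * 1); last first.
    by apply/funext => z; rewrite mulr1.
  rewrite (box_mean_add X0 (mB M) mid _ idB ccB); last exact: measurable_funM.
  rewrite (box_mean_scale X0 (mB M) _ mone one) oneE -/a mulNr /c mulfVK ?gt_eqF //.
  exact: subrr.
exists c.
  rewrite /c ler_pdivrMr //; apply: le_trans ay _; rewrite lerNl -mulNr.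
  apply: le_trans (ler_norm _) _; rewrite normrM normrN (ger0_norm (ltW p0)).
  by rewrite ler_piMr.
exists (B M), 0, (M%:R + `|c|); split.
- exact: mB.
- by move=> b /Bb h; apply: le_trans (ler_normB _ _) _; rewrite lerD2r.
- by rewrite addr_ge0.
- by rewrite mgfE.
move=> x; apply: (box_mgf_ge0_drift (mB M) (L := M%:R + `|c|)).
- by move=> b /Bb h; apply: le_trans (ler_normB _ _) _; rewrite lerD2r.
- by rewrite addr_ge0.
by rewrite drift mulr0.
Qed.

End TiltableRate.

(** * Left of the mean, the rate is below 1 as soon as it is below 1 somewhere *)

Lemma expR_quadratic (R : realType) (z : R) : expR z <= 1 + z + z ^+ 2 * expR `|z|.
Proof.
have := expR_cosh_le (lexx `|z|); have := expR_ge1Dx (- z).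
by rewrite real_normK ?num_real //; lra.
Qed.

(** Only [expR v], not [v^2 expR v], will be known to be integrable. For [v >= 0], [th <= 1/2] and
    [v^2 <= 8 expR (v / 2)] bound the quadratic term by [8 expR v]; for [v < 0] it is bounded
    through [L]. *)
Lemma expR_scaled_quadratic (R : realType) (th v L : R) : 0 <= th -> th <= 2^-1 -> - L <= v -> 0 <= L ->
  expR (th * v) <= 1 + th * v + th ^+ 2 * (8 * expR v + L ^+ 2 * expR L).
Proof.
move=> th0 th1 Lv L0; apply: le_trans (expR_quadratic _) _.
rewrite lerD2l exprMn -mulrA ler_wpM2l ?exprn_ge0 // normrM (ger0_norm th0).
have [v0|v0] := leP 0 v.
  apply: (@le_trans _ _ (8 * expR v)); last by rewrite lerDl mulr_ge0 ?exprn_ge0 ?expR_ge0.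
  have h1 : v ^+ 2 <= 8 * expR (v / 2).
    have := @expR_ge1Dxn R (v / 2) 1 _; rewrite divr_ge0 // => /(_ isT).
    rewrite (_ : 2`!%:R = 2 :> R) // expr_div_n; lra.
  have h2 : expR (th * `|v|) <= expR (v / 2).
    by rewrite ler_expR (ger0_norm v0) mulrC ler_wpM2l.
  have -> : expR v = expR (v / 2) * expR (v / 2) by rewrite -expRD -splitr.
  by rewrite mulrA; apply: ler_pM => //; rewrite ?exprn_ge0 ?expR_ge0.
apply: (@le_trans _ _ (L ^+ 2 * expR L)); last by rewrite lerDr mulr_ge0 ?expR_ge0.
have vL : `|v| <= L by rewrite ltr0_norm // lerNl.
apply: ler_pM; rewrite ?expR_ge0 ?sqr_ge0 //.
  by rewrite -(real_normK (num_real v)) lerXn2r // nnegrE.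
rewrite ler_expR; apply: le_trans vL; rewrite -[leRHS]mul1r ler_wpM2r //; lra.
Qed.

Lemma small_scale (R : realFieldType) (m K : R) : 0 < m -> 0 <= K ->
  exists2 th, 0 < th <= 2^-1 & th ^+ 2 * K < th * m.
Proof.
move=> m0 K0; exists (Num.min 2^-1 (m / (2 * (K + 1)))).
  by rewrite lt_min invr_gt0 ltr0n /= ge_min lexx /= divr_gt0 // mulr_gt0 // ltr_wpDl.
set th := Num.min _ _.
have th0 : 0 < th by rewrite lt_min invr_gt0 ltr0n /= divr_gt0 // mulr_gt0 // ltr_wpDl.
rewrite expr2 -mulrA ltr_pM2l //.
have : th <= m / (2 * (K + 1)) by rewrite ge_min lexx orbT.
have K1 : 0 < 2 * (K + 1) by rewrite mulr_gt0 // ltr_wpDl.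
rewrite ler_pdivlMr // => h; have := mulr_ge0 (ltW th0) K0; nra.
Qed.

Section RateLt1.
Context d' (Omega' : measurableType d') (R : realType) (P' : probability Omega' R).
Variable X0 : {RV P' >-> R}.

(** A derivative at 0: one finite exponential moment gives the bound [1 + th x0 mz + O(th^2)] for
    the transform at [th x0], where [mz > 0] is the mean of [min(X0, n) - y] and [x0 < 0]. The
    truncation is there because [X0] may have mean [+oo]. *)
Lemma rate_lt1 (y y0 : R) : (y%:E < sup_truncated_mean X0)%E -> (rate X0 y0 < 1)%E ->
  (rate X0 y < 1)%E.
Proof.
move=> /truncated_mean_gt[n nP] /rate_lt_mgf[x0 x0le x0lt].
have x0n : x0 < 0.
  by rewrite lt_neqAle x0le andbT; apply: contraTneq x0lt => ->; rewrite mgf0 ltxx.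
have fin : (mgf X0 y x0 < +oo)%E.
  rewrite (mgf_shift X0 y0); apply: lte_mul_pinfty; rewrite ?lee_fin ?expR_ge0 //.
  by apply: lt_trans x0lt _; exact: ltry.
pose f w := Num.min (X0 w) n%:R.
have mf : measurable_fun setT f by exact: measurable_min_rv.
have fi : P'.-integrable setT (EFin \o f).
  by apply: (integrable_of_bounded_above (C := n%:R) mf _ nP) => w; rewrite ge_min lexx orbT.
pose L := - x0 * (n%:R + `|y|).
have L0 : 0 <= L by rewrite mulr_ge0 ?addr_ge0 // oppr_ge0.
pose v w := x0 * (f w - y).
have vL w : - L <= v w.
  rewrite /L mulNr opprK /v ler_wnM2l //; apply: lerD; first by rewrite ge_min lexx orbT.
  by rewrite -normrN ler_norm.
have mv : measurable_fun setT v by apply: measurable_funM => //; exact: measurable_funB.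
have iy : P'.-integrable setT (EFin \o cst y) by exact: (bounded_integrable P' (bounded_cst _ y)).
pose fy w := f w - y.
pose ev w := expR (v w).
pose tv (th : R) w := th * v w.
pose tev (th : R) w := th * ev w.
have ify : P'.-integrable setT (EFin \o fy).
  rewrite (_ : _ \o _ = ((EFin \o f) \- (EFin \o cst y))%E) //.
  exact: integrableB.
have iv : P'.-integrable setT (EFin \o v).
  rewrite (_ : _ \o _ = (fun w => x0%:E * (EFin \o fy) w)%E) //.
  exact: integrableZl.
have ie : P'.-integrable setT (EFin \o ev).
  apply/integrableP; split; first by apply/measurable_EFinP; exact: measurableT_comp.
  apply: (@le_lt_trans _ _ (\int[P']_w ((expR (x0 * (X0 w - y)))%:E + (cst (expR (x0 * (n%:R - y)))%:E w)))%E).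
    apply: ge0_le_integral => //.
    - by apply: measurableT_comp => //; apply/measurable_EFinP; exact: measurableT_comp.
    - by apply: emeasurable_funD => //; exact: measurable_mgf.
    move=> w _; rewrite /= lee_fin ger0_norm ?expR_ge0 // /ev /v /f.
    case: (leP (X0 w) n%:R) => _; [rewrite lerDl|rewrite lerDr]; exact: expR_ge0.
  rewrite ge0_integralD //; do ?[exact: measurable_mgf | by move=> w _; rewrite /= lee_fin expR_ge0].
  apply: lte_add_pinfty => //.
  rewrite [X in (X < _)%E](integral_cst P' measurableT).
  by rewrite [X in (_ * X)%E](probability_setT P') mule1 ltry.
pose mz : R := (\int[P']_w (f w - y))%R.
have mz0 : 0 < mz.
  rewrite /mz RintegralB // (_ : (\int[P']_w y)%R = y); last exact: (mean_cst P' y).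
  rewrite subr_gt0 -lte_fin /Rintegral fineK //; exact: (integrable_fin_num measurableT fi).
pose me : R := (\int[P']_w expR (v w))%R.
have me0 : 0 <= me by apply: Rintegral_ge0 => w _; exact: expR_ge0.
pose c := L ^+ 2 * expR L.
have c0 : 0 <= c by rewrite mulr_ge0 ?exprn_ge0 ?expR_ge0.
have [th /andP[th0 th1] thP] : exists2 th : R, 0 < th <= 2^-1 &
    th ^+ 2 * (8 * me + c) < th * (- x0 * mz).
  by apply: small_scale; [rewrite mulr_gt0 // oppr_gt0|rewrite addr_ge0 // mulr_ge0].
have ineq w : expR (th * v w) <= (1 + th ^+ 2 * c) + (th * v w + (th ^+ 2 * 8) * expR (v w)).
  have := expR_scaled_quadratic (ltW th0) th1 (vL w) L0; rewrite -/c; lra.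
pose h w := (1 + th ^+ 2 * c) + (th * v w + (th ^+ 2 * 8) * expR (v w)).
pose r w := tv th w + tev (th ^+ 2 * 8) w.
have i1 : P'.-integrable setT (EFin \o tv th).
  by rewrite (_ : _ \o _ = (fun w => th%:E * (EFin \o v) w)%E) //; exact: integrableZl.
have i2 : P'.-integrable setT (EFin \o tev (th ^+ 2 * 8)).
  by rewrite (_ : _ \o _ = (fun w => (th ^+ 2 * 8)%:E * (EFin \o ev) w)%E) //; exact: integrableZl.
pose tv1 := tv th.
pose tv2 := tev (th ^+ 2 * 8).
have i12 : P'.-integrable setT (EFin \o r).
  rewrite (_ : _ \o _ = ((EFin \o tv1) \+ (EFin \o tv2))%E) //.
  exact: integrableD.
pose cc : Omega' -> R := cst (1 + th ^+ 2 * c).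
have i3 : P'.-integrable setT (EFin \o cst (1 + th ^+ 2 * c)) by exact: (bounded_integrable P' (bounded_cst _ _)).
have ih : P'.-integrable setT (EFin \o h).
  rewrite (_ : _ \o _ = ((EFin \o cc) \+ (EFin \o r))%E) //.
  exact: integrableD.
have hE : (\int[P']_w h w)%R = 1 + th ^+ 2 * c + (th * (x0 * mz) + th ^+ 2 * 8 * me).
  have e1 : (\int[P']_w h w)%R = (\int[P']_w cc w)%R + (\int[P']_w r w)%R.
    exact: (RintegralD measurableT i3 i12).
  have e2 : (\int[P']_w r w)%R = (\int[P']_w tv1 w)%R + (\int[P']_w tv2 w)%R.
    exact: (RintegralD measurableT i1 i2).
  have e3 : (\int[P']_w tv1 w)%R = th * (\int[P']_w v w)%R by exact: (RintegralZl th measurableT iv).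
  have e4 : (\int[P']_w v w)%R = x0 * mz by exact: (RintegralZl x0 measurableT ify).
  have e5 : (\int[P']_w tv2 w)%R = th ^+ 2 * 8 * me by exact: (RintegralZl (th ^+ 2 * 8) measurableT ie).
  have e6 : (\int[P']_w cc w)%R = 1 + th ^+ 2 * c by exact: (mean_cst P').
  by rewrite e1 e2 e3 e4 e5 e6.
apply: (@le_lt_trans _ _ (mgf X0 y (th * x0))).
  by apply: rate_le_mgf; rewrite mulr_ge0_le0 // ltW.
apply: (@le_lt_trans _ _ (\int[P']_w (h w)%:E)%E).
  apply: ge0_le_integral => //.
  - exact: measurable_mgf.
  - by apply/measurable_EFinP; case/integrableP: ih => /measurable_EFinP.
  (* As [th * x0 <= 0], replacing [X0] by the smaller [min(X0, n)] increases the exponential. *)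
  move=> w _; rewrite lee_fin; apply: le_trans (ineq w); rewrite /v mulrA ler_expR.
  by apply: ler_wnM2l; [rewrite mulr_ge0_le0 // ltW|rewrite lerD2r ge_min lexx].
have -> : (\int[P']_w (h w)%:E)%E = (\int[P']_w h w)%R%:E.
  by rewrite /Rintegral fineK //; exact: (integrable_fin_num measurableT ih).
rewrite hE lte_fin; move: thP; rewrite mulrDr; lra.
Qed.

End RateLt1.

(** * The strong law of large numbers *)

Lemma nneseries_geometric (R : realType) (r : R) : 0 <= r -> r < 1 ->
  (\sum_(0 <= n <oo) (r ^+ n)%:E < +oo)%E.
Proof.
move=> r0 r1; apply: (@le_lt_trans _ _ ((1 - r)^-1)%:E); last exact: ltry.
have r1' : 0 < 1 - r by rewrite subr_gt0.
apply: lime_le; first by apply: is_cvg_nneseries => n _ _; rewrite lee_fin exprn_ge0.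
apply: nearW => N; rewrite sumEFin lee_fin -[leRHS]mul1r ler_pdivlMr //.
suff -> : (\sum_(0 <= n < N) r ^+ n) * (1 - r) = 1 - r ^+ N by rewrite lerBlDr lerDl exprn_ge0.
elim: N => [|N IH]; first by rewrite big_nil mul0r expr0 subrr.
by rewrite big_nat_recr //= mulrDl IH exprS; ring.
Qed.

Section BorelCantelli.
Context d (Omega : measurableType d) (R : realType) (P : probability Omega R).

Lemma borel_cantelli_geometric (E : nat -> set Omega) (r : R) : 0 <= r -> r < 1 ->
  (forall n, measurable (E n)) -> (forall n, (P (E n) <= (r ^+ n)%:E)%E) ->
  {ae P, forall w, exists N, forall n, (N <= n)%N -> ~ E n w}.
Proof.
move=> r0 r1 mE PE; exists (lim_sup_set E); split.
- apply: bigcapT_measurable => n.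
  by apply: bigcup_measurable => k _; exact: mE.
- apply: lim_sup_set_cvg0 => //; apply: le_lt_trans (nneseries_geometric r0 r1).
  by apply: lee_nneseries => [n _ _|n _]; [exact: measure_ge0|exact: PE].
move=> w /= /forallNP nE n _ /=.
have /existsNP[k /not_implyP[nk Ek]] := nE n.
by exists k => //; exact: contrapT.
Qed.

(** Suits statements proved off an event that depends on [e]; [Q] itself need not be measurable. *)
Lemma ae_of_small (Q : Omega -> Prop) :
  (forall e : R, 0 < e -> exists2 F, measurable F & (P F <= e%:E)%E /\ {ae P, forall w, ~ F w -> Q w}) ->
  {ae P, forall w, Q w}.
Proof.
move=> h; have /choice[G GP] : forall n : nat, exists G : set Omega, [/\ measurable G,
    (P G <= (n.+1%:R^-1)%:E)%E & forall w, ~ G w -> Q w].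
  move=> n; have [|F mF [PF [N [mN N0 NP]]]] := h n.+1%:R^-1; first by rewrite invr_gt0.
  exists (F `|` N); split; first exact: measurableU.
    apply: le_trans (measureU2 P mF mN) _.
    by rewrite [X in (_ + X)%E]N0 adde0.
  move=> w /not_orP[nF nN]; apply: contrapT => nQ; apply: nN; apply: NP.
  by move=> /= /(_ nF).
pose B := \bigcap_n G n.
have mB : measurable B by apply: bigcapT_measurable => n; case: (GP n).
exists B; split => //.
- apply/eqP; rewrite -measure_le0; apply/lee_addgt0Pr => e e0; rewrite add0e.
  pose n := Num.truncn e^-1.
  have [mG PG _] := GP n.
  apply: le_trans (le_measure P (mem_set mB) (mem_set mG) _) _; first by move=> w; apply.
  apply: le_trans PG _; rewrite lee_fin -[leRHS]invrK lef_pV2 ?posrE ?invr_gt0 //.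
  exact/ltW/truncnS_gt.
- by move=> w /= nQ n _; apply: contrapT => nG; apply: nQ; case: (GP n) => _ _; apply.
Qed.

End BorelCantelli.

Section Maximal.
Context d (Omega : measurableType d) (R : realType) (P : probability Omega R).
Context d' (Omega' : measurableType d') (P' : probability Omega' R).
Variables (I : choiceType) (D : set I) (X : I -> {RV P >-> R}) (X0 : {RV P' >-> R}).
Hypothesis X_indep : mutually_independent D X.
Hypothesis X_law : forall i, D i -> same_law (X i) X0.
Variable r : nat -> I.
Hypothesis r_inj : injective r.
Hypothesis rD : forall n, D (r n).
Variables (g : R -> R) (C : R).
Hypothesis mg : measurable_fun setT g.
Hypothesis gC : forall z, `|g z| <= C.

(** The largest of 0 and the first [n] partial sums from index [i], by Lindley's recursion, which
    isolates the first step from an independent remainder. *)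
Fixpoint running_max n i w : R :=
  if n is n'.+1 then Num.max 0 (g (X (r i) w) + running_max n' i.+1 w) else 0.

Lemma running_max_in n i : measurable_in X [set r j | j in [set j | (i <= j)%N]] (running_max n i).
Proof.
elim: n i => [|n IH] i /=; first exact: measurable_cst.
apply: measurable_maxr; first exact: measurable_cst.
apply: measurable_funD.
  by apply: measurable_in_comp => //; exists i => /=.
apply: (measurable_in_sub _ (IH i.+1)) => _ [j /= ij <-]; exists j => //=.
exact: ltnW.
Qed.

Lemma running_max_ge0 n i w : 0 <= running_max n i w.
Proof. by case: n => [|n] //=; rewrite le_max lexx. Qed.

Lemma running_max_bounded n i : bounded_rv (running_max n i).
Proof.
split; first exact: (measurable_inE (@running_max_in n i)).
exists (n%:R * C) => w; rewrite ger0_norm ?running_max_ge0 //.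
have C0 : 0 <= C by apply: le_trans (gC 0).
elim: n i => [|n IH] i /=; first by rewrite mul0r.
rewrite ge_max mulr_ge0 //= -natr1 mulrDl mul1r addrC; apply: lerD => //.
by apply: le_trans (ler_norm _) (gC _).
Qed.

Lemma running_max_mono n i w : running_max n i w <= running_max n.+1 i w.
Proof.
elim: n i => [|n IH] i; first exact: running_max_ge0.
rewrite [leRHS]/= [leLHS]/=; rewrite ge_max !le_max lexx /=; apply/orP; right.
by rewrite lerD2l; exact: IH.
Qed.

Lemma running_max_ge_sum n m i w : (m <= n)%N ->
  \sum_(j < m) g (X (r (i + j)) w) <= running_max n i w.
Proof.
elim: n m i => [|n IH] [|m] i //=; rewrite ?big_ord0 ?running_max_ge0 // => mn.
  by rewrite le_max lexx.
rewrite big_ord_recl /= addn0 le_max; apply/orP; right; rewrite lerD2l.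
by apply: le_trans (IH m i.+1 mn); apply: ler_sum => j _; rewrite /= /bump /= add1n addnS addSn.
Qed.

(** Stationarity, by induction: the first step and the independent remainder have laws that do not
    depend on the starting index. *)
Lemma running_max_law n i (G : R -> \bar R) : measurable_fun setT G -> (forall z, (0 <= G z)%E) ->
  (\int[P]_w G (running_max n i w) = \int[P]_w G (running_max n 0 w))%E.
Proof.
elim: n i G => [|n IH] i G mG G0 //.
pose H (z : R * R) := G (Num.max 0 (g z.1 + z.2)).
have mH : measurable_fun setT H.
  apply: measurableT_comp => //; apply: measurable_maxr => //.
  by apply: measurable_funD => //; exact: measurableT_comp.
have mH1 a : measurable_fun setT (fun z => H (a, z)).
  by apply: measurableT_comp => //; exact: measurable_pair1.
pose K a := (\int[P]_w H (a, running_max n 0 w))%E.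
have mK : measurable_fun setT K.
  pose H2 (z : R * Omega) := H (z.1, running_max n 0 z.2).
  have mH2 : measurable_fun setT H2.
    apply: measurableT_comp => //; apply: measurable_fun_pair => //.
    by apply: measurableT_comp => //; exact: (measurable_inE (@running_max_in n 0)).
  by have := @measurable_fun_fubini_tonelli_F _ _ _ _ _ P _ mH2; apply => z; exact: G0.
have step k : (\int[P]_w G (running_max n.+1 k w) = \int[P']_w K (X0 w))%E.
  transitivity (\int[P]_w H (X (r k) w, running_max n k.+1 w))%E; first by [].
  have rk : [set r k] `&` [set r j | j in [set j | (k.+1 <= j)%N]] = set0.
    apply/seteqP; split => // _ [-> [j /= kj /r_inj jk]].
    by rewrite jk ltnn in kj.
  have m1 : measurable_in X [set r k] (X (r k)) by exact: measurable_in_rv.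
  have m2 := @running_max_in n k.+1.
  rewrite (indep_integral X_indep _ _ rk m1 m2 mH).
  - rewrite -(law_integral X_law (rD k) mK); last by move=> a; apply: integral_ge0 => w _; exact: G0.
    apply: eq_integral => w _.
    by apply: (IH k.+1 (fun z => H (X (r k) w, z)) (mH1 _)) => z; exact: G0.
  - by move=> _ ->.
  - by move=> _ [j _ <-].
  - by move=> z; exact: G0.
by rewrite !step.
Qed.

(* Garsia: on the event that the maximum M is positive, M = g(X_0) + M', where M'
   has the law of the maximum over one step fewer, hence mean at most that of M. *)
Lemma mean_on_positive_max n :
  0 <= mean P (fun w => \1_[set w | 0 < running_max n.+1 0 w] w * g (X (r 0) w)).
Proof.
pose E := [set w | 0 < running_max n.+1 0 w].
have mE : measurable E by apply: measurable_gt; exact: (measurable_inE (@running_max_in n.+1 0)).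
have b1 := running_max_bounded n.+1 0; have b2 := running_max_bounded n 1.
have b3 := running_max_bounded n 0.
have bg : bounded_rv (fun w => g (X (r 0) w)).
  split; first exact: measurableT_comp.
  by exists C => w; exact: gC.
have bE := bounded_mul (bounded_indic R mE) bg.
have h1 : mean P (running_max n.+1 0) <= mean P (fun w => \1_E w * g (X (r 0) w) + running_max n 1 w).
  apply: mean_le => //; first exact: bounded_add.
  move=> w; rewrite indicE; case: (boolP (w \in E)) => [|]; rewrite ?inE ?notin_setE /E /=.
    rewrite lt_max ltxx /= => h; rewrite mul1r ge_max lexx andbT; exact: ltW.
  move/negP; rewrite -leNgt => h; rewrite mul0r add0r; apply: le_trans h _.
  exact: running_max_ge0.
rewrite mean_add // in h1.
have h2 : mean P (running_max n 1) = mean P (running_max n 0).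
  have := running_max_law n 1 (G := fun z => `|z%:E|%E).
  rewrite /mean => h; congr fine.
  have e0 i : (\int[P]_w (running_max n i w)%:E = \int[P]_w `|(running_max n i w)%:E|)%E.
    by apply: eq_integral => w _; rewrite /= ger0_norm ?running_max_ge0.
  by rewrite !e0 h // ; apply: measurableT_comp => //; exact: measurable_EFin.
have h3 : mean P (running_max n 0) <= mean P (running_max n.+1 0).
  by apply: mean_le => // w; exact: running_max_mono.
by rewrite -(lerD2r (mean P (running_max n 1))) add0r h2; apply: le_trans h3 _; rewrite -h2.
Qed.

End Maximal.

Lemma min_add (R : realDomainType) (x K N : R) : 0 <= N ->
  Num.min x (K + N) = Num.min x K + Num.min (Num.max (x - K) 0) N.
Proof.
move=> N0; have [h|h] := leP x K.
  rewrite (max_r (_ : x - K <= 0)) ?subr_le0 // (min_l N0) addr0 min_l //.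
  by apply: le_trans h _; rewrite lerDl.
rewrite (max_l (_ : 0 <= x - K)) ?subr_ge0 1?ltW // addr_minr.
by rewrite subrKC.
Qed.

Section RunningMaxCompare.
Context d (Omega : measurableType d) (R : realType) (P : probability Omega R).
Variables (I : choiceType) (X : I -> {RV P >-> R}) (r : nat -> I).

Lemma running_max_le (g g' : R -> R) n n' i w : (forall z, g z <= g' z) -> (n <= n')%N ->
  running_max X r g n i w <= running_max X r g' n' i w.
Proof.
move=> gg; elim: n n' i => [|n IH] [|n'] i //= nn; first by rewrite le_max lexx.
rewrite ge_max !le_max lexx /=; apply/orP; right; apply: lerD => //; exact: IH.
Qed.

End RunningMaxCompare.

Section StrongLaw.
Context d (Omega : measurableType d) (R : realType) (P : probability Omega R).
Context d' (Omega' : measurableType d') (P' : probability Omega' R).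
Variables (I : choiceType) (D : set I) (X : I -> {RV P >-> R}) (X0 : {RV P' >-> R}).
Hypothesis X_indep : mutually_independent D X.
Hypothesis X_law : forall i, D i -> same_law (X i) X0.
Variable r : nat -> I.
Hypothesis r_inj : injective r.
Hypothesis rD : forall n, D (r n).
Variable m : R.
Hypothesis mE : sup_truncated_mean X0 = m%:E.

Let mean_min n : (\int[P']_w (Num.min (X0 w) n%:R)%:E <= m%:E)%E.
Proof. by rewrite -mE; apply: ereal_sup_ubound; exists n => //; rewrite unlock. Qed.

(** [min(X0, K + N)] is [min(X0, K)] plus the truncated excess, and the means of these two minima
    lie between [m - eta e] and [m]. *)
Let tail_excess_bound (K : nat) (e eta : R) : 0 < e -> ((m - eta * e)%:E < \int[P']_w (Num.min (X0 w) K%:R)%:E)%E ->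
  forall N : nat, mean P' (fun w => Num.min (Num.max (X0 w - K%:R) 0) N%:R) <= eta * e.
Proof.
move=> e0 KP N.
pose f2 w := Num.min (Num.max (X0 w - K%:R) 0) N%:R.
pose f1 w := Num.min (X0 w) (K + N)%:R; pose f0 w := Num.min (X0 w) K%:R.
have i0 : P'.-integrable setT (EFin \o f0).
  apply: (integrable_of_bounded_above (C := K%:R) (measurable_min_rv X0 K%:R) _ KP) => w.
  by rewrite ge_min lexx orbT.
have i1 : P'.-integrable setT (EFin \o f1).
  have bd : bounded_rv (fun w => Num.min (Num.max (X0 w - K%:R) 0) N%:R).
    split.
      apply: measurable_minr => //; apply: measurable_maxr => //.
      exact: measurable_funB.
    exists N%:R => w; rewrite ger0_norm ?ge_min ?lexx ?orbT // le_min ler0n andbT.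
    by rewrite le_max lexx orbT.
  have -> : EFin \o f1 = ((EFin \o f0) \+ (EFin \o f2))%E.
    apply/funext => w /=; rewrite -EFinD; congr (_%:E); rewrite /f1 /f0 /f2 natrD.
    exact: min_add.
  by apply: integrableD => //; exact: bounded_integrable.
have -> : mean P' (fun w => Num.min (Num.max (X0 w - K%:R) 0) N%:R) =
    (\int[P']_w f1 w)%R - (\int[P']_w f0 w)%R.
  rewrite -RintegralB //; congr fine; apply: eq_integral => w _; congr (_%:E); rewrite /f1 /f0 natrD.
  by rewrite min_add // [RHS]addrAC subrr add0r.
have l1 : (\int[P']_w f1 w)%R <= m.
  by rewrite -lee_fin /Rintegral fineK ?(integrable_fin_num measurableT i1) //; exact: mean_min.
have l0 : m - eta * e < (\int[P']_w f0 w)%R.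
  by rewrite -lte_fin /Rintegral fineK // (integrable_fin_num measurableT i0).
lra.
Qed.

Let excess (K : nat) (e : R) (N : nat) (z : R) : R := Num.min (Num.max (z - K%:R) 0) N%:R - e.

Let excess_measurable K e N : measurable_fun setT (excess K e N).
Proof.
apply: measurable_funB => //; apply: measurable_minr => //; apply: measurable_maxr => //.
exact: measurable_funB.
Qed.

Let excess_bounded K e N z : 0 < e -> `|excess K e N z| <= N%:R + e.
Proof.
move=> e0; apply: le_trans (ler_normB _ _) _; rewrite (ger0_norm (ltW e0)) lerD2r.
rewrite ger0_norm; first by rewrite ge_min lexx orbT.
by rewrite le_min ler0n andbT le_max lexx orbT.
Qed.

Let exceed K e N := [set w | 0 < running_max X r (excess K e N) N.+1 0 w].

Let exceed_measurable K e N : measurable (exceed K e N).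
Proof.
apply: measurable_gt; exact: (measurable_inE (@running_max_in _ _ _ _ _ _ r _ (excess_measurable K e N) N.+1 0)).
Qed.

(** The maximal inequality for [Z - e], with [Z] the truncated excess over [K], gives [e P(E) <=
    E[Z 1_E] <= E[Z] <= eta e]. *)
Let exceed_prob (K : nat) (e eta : R) N : 0 < e ->
  ((m - eta * e)%:E < \int[P']_w (Num.min (X0 w) K%:R)%:E)%E -> (P (exceed K e N) <= eta%:E)%E.
Proof.
move=> e0 KP; have bd z : `|excess K e N z| <= N%:R + e by exact: excess_bounded.
have := mean_on_positive_max X_indep X_law r_inj rD (excess_measurable K e N) bd N.
rewrite -/(exceed K e N); set E := exceed K e N => h.
have mEv := exceed_measurable K e N.
pose z w := Num.min (Num.max (X (r 0) w - K%:R) 0) N%:R.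
have bz : bounded_rv z.
  split.
    apply: measurable_minr => //; apply: measurable_maxr => //.
    exact: measurable_funB.
  exists N%:R => w; rewrite ger0_norm ?ge_min ?lexx ?orbT // le_min ler0n andbT.
  by rewrite le_max lexx orbT.
have bE := bounded_indic R mEv.
have h2 : mean P (fun w => \1_E w * excess K e N (X (r 0) w)) <= mean P (fun w => z w + (- e) * \1_E w).
  apply: mean_le.
  - apply: bounded_mul => //; split; first exact: measurableT_comp.
    by exists (N%:R + e) => w.
  - by apply: bounded_add => //; exact: bounded_scale.
  move=> w; rewrite indicE; case: (_ \in _); rewrite ?mul1r ?mul0r ?mulr1 ?mulr0 ?addr0 //.
  by rewrite le_min ler0n andbT le_max lexx orbT.
rewrite mean_add // ?mean_scale // in h2; last exact: bounded_scale.
have h3 : mean P z <= eta * e.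
  apply: le_trans (tail_excess_bound e0 KP N); rewrite /mean.
  pose gz (y : R) := `|(Num.min (Num.max (y - K%:R) 0) N%:R)%:E|%E.
  have gE (y : R) : (Num.min (Num.max (y - K%:R) 0) N%:R)%:E = gz y.
    by rewrite /gz /= ger0_norm // le_min ler0n andbT le_max lexx orbT.
  under eq_integral do rewrite gE.
  under [X in _ <= fine X]eq_integral do rewrite gE.
  rewrite (law_integral X_law (rD 0)) //.
    apply: measurableT_comp => //; apply/measurable_EFinP; apply: measurable_minr => //; apply: measurable_maxr => //.
    exact: measurable_funB.
  by move=> y; exact: abse_ge0.
rewrite -mean_indic // lee_fin -(ler_pM2r e0).
by have := le_trans h h2; lra.
Qed.

Let excess_mono K e N N' z : (N <= N')%N -> excess K e N z <= excess K e N' z.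
Proof.
move=> NN; rewrite lerD2r le_min ge_min lexx /= ge_min; apply/orP; right.
by rewrite ler_nat.
Qed.

(** Controls the unbounded upper tail for all [n] at once, off a small event; the bound on the
    probability is uniform in the cap [N], which is then sent to infinity. *)
Lemma positive_part_control (e eta : R) : 0 < e -> 0 < eta ->
  exists (K : nat) (F : set Omega), [/\ ((m - eta * e)%:E < \int[P']_w (Num.min (X0 w) K%:R)%:E)%E,
    measurable F, (P F <= eta%:E)%E & forall w, ~ F w ->
    forall n, \sum_(j < n) Num.max (X (r j) w - K%:R) 0 <= e * n%:R].
Proof.
move=> e0 eta0; have : ((m - eta * e)%:E < sup_truncated_mean X0)%E.
  by rewrite mE lte_fin ltrBlDr ltrDl mulr_gt0.
move=> /truncated_mean_gt[K KP]; exists K, (\bigcup_N exceed K e N); split => //.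
- exact: bigcupT_measurable.
- have nd : nondecreasing_seq (exceed K e).
    move=> N N' NN; apply/subsetPset => w /= h; apply: lt_le_trans h _.
    by apply: running_max_le; [move=> z; exact: excess_mono|rewrite ltnS].
  have cv := nondecreasing_cvg_mu (mu := P) (exceed_measurable K e) (bigcupT_measurable _ (exceed_measurable K e)) nd.
  by apply: (cvge_le _ cv); apply: nearW => N; exact: exceed_prob.
move=> w nF n.
(* So large a cap [N] leaves the first [n] excesses untouched. *)
pose M := (\max_(j < n) (Num.truncn `|X (r j) w - K%:R|%R).+1)%N.
pose N := maxn n M.
have : running_max X r (excess K e N) N.+1 0 w <= 0.
  by rewrite leNgt; apply/negP => h; apply: nF; exists N.
move=> h; have := le_trans (@running_max_ge_sum _ _ _ _ _ X r (excess K e N) N.+1 n 0 w _) h.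
rewrite (leq_trans (leq_maxl n M)) // => /(_ isT).
pose q (j : 'I_n) : R := Num.max (X (r j) w - K%:R) 0 - e.
rewrite (eq_bigr q); last first.
  move=> j _; rewrite add0n /excess /q; congr (_ - _); apply: min_l.
  rewrite ge_max ler0n andbT; apply: le_trans (ler_norm _) _; apply: ltW.
  apply: lt_le_trans (truncnS_gt _) _; rewrite ler_nat; apply: leq_trans (leq_maxr n M).
  exact: (leq_bigmax j).
by rewrite /q sumrB sumr_const card_ord -[e *+ n]mulr_natr subr_le0.
Qed.

(** Cutting below at [- k] makes the variables bounded and, for large [k], keeps the mean below
    [m + e]; a small tilt [th] then gives an exponential moment below 1, hence geometric
    probabilities. *)
Lemma bounded_part_control (K : nat) (b : \bar R) (e : R) : 0 < e ->
  (b < \int[P']_w (Num.min (X0 w) K%:R)%:E)%E ->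
  {ae P, forall w, exists N, forall n, (N <= n)%N ->
    \sum_(j < n) Num.min (X (r j) w) K%:R <= (m + e) * n%:R}.
Proof.
move=> e0 bK; pose f w := Num.min (X0 w) K%:R.
have fi : P'.-integrable setT (EFin \o f).
  apply: (integrable_of_bounded_above (C := K%:R) (measurable_min_rv X0 K%:R) _ bK) => w.
  by rewrite ge_min lexx orbT.
pose h (k : nat) (z : R) := Num.max (Num.min z K%:R) (- k%:R).
have mh k : measurable_fun setT (h k).
  by apply: measurable_maxr => //; exact: measurable_minr.
have hb k z : `|h k z| <= K%:R + k%:R.
  rewrite ler_norml /h; apply/andP; split; last first.
    by rewrite ge_max ge_min lerDl ler0n orbT /= -subr_ge0 opprK !addr_ge0.
  by rewrite le_max; apply/orP; right; rewrite lerN2 lerDr.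
have cv : (\int[P']_w (h k (X0 w))%:E)%E @[k --> \oo] --> (\int[P']_w (f w)%:E)%E.
  apply: (@dominated_cvg _ _ _ P' setT measurableT (fun k w => (h k (X0 w))%:E) _ (fun w => `|(f w)%:E|%E)) => //.
  - by move=> k; apply/measurable_EFinP; exact: measurableT_comp.
  - move=> w _; apply: cvg_near_cst; exists (Num.truncn `|f w|).+1 => // k /= kw.
    congr (_%:E); rewrite /h max_l // lerNl; apply: le_trans (ler_norm _) _.
    by rewrite normrN; apply: ltW; apply: lt_le_trans (truncnS_gt _) _; rewrite ler_nat.
  - exact: integrable_abse.
  - move=> k w _; rewrite /= lee_fin /h -/(f w); case: (leP (- k%:R) (f w)) => // fk.
    rewrite normrN (ger0_norm (ler0n _ k)); apply: le_trans (_ : - f w <= _).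
      by rewrite lerNr ltW.
    by rewrite -normrN ler_norm.
have [k kP] : exists k, (\int[P']_w (h k (X0 w))%:E < (m + e)%:E)%E.
  have /cv[k _ kP] : nbhs (\int[P']_w (f w)%:E)%E [set y | (y < (m + e)%:E)%E].
    apply: open_nbhs_nbhs; split; first exact: open_ereal_lt_ereal.
    by rewrite /=; apply: le_lt_trans (mean_min K) _; rewrite lte_fin ltrDl.
  by exists k; exact: (kP k (leqnn k)).
pose c := m + e; pose v z := h k z - c; pose L := K%:R + k%:R + `|c|.
have L0 : 0 <= L by rewrite !addr_ge0.
have vL z : `|v z| <= L by apply: le_trans (ler_normB _ _) _; rewrite lerD2r.
have mv : measurable_fun setT v by exact: measurable_funB.
have bv : bounded_rv (fun w => v (X0 w)).
  by split; [exact: measurableT_comp|exists L => w].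
have bh : bounded_rv (fun w => h k (X0 w)).
  by split; [exact: measurableT_comp|exists (K%:R + k%:R) => w].
have mneg : 0 < - mean P' (fun w => v (X0 w)).
  have -> : mean P' (fun w => v (X0 w)) = mean P' (fun w => h k (X0 w)) - c.
    by rewrite -[X in _ - X](mean_cst P') -mean_sub //; exact: bounded_cst.
  by rewrite oppr_gt0 subr_lt0 -lte_fin -bounded_rvE.
have Lc0 : 0 <= L ^+ 2 * expR L by rewrite mulr_ge0 ?exprn_ge0 ?expR_ge0.
have [th /andP[th0 th1] thP] := small_scale mneg Lc0.
have ineq z : expR (th * v z) <= 1 + th ^+ 2 * (L ^+ 2 * expR L) + th * v z.
  apply: le_trans (expR_quadratic _) _; rewrite addrAC lerD2r lerD2l exprMn -mulrA.
  rewrite ler_wpM2l ?exprn_ge0 // ?(ltW th0) //; apply: ler_pM; rewrite ?expR_ge0 ?sqr_ge0 //.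
    by rewrite -(real_normK (num_real (v z))) lerXn2r // nnegrE.
  rewrite ler_expR normrM (ger0_norm (ltW th0)); apply: le_trans (vL z).
  by rewrite -[leRHS]mul1r ler_wpM2r //; lra.
have be : bounded_rv (fun w => expR (th * v (X0 w))).
  split; first by apply: measurableT_comp => //; apply: measurable_funM => //; exact: measurableT_comp.
  exists (expR (th * L)) => w; rewrite ger0_norm ?expR_ge0 // ler_expR ler_pM2l //.
  exact: le_trans (ler_norm _) (vL _).
pose a := mean P' (fun w => expR (th * v (X0 w))).
have a0 : 0 <= a by apply: mean_ge0 => w; exact: expR_ge0.
have a1 : a < 1.
  have : a <= mean P' (fun w => cst (1 + th ^+ 2 * (L ^+ 2 * expR L)) w + th * v (X0 w)).
    by apply: mean_le => //; apply: bounded_add; [exact: bounded_cst|exact: bounded_scale].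
  rewrite mean_add ?mean_cst ?mean_scale //; [|exact: bounded_cst|exact: bounded_scale].
  by move: thP; rewrite mulrN; set q := th * mean _ _; lra.
pose s n := [seq r j | j <- index_iota 0 n].
have us n : uniq (s n) by rewrite map_inj_uniq // iota_uniq.
have sD n : [set` s n] `<=` D by move=> i /= /mapP[j _ ->].
have mtv : measurable_fun setT (fun z => th * v z) by exact: measurable_funM.
have PE n := chernoff X_indep X_law (us n) (sD n) mtv (bounded_rvE P' be).
have sz n : size (s n) = n by rewrite size_map size_iota subn0.
pose E n := [set w | 0 <= \sum_(i <- s n) th * v (X i w)].
have mEv n : measurable (E n).
  by apply: measurable_ge; exact: (measurable_inE (measurable_in_sum (sD n) mtv)).
have PE' n : (P (E n) <= (a ^+ n)%:E)%E by have := PE n; rewrite sz.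
apply: filterS (borel_cantelli_geometric a0 a1 mEv PE') => w [N NP].
exists N => n nN; have := NP n nN; rewrite /E /= => /negP; rewrite -ltNge.
rewrite big_map big_mkord -mulr_sumr pmulr_rlt0 // sumrB sumr_const card_ord subr_lt0 => hs.
apply: le_trans (_ : \sum_(j < n) h k (X (r j) w) <= _).
  by apply: ler_sum => j _; rewrite /h le_max lexx.
by rewrite mulr_natr ltW.
Qed.

(** Only the upper half is proved here: where the law is applied, the lower half is a large
    deviation bound. *)
Lemma lln_upper (e : R) : 0 < e ->
  {ae P, forall w, exists N, forall n, (N <= n)%N -> \sum_(j < n) X (r j) w <= (m + e) * n%:R}.
Proof.
move=> e0; have e20 : 0 < e / 2 by rewrite divr_gt0.
apply: ae_of_small => eta eta0.
have [K [F [KP mF PF FP]]] := positive_part_control e20 eta0.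
exists F => //; split => //.
apply: filterS (bounded_part_control e20 KP) => w [N NP] nF; exists N => n nN.
have h1 := FP w nF n; have h2 := NP n nN.
have -> : \sum_(j < n) X (r j) w = \sum_(j < n) Num.min (X (r j) w) K%:R +
    \sum_(j < n) Num.max (X (r j) w - K%:R) 0.
  rewrite -big_split /=; apply: eq_bigr => j _.
  by case: (leP (X (r j) w) K%:R) => h; case: leP => h'; lra.
apply: le_trans (lerD h2 h1) _; rewrite -mulrDl; apply: ler_wpM2r => //; lra.
Qed.

End StrongLaw.

(** * Hausdorff measure of the boundary *)

Section BoundaryMetric.
Variables (R : realType) (T : rooted_tree).
Implicit Types (s t : boundary T) (v : T).
Local Notation dist := (@boundary_dist R T).

Definition through v : set (boundary T) := [set s | s (depth v) = v].

Lemma ray_eq_le s t m n : (m <= n)%N -> s n = t n -> s m = t m.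
Proof. by move=> mn st; rewrite -(anc_ray s mn) st anc_ray. Qed.

Lemma through_eq s t n : s n = t n <-> through (s n) t.
Proof. by rewrite /through /= depth_ray; split => ->. Qed.

Let edge s i : set T := [set s i; s i.+1].

Let edge_depth s i v : edge s i v -> depth v = i \/ depth v = i.+1.
Proof. by case => ->; rewrite depth_ray; [left|right]. Qed.

Let edge_inj s t i j : edge s i = edge t j -> i = j /\ s i.+1 = t i.+1.
Proof.
move=> e; have h1 : edge t j (s i) by rewrite -e; left.
have h2 : edge t j (s i.+1) by rewrite -e; right.
have ij : i = j.
  by case: (edge_depth h1); case: (edge_depth h2); rewrite !depth_ray; lia.
split => //; rewrite -ij in h2; case: h2 => // e2.
by have := congr1 (@depth T) e2; rewrite !depth_ray; lia.
Qed.

Let common s t : set (set T) := ray_edges s `&` ray_edges t.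

Let dist_finite s t : finite_set (common s t) ->
  dist s t = expR (- (#|` fset_set (common s t)|)%:R).
Proof.
by move=> fc; rewrite /boundary_dist /counting -/(common s t); case: asboolP.
Qed.

Lemma dist_le s t n : s n = t n -> dist s t <= expR (- n%:R).
Proof.
move=> st; rewrite /boundary_dist /counting -/(common s t); case: asboolP => [fc|_]; last first.
  exact: expR_ge0.
rewrite /= ler_expR lerN2 ler_nat -(size_iota 0 n) -(size_map (edge s)).
apply: uniq_leq_size.
  by rewrite map_inj_uniq ?iota_uniq // => i j /edge_inj[].
move=> x /mapP[i]; rewrite mem_iota add0n => /= ilt ->{x}.
rewrite in_fset_set // inE; split; exists i => //.
have e1 := ray_eq_le ilt st; have e2 := ray_eq_le (ltnW ilt) st.
by rewrite /edge e1 e2.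
Qed.

(** The shift of index matters: rays that have separated by depth [n + 1] share at most [n]
    edges. *)
Lemma dist_ge s t n : s n.+1 <> t n.+1 -> expR (- n%:R) <= dist s t.
Proof.
move=> st; have sub : common s t `<=` [set` [seq edge s i | i <- iota 0 n]].
  move=> _ [[i _ <-] [j _ e]] /=; apply: map_f; rewrite mem_iota add0n /=.
  have [ji e2] := edge_inj (esym e); rewrite ltnNge; apply/negP => ni.
  by apply: st; apply: (ray_eq_le (n := i.+1)).
have fc : finite_set (common s t) by apply: sub_finite_set sub (finite_seq _).
rewrite dist_finite // ler_expR lerN2 ler_nat -[leqRHS](size_iota 0 n) -[leqRHS](size_map (edge s)).
apply: uniq_leq_size; first exact: fset_uniq.
by move=> x; rewrite in_fset_set // inE => /sub.
Qed.

Local Open Scope ereal_scope.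

Lemma diameter_ge0 (A : set (boundary T)) : 0 <= diameter dist A.
Proof. by apply: ereal_sup_ubound; left. Qed.

Lemma diameter_set0 : diameter dist set0 = 0.
Proof.
rewrite /diameter -[RHS](ereal_sup1 0); congr ereal_sup.
by apply/seteqP; split => x; [case=> // -[? [? []]]|left].
Qed.

Lemma diameter_through v (A : set (boundary T)) : A `<=` through v ->
  diameter dist A <= (expR (- (depth v)%:R))%:E.
Proof.
move=> Av; apply: ge_ereal_sup => _ [->|[s [t [/Av sv /Av tv ->]]]].
  by rewrite lee_fin expR_ge0.
by rewrite lee_fin; apply: dist_le; rewrite sv tv.
Qed.

Lemma dist_le_diameter (A : set (boundary T)) s t : A s -> A t -> (dist s t)%:E <= diameter dist A.
Proof. by move=> As At; apply: ereal_sup_ubound; right; exists s, t. Qed.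

Lemma poweR_expR (a x : R) : ((expR x)%:E `^ a) = (expR (x * a))%:E.
Proof. by rewrite poweR_EFin expRM. Qed.

Lemma poweR_diameter_le (a : R) v (A : set (boundary T)) : (0 < a)%R -> A `<=` through v ->
  diameter dist A `^ a <= (expR (- a * (depth v)%:R))%:E.
Proof.
move=> a0 Av; have -> : (- a * (depth v)%:R = - (depth v)%:R * a)%R by ring.
rewrite -poweR_expR; apply: gt0_ler_poweR; rewrite ?(ltW a0) ?in_itv /= ?leey ?andbT //.
- exact: diameter_ge0.
- exact: diameter_through.
Qed.

Lemma hausdorff_premeasure_ge0 (a delta : R) E : 0 <= hausdorff_premeasure dist a delta E.
Proof.
apply: le_ereal_inf_tmp => _ [U _ <-]; apply: nneseries_ge0 => i _ _.
exact: poweR_ge0.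
Qed.

Lemma nneseries_single (j : nat) (b : \bar R) : 0 <= b ->
  \sum_(0 <= i <oo) (if i == j then b else 0) <= b.
Proof.
move=> b0; apply: lime_le; first by apply: is_cvg_nneseries => i _ _; case: ifP.
by apply: nearW => n; rewrite -big_mkcond big_nat1_eq; case: ifP.
Qed.

(* Every point of [E] meets infinitely many of the lists [G n], whose total cost converges. *)
Lemma hausdorff_zero (a : R) (E : set (boundary T)) (G : nat -> seq T) : (0 < a)%R ->
  (forall s, E s -> forall N, exists2 n, (N <= n)%N & exists2 v, v \in G n & through v s) ->
  \sum_(0 <= n <oo) (\sum_(v <- G n) expR (- a * (depth v)%:R))%R%:E < +oo ->
  hausdorff_measure dist a E = 0.
Proof.
move=> a0 EG sumG.
pose cost n := (\sum_(v <- G n) expR (- a * (depth v)%:R))%R.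
have cost0 n : (0 <= cost n)%R by apply: sumr_ge0 => v _; exact: expR_ge0.
have tail : \sum_(N <= n <oo) (cost n)%:E @[N --> \oo] --> 0.
  by apply: nneseries_tail_cvg => // n _; rewrite lee_fin.
have pre (delta e : R) : (0 < delta)%R -> (0 < e)%R -> hausdorff_premeasure dist a delta E <= e%:E.
  move=> d0 e0.
  (* The first bound makes the total cost at most [e]; the second forces each diameter below
     [delta], as one term is at most the whole sum. *)
  have m0 : (0 < Num.min e (expR (a * ln delta)))%R by rewrite lt_min e0 expR_gt0.
  have [N NP] : exists N, \sum_(N <= n <oo) (cost n)%:E < (Num.min e (expR (a * ln delta)))%:E.
    have /tail[N _ NP] : nbhs (0 : \bar R) [set y | y < (Num.min e (expR (a * ln delta)))%:E].
      by apply: open_nbhs_nbhs; split; [exact: open_ereal_lt_ereal|rewrite /= lte_fin].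
    by exists N; exact: (NP N (leqnn N)).
  pose v0 : T := origin.
  pose ok (p : nat * nat) := (N <= p.1)%N && (p.2 < size (G p.1))%N.
  pose vert (p : nat * nat) := nth v0 (G p.1) p.2.
  pose U i : set (boundary T) := if pickle_inv i is Some p then (if ok p then through (vert p) else set0) else set0.
  pose b n k : \bar R := if ok (n, k) then (expR (- a * (depth (vert (n, k)))%:R))%:E else 0.
  have b0 n k : 0 <= b n k by rewrite /b; case: ifP => // _; rewrite lee_fin expR_ge0.
  pose c i : \bar R := \sum_(0 <= n <oo) \sum_(0 <= k <oo) (if i == choice.pickle (n, k) then b n k else 0).
  have row_le n : \sum_(0 <= k <oo) b n k <= (cost n)%:E.
    rewrite (nneseries_split_cond 0 (size (G n))) //.
    rewrite add0n eseries0 ?adde0; last first.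
      by move=> k sk _; rewrite /b /ok /= ltnNge sk andbF.
    rewrite /cost (big_nth v0) -sumEFin; apply: lee_sum => k _.
    by rewrite /b; case: ifP => // _; rewrite lee_fin expR_ge0.
  have row0 n : (n < N)%N -> \sum_(0 <= k <oo) b n k = 0.
    by move=> nN; apply: eseries0 => k _ _; rewrite /b /ok /= leqNgt nN.
  have total : \sum_(0 <= n <oo) \sum_(0 <= k <oo) b n k <= \sum_(N <= n <oo) (cost n)%:E.
    rewrite (nneseries_split_cond 0 N) //; last by move=> n _; apply: nneseries_ge0.
    rewrite add0n big1_seq ?add0e; last first.
      by move=> n; rewrite mem_index_iota => /andP[_ nN]; exact: row0.
    by apply: lee_nneseries => [n _ _|n _]; [exact: nneseries_ge0|exact: row_le].
  have csum : \sum_(0 <= i <oo) c i <= \sum_(N <= n <oo) (cost n)%:E.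
    apply: le_trans total; rewrite /c [leLHS]nneseries_interchange; last first.
      by move=> i n; apply: nneseries_ge0 => k _ _; case: ifP.
    apply: lee_nneseries => [n _ _|n _]; first by apply: nneseries_ge0 => i _ _ /=; apply: nneseries_ge0 => k _ _ /=; case: ifP.
    rewrite [leLHS]nneseries_interchange; last by move=> i k; case: ifP.
    apply: lee_nneseries => [k _ _|k _]; first by apply: nneseries_ge0 => ? _ _ /=; case: ifP.
    exact: nneseries_single.
  have bc n k : b n k <= c (choice.pickle (n, k)).
    apply: le_trans (_ : \sum_(0 <= k' <oo) (if choice.pickle (n, k) == choice.pickle (n, k') then b n k' else 0) <= _).
      have := @nneseries_lim_ge R (fun k' => if choice.pickle (n, k) == choice.pickle (n, k') then b n k' else 0) xpredT 0 k.+1.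
      move=> /(_ _) h; apply: le_trans (h _); last by move=> i _ _; case: ifP.
      rewrite big_nat_recr //= eqxx leeDr //; apply: sume_ge0 => i _; case: ifP => // _.
    have := @nneseries_lim_ge R (fun n' => \sum_(0 <= k' <oo) (if choice.pickle (n, k) == choice.pickle (n', k') then b n' k' else 0)) xpredT 0 n.+1.
    move=> h; apply: le_trans (h _); last by move=> i _ _; apply: nneseries_ge0 => ? _ _ /=; case: ifP.
    rewrite big_nat_recr //= leeDr //; apply: sume_ge0 => i _.
    by apply: nneseries_ge0 => ? _ _ /=; case: ifP.
  have c0 j : 0 <= c j by apply: nneseries_ge0 => i _ _ /=; apply: nneseries_ge0 => k _ _ /=; case: ifP.
  have Uc i : diameter dist (U i) `^ a <= c i.
    rewrite /U; case pe : (pickle_inv i) => [[n k]|]; last by rewrite diameter_set0 poweR0r ?gt_eqF.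
    have ei : choice.pickle (n, k) = i by have := @pickle_invK (nat * nat)%type i; rewrite pe.
    case: ifPn => okp; last by rewrite diameter_set0 poweR0r ?gt_eqF.
    apply: le_trans (poweR_diameter_le a0 (@subset_refl _ _)) _.
    by rewrite -ei; apply: le_trans (bc n k); rewrite /b okp.
  apply: (@le_trans _ _ (\sum_(0 <= i <oo) diameter dist (U i) `^ a)); last first.
    apply: (@le_trans _ _ (\sum_(0 <= i <oo) c i)).
      by apply: lee_nneseries => [i _ _|i _]; [exact: poweR_ge0|exact: Uc].
    by apply: le_trans csum (le_trans (ltW NP) _); rewrite lee_fin ge_min lexx.
  apply: ereal_inf_lbound; exists U => //; split.
    move=> s /EG /(_ N)[n Nn [v vG vs]].
    exists (choice.pickle (n, index v (G n))) => //.
    by rewrite /U pickleK_inv /ok /= Nn index_mem vG /= /vert /= nth_index.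
  move=> i; have : diameter dist (U i) `^ a <= (expR (a * ln delta))%:E.
    apply: le_trans (Uc i) _; apply: (@le_trans _ _ (\sum_(0 <= i <oo) c i)).
      have := @nneseries_lim_ge R c xpredT 0 i.+1 => h; apply: le_trans (h _) => //.
      by rewrite big_nat_recr //= leeDr // sume_ge0.
    apply: le_trans csum (le_trans (ltW NP) _).
    by rewrite lee_fin ge_min lexx orbT.
  have -> : (expR (a * ln delta))%:E = delta%:E `^ a.
    by rewrite -[in RHS](lnK (_ : delta \is Num.pos)) ?posrE // poweR_expR mulrC.
  have root (x : \bar R) : 0 <= x -> (x `^ a) `^ a^-1 = x.
    by move=> x0; rewrite -poweRrM mulfV ?gt_eqF // poweRe1.
  move=> h; rewrite -(root _ (diameter_ge0 (U i))) -(root delta%:E); last by rewrite lee_fin ltW.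
  apply: gt0_ler_poweR => //; first by rewrite invr_ge0 ltW.
    by rewrite in_itv /= leey andbT poweR_ge0.
  by rewrite in_itv /= leey andbT lee_fin powR_ge0.
apply/eqP; rewrite eq_le; apply/andP; split.
  apply: ge_ereal_sup => _ [delta d0 <-]; apply/lee_addgt0Pr => e e0.
  by rewrite add0e; exact: pre.
apply: le_trans (hausdorff_premeasure_ge0 a 1 E) _.
by apply: ereal_sup_ubound; exists 1%R => //=; exact: ltr01.
Qed.

End BoundaryMetric.

Section HausdorffCover.
Variables (R : realType) (T : rooted_tree).
Implicit Types (s t : boundary T) (v : T).
Local Notation dist := (@boundary_dist R T).
Local Open Scope ereal_scope.

Lemma deep_vertex (b e : R) s : (0 < b)%R -> (0 < e)%R ->
  exists n, (expR (- b * n%:R) <= e)%R.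
Proof.
move=> b0 e0; have [|K KP] := geometric_small (expR_ge0 (- b)) _ e0.
  by rewrite expR_lt1 oppr_lt0.
by exists K; rewrite expRM_natr; exact: KP.
Qed.

(** In this ultrametric a set of diameter [D > 0] lies below a vertex of depth at least [- ln D].
    The slack [e] is for empty sets and for [D = 0], where a sufficiently deep vertex is used. *)
Lemma vertex_cover (b e : R) (s0 : boundary T) (U : set (boundary T)) : (0 < b)%R -> (0 < e)%R ->
  diameter dist U <= (expR (-1))%:E ->
  exists2 v, U `<=` through v & (expR (- b * (depth v)%:R))%:E <= diameter dist U `^ b + e%:E.
Proof.
move=> b0 e0 dU; have dU0 := diameter_ge0 R U.
have [U0|[s Us]] : U = set0 \/ exists s, U s.
  by have [->|/set0P] := eqVneq U set0; [left|right].
  have [n nP] := deep_vertex s0 b0 e0; exists (s0 n); first by rewrite U0.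
  by rewrite depth_ray; apply: le_trans (_ : e%:E <= _); rewrite ?lee_fin // leeDr // poweR_ge0.
have [D DE] : exists D, diameter dist U = D%:E.
  exists (fine (diameter dist U)); rewrite fineK // ge0_fin_numE //.
  by apply: le_lt_trans dU _; exact: ltry.
have tD t : U t -> (dist s t <= D)%R by move=> Ut; rewrite -lee_fin -DE; exact: dist_le_diameter.
rewrite DE lee_fin in dU dU0.
have [D0|D0] := eqVneq D 0%R.
  have [n nP] := deep_vertex s b0 e0; exists (s n).
    move=> t Ut; apply/through_eq; case: n {nP} => [|n]; first by rewrite !ray_root.
    apply: contrapT => /(@dist_ge R) h; have := le_trans h (tD t Ut).
    by rewrite D0 leNgt expR_gt0.
  by rewrite depth_ray; apply: le_trans (_ : e%:E <= _); rewrite ?lee_fin // leeDr // poweR_ge0.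
have Dpos : (0 < D)%R by rewrite lt_neqAle eq_sym D0.
have lnD : (1 <= - ln D)%R by rewrite lerNr -[leRHS](expRK (-1)%R) ler_ln ?posrE ?expR_gt0.
pose n := (Num.truncn (- ln D)).
have n1 : (n%:R <= - ln D)%R.
  by have := truncn_itv (le_trans ler01 lnD) => /andP[].
have n2 : (- ln D < n.+1%:R)%R by exact: truncnS_gt.
(* If [n < - ln D] the rays of [U] agree up to depth [n + 1]; if [n = - ln D], agreement up to depth
   [n] is enough, and [n > 0] by the bound on the diameter. *)
have [nlt|ngt] := ltP n%:R (- ln D)%R.
  exists (s n.+1).
    move=> t Ut; apply/through_eq; apply: contrapT => /(@dist_ge R) h.
    have := le_trans h (tD t Ut); rewrite leNgt => /negP; apply.
    by rewrite -[ltLHS](lnK (_ : D \is Num.pos)) ?posrE // ltr_expR ltrNr.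
  rewrite depth_ray DE; apply: le_trans (_ : (D `^ b)%:E <= _); last by rewrite leeDl // lee_fin ltW.
  rewrite lee_fin -[in leRHS](lnK (_ : D \is Num.pos)) ?posrE // -expRM ler_expR.
  rewrite mulNr -mulrN mulrC ler_wpM2r ?(ltW b0) // lerNl; exact: ltW.
have nE : (- ln D = n%:R)%R by apply/eqP; rewrite eq_le n1 ngt.
have np : (0 < n)%N by rewrite -(ltr_nat R) -nE (lt_le_trans _ lnD).
exists (s n).
  move=> t Ut; apply/through_eq; rewrite -(prednK np); apply: contrapT => /(@dist_ge R) h.
  have := le_trans h (tD t Ut); rewrite leNgt => /negP; apply.
  rewrite -[ltLHS](lnK (_ : D \is Num.pos)) ?posrE // ltr_expR ltrNr nE ltr_nat.
  by rewrite prednK.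
rewrite depth_ray DE; apply: le_trans (_ : (D `^ b)%:E <= _); last by rewrite leeDl // lee_fin ltW.
rewrite lee_fin -[in leRHS](lnK (_ : D \is Num.pos)) ?posrE // -expRM ler_expR.
by rewrite mulNr -mulrN mulrC -nE opprK.
Qed.

Lemma hausdorff_zero_cover (b : R) (E : set (boundary T)) (s0 : boundary T) : (0 < b)%R ->
  hausdorff_measure dist b E = 0 -> forall e : R, (0 < e)%R -> exists v : nat -> T,
  (forall s, E s -> exists i, through (v i) s) /\
  \sum_(0 <= i <oo) (expR (- b * (depth (v i))%:R))%:E <= e%:E.
Proof.
move=> b0 H0 e e0.
have : hausdorff_premeasure dist b (expR (-1)) E <= 0.
  (* The scale [expR (-1)] is the one at which [vertex_cover] applies. *)
  rewrite -H0; apply: ereal_sup_ubound; exists (expR (-1)) => //=; exact: expR_gt0.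
have half : 0 < (e / 2)%:E by rewrite lte_fin divr_gt0.
move=> /le_lt_trans /(_ half) /ereal_inf_lt[_ [U [EU dU] <-] Ue].
have /choice[v vP] : forall i, exists v, U i `<=` through v /\
   (expR (- b * (depth v)%:R))%:E <= diameter dist (U i) `^ b + (e / 2 / (2 ^ i.+1)%:R)%:E.
  move=> i; have e20 : (0 < e / 2 / (2 ^ i.+1)%:R)%R by rewrite !divr_gt0 // ltr0n expn_gt0.
  by have [v v1 v2] := vertex_cover s0 b0 e20 (dU i); exists v.
exists v; split.
  by move=> s /EU[i _ Us]; exists i; have [h _] := vP i; exact: h.
apply: (@le_trans _ _ (\sum_(0 <= i <oo) (diameter dist (U i) `^ b + (e / 2 / (2 ^ i.+1)%:R)%:E))).
  by apply: lee_nneseries => [i _ _|i _]; [rewrite lee_fin expR_ge0|case: (vP i)].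
apply: le_trans (epsilon_trick _ _ _) _.
- by move=> i; exact: poweR_ge0.
- by rewrite divr_ge0 // ltW.
by rewrite [leRHS](_ : _ = (e / 2)%:E + (e / 2)%:E); [rewrite leeD2r // ltW|rewrite -EFinD -splitr].
Qed.

End HausdorffCover.

(** * First moment bounds *)

Section Limsup.
Variable R : realType.
Implicit Types (u : (\bar R)^nat) (y : \bar R).

Lemma limn_esup_ge u y : (forall N, exists2 n, (N <= n)%N & (y <= u n)%E) -> (y <= limn_esup u)%E.
Proof.
move=> h; rewrite limn_esup_lim; apply: lime_ge; first exact: is_cvg_esups.
apply: nearW => N; have [n Nn yn] := h N; apply: le_trans yn _.
by apply: ereal_sup_ubound; exists n.
Qed.

Lemma limn_esup_lt u y : (limn_esup u < y)%E -> exists N, forall n, (N <= n)%N -> (u n < y)%E.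
Proof.
rewrite limn_esup_lim => h; have cv : esups u @ \oo --> limn (esups u) by exact: is_cvg_esups.
have /cv[N _ NP] : nbhs (limn (esups u)) [set z | (z < y)%E].
  by apply: open_nbhs_nbhs; split => //; exact: open_ereal_lt_ereal.
exists N => n Nn; apply: le_lt_trans (NP N (leqnn N)).
by apply: ereal_sup_ubound; exists n.
Qed.

End Limsup.

Section PartialSums.
Variables (R : realType) (T : rooted_tree).
Implicit Types (x : T -> R) (v : T) (s : boundary T).

Lemma partial_sumE x v : partial_sum x v = \sum_(u <- root_path v) x u.
Proof.
rewrite /partial_sum; have -> : [set u | tree_lt origin u /\ tree_le u v] = [set` root_path v].
  apply/seteqP; split => u /=; rewrite mem_root_path.
    move=> [[_ /eqP u0] /tree_leP uv]; rewrite eq_sym u0 /=; exact/eqP.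
  move=> /andP[u0 /eqP uv]; split; last exact/tree_leP.
  split; first by apply/tree_leP; rewrite depth_origin anc0.
  by apply/eqP; rewrite eq_sym.
by rewrite -fsbig_seq ?uniq_root_path.
Qed.

Lemma sum_sub_const x v y : \sum_(u <- root_path v) (x u - y) = partial_sum x v - y * (depth v)%:R.
Proof. by rewrite sumrB partial_sumE big_const_seq count_predT iter_addr_0 mulr_natr. Qed.

Lemma ray_average_le x s n y : (0 < n)%N ->
  (ray_average x s n <= y%:E)%E = (\sum_(u <- root_path (s n)) (x u - y) <= 0).
Proof.
move=> n0; rewrite /ray_average lee_fin depth_ray ler_pdivrMr ?ltr0n //.
by rewrite sum_sub_const depth_ray subr_le0.
Qed.

Lemma root_path_D v : [set` root_path v] `<=` [set u : T | u <> origin].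
Proof. by move=> u /=; rewrite mem_root_path => /andP[/eqP]. Qed.

End PartialSums.

Section FirstMoment.
Variables (R : realType) (T : rooted_tree).
Hypothesis lf : locally_finite T.
Context d (Omega : measurableType d) (P : probability Omega R).
Context d' (Omega' : measurableType d') (P' : probability Omega' R).
Variables (X : T -> {RV P >-> R}) (X0 : {RV P' >-> R}).
Hypothesis X_indep : mutually_independent [set v : T | v <> origin] X.
Hypothesis X_law : forall v : T, v <> origin -> same_law (X v) X0.
Implicit Types (v : T) (s : boundary T) (G : nat -> seq T).

Definition slow (y : R) v : set Omega := [set w | \sum_(u <- root_path v) (X u w - y) <= 0].

Lemma slow_measurable y v : measurable (slow y v).
Proof. exact: sum_le_measurable. Qed.

Lemma slow_prob (y u : R) v : (rate X0 y < u%:E)%E -> (P (slow y v) <= (u ^+ depth v)%:E)%E.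
Proof.
by move=> yu; apply: (rate_chernoff X_indep X_law yu); [exact: uniq_root_path|exact: root_path_D].
Qed.

(** The expected cost of the slow vertices of [G n] is at most [2^-n], so the total has finite mean.
    With [a = 0] the cost counts slow vertices and this is Borel-Cantelli; with [a > 0] it yields
    cheap covers. *)
Lemma summable_cost (y a : R) (p : T -> R) G : (forall v, (P (slow y v) <= (p v)%:E)%E) ->
  (forall n, \sum_(v <- G n) expR (- a * (depth v)%:R) * p v <= 2^-1 ^+ n) ->
  {ae P, forall w, (\sum_(0 <= n <oo)
    (\sum_(v <- [seq v <- G n | w \in slow y v]) expR (- a * (depth v)%:R))%:E < +oo)%E}.
Proof.
move=> Pp Gp.
pose f n w : \bar R := (\sum_(v <- G n) expR (- a * (depth v)%:R) * \1_(slow y v) w)%:E.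
have mfn n : measurable_fun setT (f n).
  apply/measurable_EFinP; apply: measurable_sum => v.
  by apply: measurable_funM => //; exact: measurable_indic (slow_measurable _ _).
have f0 n w : (0 <= f n w)%E.
  by rewrite lee_fin; apply: sumr_ge0 => v _; rewrite mulr_ge0 ?expR_ge0 // indicE; case: (_ \in _).
have If n : (\int[P]_w f n w <= (2^-1 ^+ n)%:E)%E.
  apply: le_trans (_ : (\sum_(v <- G n) expR (- a * (depth v)%:R) * p v)%:E <= _)%E; last first.
    by rewrite lee_fin.
  rewrite /f; under eq_integral do rewrite -sumEFin.
  rewrite ge0_integral_sum //; last first.
    move=> v; apply/measurable_EFinP; apply: measurable_funM => //.
    exact: measurable_indic (slow_measurable _ _).
  rewrite -sumEFin; apply: lee_sum => v _; rewrite EFinM.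
  under eq_integral do rewrite EFinM.
  rewrite ge0_integralZl //; do ?[exact/measurable_EFinP/measurable_indic/slow_measurable |
    by move=> w _; rewrite lee_fin indicE; case: (_ \in _) | by rewrite lee_fin expR_ge0].
  rewrite integral_indic ?setIT //; last exact: slow_measurable.
  by apply: lee_wpmul2l; [rewrite lee_fin expR_ge0|exact: Pp].
have S : (\int[P]_w \sum_(0 <= n <oo) f n w < +oo)%E.
  rewrite integral_nneseries //.
  apply: le_lt_trans (nneseries_geometric (_ : 0 <= 2^-1 :> R) _).
  - by apply: lee_nneseries => [n _ _|n _]; [apply: integral_ge0|exact: If].
  - by rewrite invr_ge0.
  - by rewrite invf_lt1 // ltr1n.
have mS : measurable_fun setT (fun w => (\sum_(0 <= n <oo) f n w)%E).
  exact: ge0_emeasurable_sum.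
have S0 w : (0 <= \sum_(0 <= n <oo) f n w)%E by apply: nneseries_ge0.
have iS : P.-integrable setT (fun w => (\sum_(0 <= n <oo) f n w)%E).
  apply/integrableP; split => //.
  by under eq_integral do rewrite gee0_abs //.
apply: filterS (integrable_ae measurableT iS) => w /(_ I) h.
rewrite -ge0_fin_numE; last by apply: nneseries_ge0 => n _ _; rewrite lee_fin sumr_ge0 // => v _; exact: expR_ge0.
rewrite (_ : (\sum_(0 <= n <oo) _)%E = (\sum_(0 <= n <oo) f n w)%E) //.
apply: eq_eseriesr => n _; congr (_%:E); rewrite big_filter big_mkcond /=.
by apply: eq_bigr => v _; rewrite indicE; case: (_ \in _); rewrite ?mulr1 ?mulr0.
Qed.

Lemma limsup_ge_of_summable (y : R) (p : T -> R) G : (forall v, (P (slow y v) <= (p v)%:E)%E) ->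
  (forall n, \sum_(v <- G n) p v <= 2^-1 ^+ n) -> (forall n, hits (G n)) ->
  (forall n v, v \in G n -> (n <= depth v)%N) ->
  {ae P, forall w, forall s, (y%:E <= limn_esup (ray_average (fun v => X v w) s))%E}.
Proof.
move=> Pp Gp hG dG.
have Gp0 n : \sum_(v <- G n) expR (- 0 * (depth v)%:R) * p v <= 2^-1 ^+ n.
  by under eq_bigr do rewrite oppr0 mul0r expR0 mul1r.
apply: filterS (summable_cost Pp Gp0) => w fin s.
have tail := nneseries_tail_cvg fin _.
have /tail[|N _ NP] : nbhs (0%E : \bar R) [set z | (z < 1)%E].
- by apply: open_nbhs_nbhs; split; [exact: open_ereal_lt_ereal|rewrite /= lte_fin].
- by move=> n _; rewrite lee_fin sumr_ge0 // => v _; exact: expR_ge0.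
apply: limn_esup_ge => M; pose n := maxn (maxn N M) 1.
have [k kG] := hG n s; have kn := dG _ _ kG; rewrite depth_ray in kn.
have nM : (M <= k)%N by apply: leq_trans kn; rewrite !leq_max leqnn orbT.
have k0 : (0 < k)%N by apply: leq_trans kn; rewrite !leq_max orbT.
exists k => //; rewrite leNgt; apply/negP => lt.
have slowk : w \in slow y (s k).
  by rewrite inE /slow /= -(@ray_average_le R T (fun v => X v w)) // ltW.
have nN : (N <= n)%N by rewrite !leq_max leqnn.
have := NP N (leqnn N); rewrite /= ltNge => /negP; apply.
have := @nneseries_lim_ge R (fun n => (\sum_(v <- [seq v <- G n | w \in slow y v]) expR (- 0 * (depth v)%:R))%:E) xpredT N n.+1.
move=> h; apply: le_trans (h _); last first.
  by move=> i _ _; rewrite lee_fin sumr_ge0 // => v _; exact: expR_ge0.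
rewrite big_nat_recr //= -[leLHS]add0e; apply: leeD.
  by apply: sume_ge0 => i _; rewrite lee_fin sumr_ge0 // => v _; exact: expR_ge0.
rewrite lee_fin (big_rem (s k)) /=; last by rewrite mem_filter slowk.
rewrite oppr0 mul0r expR0 lerDl sumr_ge0 // => v _; exact: expR_ge0.
Qed.

Lemma hausdorff_zero_of_summable (y0 y a : R) (p : T -> R) G : 0 < a -> y0 < y ->
  (forall v, (P (slow y v) <= (p v)%:E)%E) ->
  (forall n, \sum_(v <- G n) expR (- a * (depth v)%:R) * p v <= 2^-1 ^+ n) ->
  (forall n, hits (G n)) -> (forall n v, v \in G n -> (n <= depth v)%N) ->
  {ae P, forall w, hausdorff_measure (@boundary_dist R T) a
    (rays_limsup_le (fun v => X v w) y0%:E) = 0%E}.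
Proof.
move=> a0 yy Pp Gp hG dG; apply: filterS (summable_cost Pp Gp) => w fin.
apply: (hausdorff_zero a0 _ fin) => s sE N.
have [M MP] : exists M, forall n, (M <= n)%N -> (ray_average (fun v => X v w) s n < y%:E)%E.
  by apply: limn_esup_lt; apply: le_lt_trans sE _; rewrite lte_fin.
pose n := maxn (maxn N M) 1; exists n; first by rewrite !leq_max leqnn.
have [k kG] := hG n s; have kn := dG _ _ kG; rewrite depth_ray in kn.
have k0 : (0 < k)%N by apply: leq_trans kn; rewrite !leq_max orbT.
exists (s k); last exact/through_eq.
rewrite mem_filter kG andbT inE /slow /= -(@ray_average_le R T (fun v => X v w)) //.
by apply/ltW/MP; apply: leq_trans kn; rewrite !leq_max leqnn orbT.
Qed.

Lemma light_hitting_lists (l : R) : 1 < l -> (branching_number R T < l%:E)%E ->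
  exists G, [/\ forall n, hits (G n), forall n, \sum_(v <- G n) l ^- depth v <= 2^-1 ^+ n &
    forall n v, v \in G n -> (n <= depth v)%N].
Proof.
move=> l1 bl; have l0 : 0 < l by exact: lt_trans l1.
have /choice[G GP] : forall n, exists A, [/\ hits A, \sum_(v <- A) l ^- depth v <= 2^-1 ^+ n &
    forall v, v \in A -> (n <= depth v)%N].
  (* Asking for a total below [l^-n] forces the depths: a single vertex of depth less than [n] would
     cost more. *)
  move=> n; have m0 : 0 < Num.min (2^-1 ^+ n) (l ^- n).
    by rewrite lt_min invr_gt0 !exprn_gt0 // invr_gt0.
  have [A [_ hA _ sA]] := branching_cut l0 bl m0.
  exists A; split => //; first by apply: le_trans (ltW sA) _; rewrite ge_min lexx.
  move=> v vA; rewrite -(ler_eXn2l l1).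
  rewrite -lef_pV2 ?posrE ?exprn_gt0 //.
  apply: le_trans (_ : \sum_(v <- A) l ^- depth v <= _); last first.
    by apply: le_trans (ltW sA) _; rewrite ge_min lexx orbT.
  rewrite (big_rem v vA) /= lerDl sumr_ge0 // => u _; rewrite invr_ge0 exprn_ge0 //; exact: ltW.
by exists G; split => n; case: (GP n).
Qed.

(** The second alternative takes care of infinite [br]: with rate 0, almost surely no vertex but the
    root is slow, and the levels serve as hitting lists. *)
Lemma limsup_ge_rate (y : R) (s0 : boundary T) :
  (exists2 b : R, branching_number R T = b%:E & (rate X0 y < b^-1%:E)%E) \/ rate X0 y = 0%E ->
  {ae P, forall w, forall s, (y%:E <= limn_esup (ray_average (fun v => X v w) s))%E}.
Proof.
move=> [[b bE yb]|y0]; last first.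
  have P0 v : (P (slow y v) <= (if v == origin then 1 else 0 : R)%:E)%E.
    case: eqVneq => [_|v0]; first by apply: probability_le1; exact: slow_measurable.
    apply/lee_addgt0Pr => e e0; rewrite add0e.
    have dv : (0 < depth v)%N.
      by rewrite lt0n; apply: contra v0 => /eqP /depth0 ->.
    pose u := Num.min 1 e.
    have u0 : 0 < u by rewrite lt_min ltr01.
    apply: le_trans (@slow_prob y u v _) _; first by rewrite y0 lte_fin.
    rewrite lee_fin -(prednK dv) exprS; apply: le_trans (_ : u * 1 <= _).
      by rewrite ler_pM2l // exprn_ile1 ?(ltW u0) // ge_min lexx.
    by rewrite mulr1 ge_min lexx orbT.
  apply: (limsup_ge_of_summable (G := fun n => lvl T n.+1) P0).
  - move=> n; rewrite big1_seq ?exprn_ge0 ?invr_ge0 // => v.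
    rewrite (mem_lvl lf) => /eqP dv; case: eqP dv => // ->; by rewrite depth_origin.
  - by move=> n s; exists n.+1; rewrite (mem_lvl lf) depth_ray.
  - by move=> n v; rewrite (mem_lvl lf) => /eqP ->.
have b1 : 1 <= b by rewrite -lee_fin -bE; exact: branching_ge1.
have b0 : 0 < b by exact: lt_le_trans b1.
have [r rE] : exists r, rate X0 y = r%:E by exists (fine (rate X0 y)); exact: rate_fin.
have r0 : 0 <= r by rewrite -lee_fin -rE rate_ge0.
rewrite rE lte_fin in yb.
pose u := (r + b^-1) / 2; have ru : r < u by rewrite /u; lra.
have ub : u < b^-1 by rewrite /u; lra.
have u0 : 0 < u by exact: le_lt_trans ru.
have bu : b < u^-1 by rewrite -[ltLHS]invrK ltf_pV2 ?posrE // invr_gt0.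
have bB : (branching_number R T < u^-1%:E)%E by rewrite bE lte_fin.
have [G [hG sG dG]] := light_hitting_lists (le_lt_trans b1 bu) bB.
apply: (limsup_ge_of_summable (p := fun v => u ^+ depth v) (G := G)) => //.
  by move=> v; apply: slow_prob; rewrite rE lte_fin.
by move=> n; have := sG n; under eq_bigr do rewrite -exprVn invrK.
Qed.

Lemma hausdorff_upper (y0 y a b : R) (s0 : boundary T) : 0 < a -> y0 < y ->
  branching_number R T = b%:E -> (rate X0 y * b%:E < (expR a)%:E)%E ->
  {ae P, forall w, hausdorff_measure (@boundary_dist R T) a
    (rays_limsup_le (fun v => X v w) y0%:E) = 0%E}.
Proof.
move=> a0 yy bE yb.
have b1 : 1 <= b by rewrite -lee_fin -bE; exact: branching_ge1.
have b0 : 0 < b by exact: lt_le_trans b1.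
have [r rE] : exists r, rate X0 y = r%:E by exists (fine (rate X0 y)); exact: rate_fin.
have r0 : 0 <= r by rewrite -lee_fin -rE rate_ge0.
rewrite rE -EFinM lte_fin -ltr_pdivlMr // in yb.
(* With [u] strictly between, [l = expR a / u] exceeds [br], and [expR (- a n) u^n = l^-n] turns the
   expected cost into the cost at [l]. *)
pose u := (r + expR a / b) / 2; have ru : r < u by rewrite /u; lra.
have ub : u < expR a / b by rewrite /u; lra.
have u0 : 0 < u by exact: le_lt_trans ru.
have bl : b < expR a / u by rewrite ltr_pdivlMr // mulrC -ltr_pdivlMr.
have bB : (branching_number R T < (expR a / u)%:E)%E by rewrite bE lte_fin.
have [G [hG sG dG]] := light_hitting_lists (le_lt_trans b1 bl) bB.
apply: (hausdorff_zero_of_summable a0 yy (p := fun v => u ^+ depth v) (G := G)) => //.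
  by move=> v; apply: slow_prob; rewrite rE lte_fin.
move=> n; apply: le_trans (sG n); apply: ler_sum => v _.
by rewrite expRM_natr expRN -[leRHS]exprVn invf_div -[leLHS]exprMn [_^-1 * _]mulrC.
Qed.

End FirstMoment.

(** * Flows and covers *)

Section Flow.
Variables (R : realType) (T : rooted_tree).
Hypothesis lf : locally_finite T.
Variables (c : R) (k : nat -> nat).
Hypothesis c0 : 0 < c.
Implicit Types (O : nat -> T -> T -> bool) (v w : T) (s : boundary T).

(* n counts the blocks still to come and j is the index of the first of them; capping at 1
   keeps second moments finite and makes the value at a vertex comparable with its cost. *)
Fixpoint flow O n j v : R :=
  if n is n'.+1 then
    Num.min 1 (c ^- k j * \sum_(w <- desc (k j) v | O j v w) flow O n' j.+1 w)
  else 1.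

Lemma flow_ge0 O n j v : 0 <= flow O n j v.
Proof.
elim: n j v => [|n IH] j v /=; first exact: ler01.
by rewrite le_min ler01 mulr_ge0 ?sumr_ge0 // invr_ge0 exprn_ge0 // ltW.
Qed.

Lemma flow_le1 O n j v : flow O n j v <= 1.
Proof. by case: n => [|n] //=; rewrite ge_min lexx. Qed.

Lemma flowS_le O n j v : flow O n.+1 j v <= flow O n j v.
Proof.
elim: n j v => [|n IH] j v; first exact: flow_le1.
rewrite [leLHS]/= [leRHS]/= le_min !ge_min lexx /=; apply/orP; right.
by rewrite ler_wpM2l ?invr_ge0 ?exprn_ge0 ?(ltW c0) // ler_sum // => w _; exact: IH.
Qed.

Lemma flow_antitone O m n j v : (m <= n)%N -> flow O n j v <= flow O m j v.
Proof.
move=> /subnK <-; elim: (n - m)%N => [|i IH] //.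
by rewrite addSn; apply: le_trans IH; exact: flowS_le.
Qed.

Lemma ray_desc s v i : through v s -> s (depth v + i)%N \in desc i v.
Proof.
move=> sv; rewrite (mem_desc lf) depth_ray eqxx andbT anc_ray ?leq_addr //.
exact/eqP.
Qed.

Let full : nat -> T -> T -> bool := fun _ _ _ => true.

(** At each vertex either the cap is active and the cut is the vertex itself, or the sum is smaller
    and the cuts of the descendants are joined. The deterministic flow is thus the cost of an actual
    cut, so capping never brings it below the minimal cut. *)
Lemma flow_cut n j v : exists A : seq T,
  [/\ forall s, through v s -> exists m, s m \in A,
      forall x, x \in A -> (depth v <= depth x)%N &
      flow full n j v = \sum_(x <- A) c ^- (depth x - depth v)].
Proof.
have unit_cut u : exists A : seq T,
  [/\ forall s, through u s -> exists m, s m \in A,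
      forall x, x \in A -> (depth u <= depth x)%N &
      1 = \sum_(x <- A) c ^- (depth x - depth u) :> R].
  exists [:: u]; split.
  - by move=> s su; exists (depth u); rewrite inE; exact/eqP.
  - by move=> x; rewrite inE => /eqP ->.
  - by rewrite big_seq1 subnn expr0 invr1.
elim: n j v => [|n IH] j v; first exact: unit_cut.
have [h|h] := leP 1 (c ^- k j * \sum_(w <- desc (k j) v) flow full n j.+1 w).
  have [A [A1 A2 A3]] := unit_cut v; exists A; split => //.
  by rewrite -A3 /= min_l.
have /choice[A AP] := IH j.+1.
exists (flatten [seq A w | w <- desc (k j) v]); split.
- move=> s sv; have wd := ray_desc (k j) sv; set w := s _ in wd.
  have [A1 _ _] := AP w; have [|m mA] := A1 s; first exact/through_eq.
  by exists m; apply/flattenP; exists (A w) => //; exact: map_f.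
- move=> x /flattenP[_ /mapP[w wd ->] xA].
  have [_ A2 _] := AP w; apply: leq_trans (A2 x xA).
  by move: wd; rewrite (mem_desc lf) => /andP[_ /eqP ->]; exact: leq_addr.
rewrite /= min_r; last exact: ltW.
rewrite big_flatten big_map mulr_sumr [LHS]big_seq_cond [RHS]big_seq_cond.
apply: eq_bigr => w; rewrite andbT (mem_desc lf) => /andP[_ /eqP dw].
have [_ A2 ->] := AP w; rewrite mulr_sumr [LHS]big_seq_cond [RHS]big_seq_cond.
apply: eq_bigr => x; rewrite andbT => /A2 dx.
rewrite -invfM -exprD; congr (_ ^- _); lia.
Qed.

(** The cuts below the vertices of level [N] together hit every ray; [N > 0] keeps the root out of
    them. *)
Lemma flow_level_sum (dl : R) N n : (0 < N)%N ->
  (forall A : seq T, origin \notin A -> hits A -> dl <= \sum_(v <- A) c ^- depth v) ->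
  dl * c ^+ N <= \sum_(v <- lvl T N) flow full n 0 v.
Proof.
move=> N0 cut; have /choice[A AP] := flow_cut n 0.
rewrite -ler_pdivlMr ?exprn_gt0 //.
apply: le_trans (cut (flatten [seq A w | w <- lvl T N]) _ _) _.
- apply/flattenP => -[_ /mapP[w wd ->] xA]; have [_ A2 _] := AP w.
  by have := A2 _ xA; rewrite depth_origin; move: wd; rewrite (mem_lvl lf) => /eqP ->; lia.
- move=> s; have sw : s N \in lvl T N by rewrite (mem_lvl lf) depth_ray.
  have [A1 _ _] := AP (s N); have [|m mA] := A1 s; first exact/through_eq.
  by exists m; apply/flattenP; exists (A (s N)) => //; exact: map_f.
rewrite big_flatten big_map mulr_suml [leLHS]big_seq_cond [leRHS]big_seq_cond.
apply: ler_sum => w; rewrite andbT (mem_lvl lf) => /eqP dw.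
have [_ A2 ->] := AP w; rewrite mulr_suml [leLHS]big_seq_cond [leRHS]big_seq_cond.
apply: ler_sum => x; rewrite andbT => /A2 dx.
rewrite -invfM -exprD; suff -> : (depth x - depth w + N = depth x)%N by [].
by rewrite dw in dx *; lia.
Qed.

End Flow.

Section BlockLevel.
Variables (T : rooted_tree) (k : nat -> nat) (s0 : T).
Hypothesis k0 : forall j, (0 < k j)%N.

Definition block_level j : nat := (depth s0 + \sum_(i < j) k i)%N.

Lemma block_levelS j : block_level j.+1 = (block_level j + k j)%N.
Proof. by rewrite /block_level big_ord_recr addnA. Qed.

Lemma block_level_lt j : (block_level j < block_level j.+1)%N.
Proof. by rewrite block_levelS -[X in (X < _)%N]addn0 ltn_add2l. Qed.

Lemma block_level_le i j : (i <= j)%N -> (block_level i <= block_level j)%N.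
Proof.
move=> /subnK <-; elim: (j - i)%N => [|n IH] //.
by rewrite addSn; apply: leq_trans IH (ltnW (block_level_lt _)).
Qed.

Lemma block_level_ge j : (j <= block_level j)%N.
Proof. by elim: j => // j IH; exact: leq_ltn_trans IH (block_level_lt j). Qed.

Lemma block_find m : (depth s0 <= m)%N -> exists j, (block_level j <= m < block_level j.+1)%N.
Proof.
move=> sm; elim: m sm => [|m IH] sm.
  exists 0%N; rewrite /block_level big_ord0 addn0 sm /=.
  by rewrite (leq_trans _ (block_level_ge 1)).
have [sm'|ms] := leqP (depth s0) m.
  have [j /andP[h1 h2]] := IH sm'.
  have [h|h] := ltnP m.+1 (block_level j.+1); first by exists j; rewrite h ltnW.
  by exists j.+1; rewrite h /= (leq_ltn_trans _ (block_level_lt j.+1)).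
exists 0%N; rewrite /block_level big_ord0 addn0 sm /= big_ord_recl big_ord0 addn0.
have -> : depth s0 = m.+1 by lia.
by rewrite -[X in (X < _)%N]addn0 ltn_add2l.
Qed.

End BlockLevel.

(** * Greedy descent avoiding a countable cover *)

Section Avoid.
Variables (R : realType) (T : rooted_tree).
Hypothesis lf : locally_finite T.
Variables (c : R) (k : nat -> nat) (O : nat -> T -> T -> bool) (s0 : T).
Hypothesis c1 : 1 < c.
Hypothesis k0 : forall j, (0 < k j)%N.
Implicit Types (v w : T) (s : boundary T) (p : nat -> T).

Let c0 : 0 < c. Proof. exact: lt_trans c1. Qed.

Local Notation L := (block_level k s0).

(** The cost of a cover normalized at [v], so that it can be compared with the flow at [v], which is
    capped at 1. *)
Definition hit_cost p i v : \bar R :=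
  if (depth v <= depth (p i))%N && (anc (depth v) (p i) == v) then (c ^- (depth (p i) - depth v))%:E else 0%E.

Definition total_cost p v : \bar R := (\sum_(0 <= i <oo) hit_cost p i v)%E.

Lemma hit_cost_ge0 p i v : (0 <= hit_cost p i v)%E.
Proof. by rewrite /hit_cost; case: ifP => // _; rewrite lee_fin invr_ge0 exprn_ge0 // ltW. Qed.

(** At most one vertex of the lower level is an ancestor of [p i], and going down [m] levels
    multiplies its cost by [c^m]. *)
Lemma hit_cost_split p i v m (Q : pred T) :
  (\sum_(w <- desc m v | Q w) hit_cost p i w <= (c ^+ m)%:E * hit_cost p i v)%E.
Proof.
have [[w wd /andP[wh wa]]|none] := pselect (exists2 w, w \in desc m v &
    (depth w <= depth (p i))%N && (anc (depth w) (p i) == w)); last first.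
  rewrite big1_seq => [|w /andP[_ wd]]; first by rewrite mule_ge0 ?hit_cost_ge0 // lee_fin exprn_ge0 // ltW.
  by rewrite /hit_cost; case: ifP => // h; case: none; exists w.
have wv := wd; rewrite (mem_desc lf) in wv; case/andP: wv => /eqP wv /eqP dw.
apply: (@le_trans _ _ (hit_cost p i w)).
  rewrite big_mkcond (bigD1_seq w) ?uniq_desc //= big1_seq ?adde0; last first.
    move=> u /andP[uw ud]; case: ifP => // _; rewrite /hit_cost; case: ifP => // /andP[_ /eqP ua].
    move: ud; rewrite (mem_desc lf) => /andP[_ /eqP du].
    by case/negP: uw; rewrite -ua du -dw (eqP wa).
  by case: ifP => // _; exact: hit_cost_ge0.
rewrite {2}/hit_cost.
have va : anc (depth v) (p i) = v.
  by rewrite -[RHS]wv -(eqP wa) anc_anc (minn_idPl _) // dw leq_addr.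
have dv : (depth v <= depth (p i))%N by apply: leq_trans wh; rewrite dw leq_addr.
rewrite va eqxx dv /= /hit_cost wh wa /= -EFinM lee_fin.
have -> : (depth (p i) - depth v = m + (depth (p i) - depth w))%N by lia.
by rewrite exprD invfM mulrA mulfV ?mul1r // gt_eqF // exprn_gt0.
Qed.

Lemma total_cost_split p v m (Q : pred T) :
  (\sum_(w <- desc m v | Q w) total_cost p w <= (c ^+ m)%:E * total_cost p v)%E.
Proof.
rewrite /total_cost -nneseriesZl; last by move=> i _; exact: hit_cost_ge0.
rewrite -nneseries_sum; last by move=> *; exact: hit_cost_ge0.
apply: lee_nneseries => [i _ _|i _]; last exact: hit_cost_split.
by apply: sume_ge0 => w _; exact: hit_cost_ge0.
Qed.

Lemma total_cost_ge0 p v : (0 <= total_cost p v)%E.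
Proof. by apply: nneseries_ge0 => i _ _; exact: hit_cost_ge0. Qed.

Lemma total_cost_hit p v i : p i = v -> (1 <= total_cost p v)%E.
Proof.
move=> pv; have := @nneseries_lim_ge R (hit_cost p ^~ v) xpredT 0 i.+1.
move=> h; apply: le_trans (h _); last by move=> *; exact: hit_cost_ge0.
rewrite big_nat_recr //= {2}/hit_cost pv leqnn anc_id ?eqxx // subnn expr0 invr1 leeDr //.
by apply: sume_ge0 => j _; exact: hit_cost_ge0.
Qed.

(* When the flow through v exceeds the cost of the part of the cover p below v, the same holds
   at some open descendant, so a greedy descent avoids the whole cover. *)
Definition dominates p j v := forall n, (total_cost p v < (flow c k O n j v)%:E)%E.

Lemma dominates_step p j v : dominates p j v ->
  exists w, [/\ w \in desc (k j) v, O j v w & dominates p j.+1 w].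
Proof.
move=> dom; apply: contrapT => /forallNP no.
have /choice[N NP] : forall w, exists n, w \in desc (k j) v -> O j v w ->
    ((flow c k O n j.+1 w)%:E <= total_cost p w)%E.
  move=> w; have [wd|] := boolP (w \in desc (k j) v); last by exists 0%N.
  have [ow|] := boolP (O j v w); last by exists 0%N.
  have : ~ dominates p j.+1 w by move=> h; apply: (no w).
  by move=> /existsNP[n /negP]; rewrite -leNgt => h; exists n.
(* One horizon serves all descendants, since the flow decreases with the number of blocks. *)
pose n := (\max_(w <- desc (k j) v) N w)%N.
have ck : 0 < c ^+ k j by exact: exprn_gt0.
have := dom n.+1; rewrite ltNge => /negP; apply; rewrite [in leLHS]/=.
apply: (@le_trans _ _ (c ^- k j * \sum_(w <- desc (k j) v | O j v w) flow c k O n j.+1 w)%:E).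
  by rewrite lee_fin ge_min lexx orbT.
have h := total_cost_split p v (k j) (O j v).
have : ((\sum_(w <- desc (k j) v | O j v w) flow c k O n j.+1 w)%:E <= (c ^+ k j)%:E * total_cost p v)%E.
  apply: le_trans h; rewrite -sumEFin big_seq_cond [leRHS]big_seq_cond.
  apply: lee_sum => w /andP[wd ow]; apply: le_trans (NP w wd ow).
  by rewrite lee_fin (flow_antitone _ c0) // /n (big_rem w wd) /= leq_maxl.
case: (total_cost p v) (total_cost_ge0 p v) => [x| |] //.
  by rewrite -EFinM !lee_fin => _; rewrite -ler_pdivrMl.
by move=> _ _; rewrite leey.
Qed.

Lemma avoiding_ray p : dominates p 0 s0 -> exists s : boundary T,
  [/\ through s0 s, forall j, O j (s (L j)) (s (L j.+1)) &
   forall i j, s (L j) <> p i].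
Proof.
move=> dom0.
have /choice[nx nxP] : forall jv : nat * T, exists w, dominates p jv.1 jv.2 ->
    [/\ w \in desc (k jv.1) jv.2, O jv.1 jv.2 w & dominates p jv.1.+1 w].
  move=> [j v] /=; have [h|h] := pselect (dominates p j v); last by exists v.
  by have [w wP] := dominates_step h; exists w.
pose g := fix g j := if j is j'.+1 then nx (j', g j') else s0.
have gdom j : dominates p j (g j).
  by elim: j => // j IH; have [_ _] := nxP (j, g j) IH.
have gS j : g j.+1 \in desc (k j) (g j) by have [] := nxP (j, g j) (gdom j).
have gO j : O j (g j) (g j.+1) by have [] := nxP (j, g j) (gdom j).
have gd j : depth (g j) = L j.
  elim: j => [|j IH]; first by rewrite /block_level big_ord0 addn0.
  by have := gS j; rewrite (mem_desc lf) => /andP[_ /eqP ->]; rewrite block_levelS IH.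
have gaS j : anc (L j) (g j.+1) = g j.
  by have := gS j; rewrite (mem_desc lf) => /andP[/eqP + _]; rewrite gd.
have ga i j : (i <= j)%N -> anc (L i) (g j) = g i.
  move=> /subnK <-; elim: (j - i)%N => [|n IH]; first by rewrite anc_id // gd.
  rewrite addSn -IH -(gaS (n + i)%N) anc_anc (minn_idPl _) //.
  by apply: block_level_le => //; exact: leq_addl.
(* Only the vertices at block levels have been chosen; since [L n >= n], the vertex at depth [n] can
   be read off from [g n]. *)
have [||s sE] := @ray_of_chain T (fun n => anc n (g n)).
- by move=> n; rewrite depth_anc gd (minn_idPl (block_level_ge s0 k0 n)).
- move=> n; rewrite anc_anc (minn_idPl _) // -(gaS n) anc_anc (minn_idPl _) //.
  exact: block_level_ge.
have sg j : s (L j) = g j.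
  by rewrite sE ga // block_level_ge.
exists s; split.
- by have := sg 0%N; rewrite /block_level big_ord0 addn0.
- by move=> j; rewrite !sg.
(* A vertex in the cover costs at least 1, while the flow over 0 blocks is 1. *)
move=> i j; rewrite sg => /esym/total_cost_hit h.
by have := le_lt_trans h (gdom j 0%N); rewrite ltxx.
Qed.

End Avoid.

(** * Dimension and speed of the rays through open blocks *)

Section OpenRays.
Variables (R : realType) (T : rooted_tree).
Hypothesis lf : locally_finite T.
Variables (k : nat -> nat) (s0 : T).
Hypothesis k0 : forall j, (0 < k j)%N.
Local Notation L := (block_level k s0).
(* Blocks are negligible compared with the level at which they start. *)
Hypothesis growth : forall eta : R, 0 < eta -> exists C : R, forall j,
  (k j)%:R <= eta * (L j)%:R + C.
Implicit Types (s t : boundary T) (v w : T).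

(** If the measure vanished, a cheap cover by vertices could be moved up to block levels, where the
    greedy descent avoids it. The ray found escapes the original cover too, since it would have to
    pass through the chosen ancestor of any vertex covering it. *)
Lemma hausdorff_positive (a b th : R) (O : nat -> T -> T -> bool) (E : set (boundary T))
  (s1 : boundary T) : 0 < b -> b < a -> 0 < th -> (forall n, th <= flow (expR a) k O n 0 s0) ->
  (forall s, through s0 s -> (forall j, O j (s (L j)) (s (L j.+1))) -> E s) ->
  hausdorff_measure (@boundary_dist R T) b E <> 0%E.
Proof.
move=> b0 ba th0 thP OE H0.
have a0 : 0 < a by exact: lt_trans ba.
have c1 : 1 < expR a by rewrite -(@expR0 R) ltr_expR.
(* This rate gives [b (L + k) <= a L + b C]: the gap between [a] and [b] pays for moving a vertex up
   by less than a block. *)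
have [|C CP] := growth (_ : 0 < (a - b) / b); first by rewrite divr_gt0 // subr_gt0.
have aL j : b * ((L j)%:R + (k j)%:R) <= a * (L j)%:R + b * C.
  have := ler_wpM2l (ltW b0) (CP j).
  have -> : b * ((a - b) / b * (L j)%:R + C) = (a - b) * (L j)%:R + b * C.
    by field; rewrite gt_eqF.
  by clear -b0; lra.
pose K := expR (b * C).
pose F := expR a ^+ depth s0 * K.
have F0 : 0 < F by rewrite mulr_gt0 ?exprn_gt0 ?expR_gt0.
(* The first bound forces the covering vertices to be at least as deep as [s0], the second makes
   their normalized cost at most [th / 2]. *)
pose e := Num.min (expR (- b * (depth s0)%:R) / 2) (th / (2 * F)).
have e0 : 0 < e by rewrite lt_min !divr_gt0 ?expR_gt0 // mulr_gt0.
have [q [qE qsum]] := hausdorff_zero_cover s1 b0 H0 e0.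
have qe i : expR (- b * (depth (q i))%:R) <= e.
  rewrite -lee_fin; apply: le_trans qsum.
  have := @nneseries_lim_ge R (fun i => (expR (- b * (depth (q i))%:R))%:E) xpredT 0 i.+1.
  move=> h; apply: le_trans (h _); last by move=> j _ _; rewrite lee_fin expR_ge0.
  rewrite big_nat_recr //= leeDr // sume_ge0 // => j _; by rewrite lee_fin expR_ge0.
have qd i : (depth s0 <= depth (q i))%N.
  have : expR (- b * (depth (q i))%:R) < expR (- b * (depth s0)%:R).
    apply: le_lt_trans (qe i) _; rewrite /e gt_min; apply/orP; left.
    by rewrite ltr_pdivrMr // ltr_pMr ?expR_gt0 // ltr1n.
  by rewrite ltr_expR !mulNr ltrN2 ltr_pM2l // ltr_nat => /ltnW.
have /choice[J JP] : forall i, exists j, (L j <= depth (q i) < L j.+1)%N.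
  by move=> i; exact: (block_find k0 (qd i)).
pose p i := anc (L (J i)) (q i).
have pd i : depth (p i) = L (J i).
  by rewrite depth_anc (minn_idPl _) //; case/andP: (JP i).
have pc i : expR a ^- depth (p i) <= K * expR (- b * (depth (q i))%:R).
  rewrite -expRM_natr -expRN -expRD ler_expR pd.
  have /andP[_ h] := JP i; rewrite block_levelS in h.
  have : b * (depth (q i))%:R <= b * ((L (J i))%:R + (k (J i))%:R).
    by rewrite ler_wpM2l ?(ltW b0) // -natrD ler_nat ltnW.
  have := aL (J i); lra.
have hit i : (hit_cost (expR a) p i s0 <= F%:E * (expR (- b * (depth (q i))%:R))%:E)%E.
  rewrite -EFinM /hit_cost; case: ifP => [/andP[sp _]|_]; last first.
    by rewrite lee_fin mulr_ge0 ?expR_ge0 // ltW.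
  rewrite lee_fin /F -mulrA; apply: le_trans (ler_wpM2l _ (pc i)); last first.
    by rewrite exprn_ge0 // expR_ge0.
  rewrite -{2}(subnK sp) exprD invfM mulrCA mulfV ?mulr1 // gt_eqF //.
  by rewrite exprn_gt0 ?expR_gt0.
have cost : (total_cost (expR a) p s0 < th%:E)%E.
  apply: (@le_lt_trans _ _ (F%:E * e%:E)%E).
    apply: le_trans (_ : (\sum_(0 <= i <oo) F%:E * (expR (- b * (depth (q i))%:R))%:E <= _)%E).
      by apply: lee_nneseries => [i _ _|i _]; [exact: hit_cost_ge0|exact: hit].
    rewrite nneseriesZl; last by move=> i _; rewrite lee_fin expR_ge0.
    by apply: lee_wpmul2l => //; rewrite lee_fin ltW.
  rewrite -EFinM lte_fin.
  have : e <= th / (2 * F) by rewrite ge_min lexx orbT.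
  move=> /(ler_wpM2l (ltW F0)) h; apply: le_lt_trans h _.
  rewrite invfM mulrCA [X in _ * X]mulrCA mulfV ?gt_eqF // mulr1.
  by rewrite gtr_pMr // invf_lt1 // ltr1n.
have dom : dominates (expR a) k O p 0 s0.
  by move=> n; apply: lt_le_trans cost _; rewrite lee_fin.
have [s [sv so sp]] := avoiding_ray lf c1 k0 dom.
have [i qs] := qE s (OE s sv so).
apply: (sp i (J i)).
rewrite /p -qs anc_ray // ; by case/andP: (JP i).
Qed.

Lemma sum_root_path_ray (f : T -> R) t n : \sum_(u <- root_path (t n)) f u = \sum_(0 <= i < n) f (t i.+1).
Proof. by rewrite root_path_ray big_map -[1%N]addn0 iotaDl big_map /index_iota subn0. Qed.

Lemma sum_segment_ray (f : T -> R) t m n : (m <= n)%N ->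
  \sum_(u <- drop m (root_path (t n))) f u = \sum_(0 <= i < n) f (t i.+1) - \sum_(0 <= i < m) f (t i.+1).
Proof.
move=> mn; rewrite -!sum_root_path_ray -[in X in _ = X - _](cat_take_drop m (root_path (t n))) big_cat /=.
have -> : take m (root_path (t n)) = root_path (t m).
  by rewrite -(anc_ray t mn) root_path_anc.
by rewrite addrAC subrr add0r.
Qed.

(** Full blocks contribute at most [eps j * k j] each, a vanishing share of their length; the
    incomplete last block contributes at most a constant times its length, negligible by
    [growth]. *)
Lemma open_ray_lim (x : T -> R) (y M : R) (eps : nat -> R) t :
  eps @ \oo --> (0 : R) -> through s0 t ->
  (forall j, let l := drop (L j) (root_path (t (L j.+1))) in
     `|\sum_(u <- l) (x u - y)| <= eps j * (size l)%:R /\ all (fun u => `|x u| <= M) l) ->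
  rays_lim_eq x y%:E t.
Proof.
move=> epsl t0 op.
pose D n := \sum_(0 <= i < n) (x (t i.+1) - y).
have szl j : size (drop (L j) (root_path (t (L j.+1)))) = k j.
  by rewrite size_drop -/(depth _) depth_ray block_levelS addKn.
have DS j : `|D (L j.+1) - D (L j)| <= eps j * (k j)%:R.
  have [h _] := op j; rewrite szl in h; move: h.
  by rewrite sum_segment_ray // ltnW // block_level_lt.
have M0 : 0 <= M.
  have [_ /allP h] := op 0%N.
  have : (0 < size (drop (L 0) (root_path (t (L 1)))))%N by rewrite szl.
  case: (drop _ _) h => // u l h _.
  by apply: le_trans (h u _); rewrite ?inE ?eqxx.
have inblock j n : (L j <= n)%N -> (n <= L j.+1)%N -> `|D n - D (L j)| <= (M + `|y|) * (k j)%:R.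
  move=> jn nj; have [_ /allP h] := op j.
  have -> : D n - D (L j) = \sum_(L j <= i < n) (x (t i.+1) - y).
    by rewrite /D (big_cat_nat (leq0n (L j)) jn) /= addrAC subrr add0r.
  apply: le_trans (ler_norm_sum _ _ _) _.
  apply: (@le_trans _ _ (\sum_(L j <= i < n) (M + `|y|))).
    rewrite big_nat_cond [leRHS]big_nat_cond; apply: ler_sum => i /andP[/andP[h1 h2] _].
    apply: le_trans (ler_normB _ _) _; rewrite lerD2r; apply: h.
    rewrite root_path_ray -map_drop; apply: map_f.
    rewrite drop_iota mem_iota; lia.
  rewrite sumr_const_nat -[leLHS]mulr_natr ler_wpM2l ?addr_ge0 // ler_nat.
  rewrite leq_subLR; by rewrite block_levelS in nj.
have main (e : R) : 0 < e -> exists C : R, forall n, `|D n| <= 2 * e * n%:R + C.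
  move=> e0; have M1 : 0 < M + `|y| + 1 by rewrite ltr_wpDl // addr_ge0.
  have [|C CP] := growth (_ : 0 < e / (M + `|y| + 1)); first by rewrite divr_gt0.
  have [J _ JP] : \forall j \near \oo, eps j <= e.
    move/cvgrPdist_le: epsl => /(_ e e0); apply: filterS => j.
    by rewrite sub0r normrN; apply: le_trans; exact: ler_norm.
  pose B := \sum_(0 <= i < L J) `|x (t i.+1) - y|.
  have B0 m : (m <= L J)%N -> `|D m| <= B.
    move=> mJ; apply: le_trans (ler_norm_sum _ _ _) _.
    by rewrite /B (big_cat_nat (leq0n m) mJ) /= lerDl sumr_ge0.
  have DL j : (J <= j)%N -> `|D (L j)| <= B + e * (L j)%:R.
    move=> /subnK <-; elim: (j - J)%N => [|i IH].
      by rewrite add0n; apply: le_trans (B0 _ (leqnn _)) _; rewrite lerDl mulr_ge0 // ltW.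
    rewrite addSn -(subrK (D (L (i + J))) (D (L (i + J).+1))).
    apply: le_trans (ler_normD _ _) _; apply: le_trans (lerD (DS _) IH) _.
    rewrite block_levelS natrD mulrDr addrCA lerD2l addrC lerD2l ler_wpM2r //.
    by apply: JP => /=; exact: leq_addl.
  exists (B + (M + `|y|) * `|C|) => n.
  have [nJ|Jn] := leqP n (L J).
    apply: le_trans (B0 _ nJ) _; rewrite addrCA lerDl addr_ge0 // ?mulr_ge0 ?addr_ge0 //; exact: ltW.
  have s0n : (depth s0 <= n)%N.
    by apply: leq_trans (ltnW Jn); rewrite /block_level leq_addr.
  have [j /andP[jn nj]] := block_find k0 s0n.
  have Jj : (J <= j)%N.
    rewrite leqNgt; apply/negP => jJ; have := block_level_le s0 k0 jJ; lia.
  rewrite -(subrK (D (L j)) (D n)); apply: le_trans (ler_normD _ _) _.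
  apply: le_trans (lerD (inblock j n jn (ltnW nj)) (DL j Jj)) _.
  have h1 : (M + `|y|) * (k j)%:R <= e * n%:R + (M + `|y|) * `|C|.
    apply: (@le_trans _ _ ((M + `|y|) * (e / (M + `|y| + 1) * (L j)%:R + `|C|))).
      rewrite ler_wpM2l ?addr_ge0 //; apply: le_trans (CP j) _; rewrite lerD2l; exact: ler_norm.
    rewrite mulrDr lerD2r mulrA; apply: ler_pM => //.
    - by rewrite mulr_ge0 ?addr_ge0 // divr_ge0 ?ltW.
    - by rewrite mulrCA ger_pMr // ler_pdivrMr // mul1r lerDl.
    - by rewrite ler_nat.
  have h2 : e * (L j)%:R <= e * n%:R by rewrite ler_wpM2l ?(ltW e0) // ler_nat.
  by move: h1 h2; set q1 := _ * (k j)%:R; set q2 := _ * `|C|; lra.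
rewrite /rays_lim_eq /= /ray_average; apply: cvg_EFin; first exact: nearW.
apply/cvgrPdist_le => e e0.
(* Half of [e] goes to the linear term [2 (e / 4) n], half to the constant [C]. *)
have [C CP] := main (e / 4) (divr_gt0 e0 (ltr0n _ 4)).
pose N := (Num.truncn (`|C| / (e / 2))).+1.
exists N => // n /= Nn.
have n0 : (0 < n)%N by apply: leq_trans Nn.
have nr : (0 : R) < n%:R by rewrite ltr0n.
rewrite depth_ray partial_sumE.
have -> : y - (\sum_(u <- root_path (t n)) x u) / n%:R = - (D n / n%:R).
  rewrite /D -(sum_root_path_ray (fun u => x u - y)) sum_sub_const partial_sumE depth_ray.
  by rewrite mulrBl mulfK ?gt_eqF // opprB.
rewrite normrN normrM normfV (ger0_norm (ltW nr)) ler_pdivrMr //.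
apply: le_trans (CP n) _.
have : `|C| <= e / 2 * n%:R.
  rewrite -ler_pdivrMl ?divr_gt0 // mulrC; apply: ltW; apply: lt_le_trans (truncnS_gt _) _.
  by rewrite ler_nat.
have := ler_norm C; lra.
Qed.

End OpenRays.

(** The level grows quadratically, [L j >= j (j - 1) / 2]; [C] comes from completing the square in
    [j]. *)
Lemma linear_growth (R : realType) (T : rooted_tree) (s0 : T) (m : nat) (eta : R) : 0 < eta ->
  exists C : R, forall j, (m + j)%:R <= eta * (block_level (fun j => m + j)%N s0 j)%:R + C.
Proof.
move=> eta0; pose h := eta / 2; have h0 : 0 < h by rewrite divr_gt0.
exists (m%:R + (h + 1) ^+ 2 / (4 * h)) => j.
have q : (j * (j - 1) <= 2 * block_level (fun j => m + j)%N s0 j)%N.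
  elim: j => [|j IH]; first by [].
  rewrite block_levelS; case: j IH => [|j] IH; first by [].
  rewrite !subn1 /= in IH *; nia.
have q' : (j%:R * (j%:R - 1) : R) <= 2 * (block_level (fun j => m + j)%N s0 j)%:R.
  case: j q => [|j] q; first by rewrite mul0r mulr_ge0.
  by rewrite -[X in _ * (X - 1)]natr1 addrK -!natrM ler_nat; move: q; rewrite subn1.
rewrite natrD [leRHS]addrCA lerD2l.
set l := _%:R : R in q' *; set x : R := j%:R in q' *.
have sq : h * (x - (h + 1) / (2 * h)) ^+ 2 = h * (x * (x - 1)) - x + (h + 1) ^+ 2 / (4 * h).
  by field; rewrite gt_eqF.
have := mulr_ge0 (ltW h0) (sqr_ge0 (x - (h + 1) / (2 * h))); rewrite sq => s1.
have s2 : h * (x * (x - 1)) <= eta * l.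
  rewrite /h mulrAC ler_pdivrMr // -mulrA ler_wpM2l ?(ltW eta0) //.
  by rewrite [leRHS]mulrC.
have := le_trans s1 (lerD (lerB s2 (lexx x)) (lexx _)).
by rewrite addrAC subr_ge0.
Qed.

(** * Percolation of typical blocks *)

Section SecondMoment.
Context d (Omega : measurableType d) (R : realType) (P : probability Omega R).
Variables (I : eqType) (r : seq I) (e h : I -> Omega -> R) (b q : R).
Hypothesis ur : uniq r.
Hypothesis be : forall i, i \in r -> bounded_rv (e i).
Hypothesis bh : forall i, i \in r -> bounded_rv (h i).
Hypothesis e01 : forall i w, 0 <= e i w <= 1.
Hypothesis h01 : forall i w, 0 <= h i w <= 1.
Hypothesis b0 : 0 < b.
Hypothesis b1 : b <= 1.
Hypothesis q0 : 0 < q.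
Hypothesis qe : forall i, i \in r -> q <= mean P (e i).
Hypothesis eh : forall i, i \in r -> mean P (fun w => e i w * h i w) = mean P (e i) * mean P (h i).
Hypothesis ehh : forall i j, i \in r -> j \in r -> i != j ->
  mean P (fun w => e i w * h i w * h j w) = mean P (e i) * mean P (h i) * mean P (h j).

Let e0 i w : 0 <= e i w. Proof. by case/andP: (e01 i w). Qed.
Let e1 i w : e i w <= 1. Proof. by case/andP: (e01 i w). Qed.
Let h0 i w : 0 <= h i w. Proof. by case/andP: (h01 i w). Qed.
Let h1 i w : h i w <= 1. Proof. by case/andP: (h01 i w). Qed.

Lemma bounded_min1 (f : Omega -> R) : bounded_rv f -> (forall w, 0 <= f w) ->
  bounded_rv (fun w => Num.min 1 (f w)).
Proof.
move=> [mf _] f0; split; first exact: measurable_minr.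
by exists 1 => w; rewrite ger0_norm ?ge_min ?lexx // le_min ler01 f0.
Qed.

(* The thinning factors [t i] turn the first moments into exactly [q * g i];
   then min(1, x) >= x - x^2 / 4 and a crude bound of the off-diagonal terms suffice. *)
Let second_moment_small (g : I -> R) : (forall i, i \in r -> 0 <= g i <= mean P (h i)) ->
  b * \sum_(i <- r) g i <= 1 ->
  q / 2 * (b * \sum_(i <- r) g i) <= mean P (fun w => Num.min 1 (b * \sum_(i <- r) e i w * h i w)).
Proof.
move=> gh G1; pose G := \sum_(i <- r) g i.
pose t i := q * g i / (mean P (e i) * mean P (h i)).
have me0 i : i \in r -> 0 < mean P (e i) by move=> ir; apply: lt_le_trans q0 (qe ir).
have t0 i : i \in r -> 0 <= t i.
  move=> ir; have /andP[g0 gm] := gh i ir.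
  by rewrite divr_ge0 ?mulr_ge0 ?(ltW q0) ?(ltW (me0 i ir)) // (le_trans g0).
have tm i : i \in r -> t i * (mean P (e i) * mean P (h i)) = q * g i.
  move=> ir; have /andP[g0 gm] := gh i ir; rewrite /t.
  have [m0|m0] := eqVneq (mean P (h i)) 0; last by rewrite mulfVK // mulf_neq0 // gt_eqF // me0.
  have -> : g i = 0 by apply/eqP; rewrite eq_le g0 andbT -m0.
  by rewrite m0 !mulr0.
have tg i : i \in r -> t i * mean P (h i) <= g i.
  move=> ir; have /andP[g0 _] := gh i ir.
  rewrite -(ler_pM2l (me0 i ir)) mulrCA tm //.
  by rewrite ler_wpM2r // qe.
have t1 i : i \in r -> t i <= 1.
  move=> ir; have /andP[g0 gm] := gh i ir; rewrite /t.
  have [m0|m0] := eqVneq (mean P (h i)) 0; first by rewrite m0 mulr0 invr0 mulr0.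
  have mh : 0 < mean P (h i) by rewrite lt_neqAle eq_sym m0 (le_trans g0).
  rewrite ler_pdivrMr ?mulr_gt0 ?me0 // mul1r; apply: ler_pM => //; [exact: ltW|exact: qe].
pose x i w := t i * (e i w * h i w).
have bx i : i \in r -> bounded_rv (x i).
  by move=> ir; apply: bounded_scale; apply: bounded_mul; [exact: be|exact: bh].
have x0 i w : i \in r -> 0 <= x i w by move=> ir; apply: mulr_ge0; [exact: t0|exact: mulr_ge0].
pose W w := b * \sum_(i <- r) x i w.
have bW : bounded_rv W by apply: bounded_scale; exact: bounded_sum.
have W0 w : 0 <= W w.
  by rewrite mulr_ge0 ?(ltW b0) // big_seq_cond sumr_ge0 // => i /andP[ir _]; exact: x0.
have bWW := bounded_mul bW bW.
have mx i : i \in r -> mean P (x i) = q * g i.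
  by move=> ir; rewrite mean_scale ?eh ?tm //; apply: bounded_mul; [exact: be|exact: bh].
have mW : mean P W = b * (q * G).
  rewrite mean_scale ?mean_sum //; last exact: bounded_sum.
  by rewrite big_seq (eq_bigr (fun i => q * g i)) -?big_seq ?mulr_sumr // => i; exact: mx.
have mxx i j : i \in r -> j \in r -> mean P (fun w => x i w * x j w) <=
    (if i == j then q * g i else 0) + q * g i * g j.
  move=> ir jr; have /andP[gi0 _] := gh i ir; have /andP[gj0 _] := gh j jr.
  have bxx := bounded_mul (bx i ir) (bx j jr).
  case: eqVneq => [ij|ij].
    subst j; apply: (@le_trans _ _ (q * g i)); last by rewrite lerDl !mulr_ge0 // ltW.
    rewrite -(mx i ir); apply: mean_le => // [|w]; first exact: bx.
    rewrite -[leRHS]mulr1 ler_wpM2l ?x0 // mulr_ile1 ?t0 ?t1 //.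
      by rewrite mulr_ge0.
    by rewrite mulr_ile1.
  rewrite add0r; have bij : bounded_rv (fun w => e i w * h i w * h j w).
    by apply: bounded_mul; [apply: bounded_mul; [exact: be|exact: bh]|exact: bh].
  (* Blocks ending at different vertices may share edges, so [e j] is dropped by [e j <= 1];
     thinning brings [t j] times the mean of [h j] down to [g j]. *)
  apply: (@le_trans _ _ (mean P (fun w => (t i * t j) * (e i w * h i w * h j w)))).
    apply: mean_le => //; first exact: bounded_scale.
    move=> w; rewrite /x mulrACA; apply: ler_wpM2l; first by rewrite mulr_ge0 ?t0.
    apply: ler_wpM2l; first by rewrite mulr_ge0.
    by rewrite -[leRHS]mul1r ler_wpM2r.
  rewrite mean_scale // ehh // mulrACA tm // ler_wpM2l ?mulr_ge0 ?(ltW q0) //.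
  exact: tg.
have G0 : 0 <= G by rewrite /G big_seq_cond sumr_ge0 // => i /andP[ir _]; case/andP: (gh i ir).
have mWW : mean P (fun w => W w * W w) <= b ^+ 2 * (q * G + q * G * G).
  have -> : mean P (fun w => W w * W w) = mean P (fun w => b ^+ 2 * \sum_(i <- r) \sum_(j <- r) (x i w * x j w)).
    by apply: eq_mean => w; rewrite /W mulrACA -expr2 mulr_suml; congr (_ * _); apply: eq_bigr => i _; rewrite mulr_sumr.
  have bs i : i \in r -> bounded_rv (fun w => \sum_(j <- r) (x i w * x j w)).
    by move=> ir; apply: bounded_sum => j jr; apply: bounded_mul; exact: bx.
  rewrite mean_scale ?mean_sum //; last exact: bounded_sum.
  rewrite ler_wpM2l ?exprn_ge0 ?(ltW b0) //.
  apply: (@le_trans _ _ (\sum_(i <- r) \sum_(j <- r) ((if i == j then q * g i else 0) + q * g i * g j))).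
    rewrite big_seq [leRHS]big_seq; apply: ler_sum => i ir.
    rewrite mean_sum; last by move=> j jr; apply: bounded_mul; exact: bx.
    by rewrite big_seq [leRHS]big_seq; apply: ler_sum => j jr; exact: mxx.
  rewrite (eq_big_seq (fun i => q * g i + q * g i * G)).
    by rewrite big_split /= -mulr_suml -mulr_sumr.
  move=> i ir; rewrite big_split /= -mulr_sumr; congr (_ + _).
  rewrite (bigD1_seq i) //= eqxx big1_seq ?addr0 // => j /andP[ji _].
  by rewrite eq_sym (negbTE ji).
(* The mean of [W] is [b q G], that of its square at most [2 b q G] because [b <= 1] and [b G <= 1];
   a quarter of the latter removes half of the former. *)
apply: (@le_trans _ _ (mean P (fun w => W w - 4^-1 * (W w * W w)))).
  rewrite (mean_sub P bW (bounded_scale _ bWW)) (mean_scale P _ bWW).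
  have z0 : 0 <= b * q * G by rewrite !mulr_ge0 ?(ltW b0) ?(ltW q0).
  have z1 : b * (b * q * G) <= b * q * G by rewrite ler_piMl.
  have z2 : (b * G) * (b * q * G) <= b * q * G by rewrite ler_piMl.
  have z3 : b ^+ 2 * (q * G + q * G * G) = b * (b * q * G) + (b * G) * (b * q * G) by ring.
  rewrite z3 in mWW; rewrite mW -/G.
  have -> : q / 2 * (b * G) = b * q * G - (b * q * G) / 2 by field.
  rewrite mulrA lerD2l lerN2.
  by move: (le_trans mWW (lerD z1 z2)); set m := mean _ _; set z := b * q * G; lra.
have bsum : bounded_rv (fun w => b * \sum_(i <- r) e i w * h i w).
  by apply: bounded_scale; apply: bounded_sum => i ir; apply: bounded_mul; [exact: be|exact: bh].
have sum0 w : 0 <= b * \sum_(i <- r) e i w * h i w.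
  by rewrite mulr_ge0 ?(ltW b0) // sumr_ge0 // => i _; rewrite mulr_ge0.
apply: mean_le => //.
- have -> : (fun w => W w - 4^-1 * (W w * W w)) = (fun w => W w + (- 4^-1) * (W w * W w)).
    by apply/funext => w; rewrite mulNr.
  by apply: (bounded_add bW); exact: bounded_scale.
- exact: bounded_min1.
move=> w; have WS : W w <= b * \sum_(i <- r) e i w * h i w.
  rewrite ler_wpM2l ?(ltW b0) // big_seq [leRHS]big_seq; apply: ler_sum => i ir.
  by rewrite /x ler_piMl ?mulr_ge0 ?t1.
rewrite le_min; apply/andP; split.
  by have := sqr_ge0 (W w / 2 - 1); rewrite expr2; lra.
by apply: le_trans WS; rewrite gerBl mulr_ge0 ?invr_ge0 // mulr_ge0.
Qed.

(** Weights too large for the quadratic bound are scaled down until [b] times their sum is exactly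
    1. *)
Lemma second_moment (g : I -> R) : (forall i, i \in r -> 0 <= g i <= mean P (h i)) ->
  q / 2 * Num.min 1 (b * \sum_(i <- r) g i) <=
  mean P (fun w => Num.min 1 (b * \sum_(i <- r) e i w * h i w)).
Proof.
move=> gh; have [S1|S1] := leP (b * \sum_(i <- r) g i) 1.
  exact: second_moment_small.
rewrite mulr1; set S := b * _ in S1.
have S0 : 0 < S by exact: lt_trans S1.
have SV : b * (\sum_(i <- r) g i / S) = 1.
  by rewrite -mulr_suml mulrA -/S mulfV // gt_eqF.
have := @second_moment_small (fun i => g i / S); rewrite SV mulr1; apply => //.
move=> i ir; have /andP[g0 gm] := gh i ir.
rewrite divr_ge0 ?(ltW S0) //=; apply: le_trans gm.
by rewrite ler_pdivrMr // ler_peMr // ltW.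
Qed.

End SecondMoment.

Section Percolation.
Variables (R : realType) (T : rooted_tree).
Hypothesis lf : locally_finite T.
Context d (Omega : measurableType d) (P : probability Omega R).
Variable X : T -> {RV P >-> R}.
Let D : set T := [set v : T | v <> origin].
Hypothesis X_indep : mutually_independent D X.
Variables (y M : R) (eps : nat -> R) (m : nat) (c u : R).
Hypothesis m0 : (0 < m)%N.
Let k j := (m + j)%N.
Hypothesis c1 : 1 < c.
Hypothesis u0 : 0 < u.
Hypothesis u1 : u <= 1.
(** The factor 2 pays for the loss in the second moment bound, and [u^-2] for the ratio of the
    ansatz between consecutive blocks, whose lengths differ by 1. *)
Hypothesis typical_prob : forall j (l : seq T), uniq l -> [set` l] `<=` D -> size l = k j ->
  ((2 * u ^+ k j / u ^+ 2)%:E <= P (typical X y M (eps j) l))%E.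
Implicit Types (v w : T) (s : boundary T).

Let c0 : 0 < c. Proof. exact: lt_trans c1. Qed.

Definition segment v w : seq T := drop (depth v) (root_path w).

Definition open_block j v w : set Omega := typical X y M (eps j) (segment v w).

Definition random_flow n j v (a : Omega) : R :=
  flow c k (fun j v w => a \in open_block j v w) n j v.

(** The edges on which the flow at [v] may depend; for distinct vertices of one level these sets are
    disjoint, whence independence. *)
Definition below v : set T := [set x | (depth v < depth x)%N /\ anc (depth v) x = v].

Lemma below_D v : below v `<=` D.
Proof. by move=> x [h _] x0; rewrite x0 depth_origin in h. Qed.

Lemma segment_D v w : [set` segment v w] `<=` D.
Proof. by move=> x /= /mem_drop; exact: root_path_D. Qed.

Lemma segment_depth v w x : x \in segment v w -> (depth v < depth x)%N /\ anc (depth x) w = x.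
Proof.
move=> xs; have := mem_drop xs; rewrite mem_root_path => /andP[_ /eqP xw]; split => //.
rewrite ltnNge; apply/negP => xv.
have : uniq (root_path w) by exact: uniq_root_path.
rewrite -(cat_take_drop (depth v) (root_path w)) cat_uniq => /and3P[_ /hasPn h _].
have := h x xs; rewrite /= -root_path_anc mem_root_path anc_anc (minn_idPl xv) xw eqxx andbT.
have := mem_drop xs; rewrite mem_root_path => /andP[-> _] //.
Qed.

Lemma uniq_segment v w : uniq (segment v w).
Proof. exact/drop_uniq/uniq_root_path. Qed.

Lemma size_segment j v w : w \in desc j v -> size (segment v w) = j.
Proof.
rewrite (mem_desc lf) => /andP[_ /eqP dw].
have e : size (root_path w) = (depth v + j)%N by exact: dw.
by rewrite size_drop e addKn.
Qed.

Lemma segment_below j v w : w \in desc j v -> [set` segment v w] `<=` below v.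
Proof.
rewrite (mem_desc lf) => /andP[/eqP wv _] x /segment_depth[h xw]; split => //.
by rewrite -xw anc_anc (minn_idPl (ltnW h)).
Qed.

Lemma below_desc j v w : w \in desc j v -> below w `<=` below v.
Proof.
rewrite (mem_desc lf) => /andP[/eqP wv /eqP dw] x [h xw]; split.
  by apply: leq_ltn_trans h; rewrite dw leq_addr.
by rewrite -[RHS]wv -xw anc_anc (minn_idPl _) // dw leq_addr.
Qed.

Lemma open_block_measurable j v w : measurable (open_block j v w).
Proof. exact: typical_measurable. Qed.

Lemma random_flowS n j v a : random_flow n.+1 j v a =
  Num.min 1 (c ^- k j * \sum_(w <- desc (k j) v) \1_(open_block j v w) a * random_flow n j.+1 w a).
Proof.
rewrite /random_flow /=; congr (Num.min _ (_ * _)); rewrite big_mkcond.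
by apply: eq_bigr => w _; rewrite indicE; case: (_ \in _); rewrite ?mul1r ?mul0r.
Qed.

Lemma random_flow01 n j v a : 0 <= random_flow n j v a <= 1.
Proof. by rewrite (flow_ge0 _ c0) flow_le1. Qed.

Lemma open_block_in A j v w : [set` segment v w] `<=` A ->
  measurable_in X A (\1_(open_block j v w) : Omega -> R).
Proof.
move=> sA; apply: (@measurable_indic _ (g_sigma_algebraType (cyl X A))).
exact: typical_sigma.
Qed.

Lemma random_flow_in n j v : measurable_in X (below v) (random_flow n j v).
Proof.
elim: n j v => [|n IH] j v; first exact: measurable_cst.
(* The guard supplies, inside the sum, the membership in [desc (k j) v] that measurability in
   [below v] requires. *)
have -> : random_flow n.+1 j v = fun a => Num.min 1 (c ^- k j *
    \sum_(w <- desc (k j) v) (if w \in desc (k j) v then \1_(open_block j v w) a * random_flow n j.+1 w a else 0)).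
  apply/funext => a; rewrite random_flowS; congr (Num.min _ (_ * _)).
  by apply: eq_big_seq => w ->.
apply: measurable_minr; first exact: measurable_cst.
apply: measurable_funM; first exact: measurable_cst.
apply: measurable_sum => w; case: (boolP (w \in desc (k j) v)) => wd; last exact: measurable_cst.
apply: measurable_funM; first exact: (open_block_in j (segment_below wd)).
exact: (measurable_in_sub (below_desc wd) (IH j.+1 w)).
Qed.

Lemma random_flow_bounded n j v : bounded_rv (random_flow n j v).
Proof.
split; first exact: (measurable_inE (@random_flow_in n j v)).
by exists 1 => a; have /andP[h0 h1] := random_flow01 n j v a; rewrite ger0_norm.
Qed.

Lemma mean_indep (A B : set T) (U V : Omega -> R) : A `<=` D -> B `<=` D -> A `&` B = set0 ->
  measurable_in X A U -> measurable_in X B V -> bounded_rv U -> bounded_rv V ->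
  (forall a, 0 <= U a) -> (forall a, 0 <= V a) ->
  mean P (fun a => U a * V a) = mean P U * mean P V.
Proof.
move=> AD BD AB mU mV bU bV U0 V0; apply: EFin_inj.
rewrite EFinM -!bounded_rvE //; last exact: bounded_mul.
exact: (indep_mul X_indep AD BD AB mU mV U0 V0).
Qed.

Let full : nat -> T -> T -> bool := fun _ _ _ => true.

(* [u ^ (2 * k j) / u ^ 2] is the ansatz for which the second moment bound is inductive. *)
Lemma mean_flow_ge n j v :
  u ^+ (2 * k j) / u ^+ 2 * flow (c / u) k full n j v <= mean P (random_flow n j v).
Proof.
have cj (i : nat) : (0 < i)%N -> u ^+ (2 * i) / u ^+ 2 <= 1.
  case: i => // i _; rewrite ler_pdivrMr ?exprn_gt0 // mul1r mulnS exprD.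
  by rewrite ler_piMr ?exprn_ge0 ?exprn_ile1 // ltW.
have kpos j' : (0 < k j')%N by rewrite /k addn_gt0 m0.
have cuv : 0 < c / u by rewrite divr_gt0.
elim: n j v => [|n IH] j v.
  by rewrite /= mulr1; apply: le_trans (cj _ (kpos j)) _; rewrite (mean_cst P 1).
pose r := desc (k j) v; pose e w := (\1_(open_block j v w) : Omega -> R).
pose h w := random_flow n j.+1 w.
pose b := c ^- k j; pose q := 2 * u ^+ k j / u ^+ 2.
have b0 : 0 < b by rewrite invr_gt0 exprn_gt0.
have b1 : b <= 1 by rewrite invf_le1 ?exprn_gt0 // exprn_ege1 // ltW.
have q0 : 0 < q by rewrite divr_gt0 ?mulr_gt0 ?exprn_gt0.
have be w : w \in r -> bounded_rv (e w) by move=> _; apply: bounded_indic; exact: open_block_measurable.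
have bh w : w \in r -> bounded_rv (h w) by move=> _; exact: random_flow_bounded.
have e01 w a : 0 <= e w a <= 1 by rewrite /e indicE; case: (_ \in _); rewrite ?lexx ?ler01.
have h01 w a : 0 <= h w a <= 1 by exact: random_flow01.
have e0 w a : 0 <= e w a by case/andP: (e01 w a).
have h0 w a : 0 <= h w a by case/andP: (h01 w a).
have qe w : w \in r -> q <= mean P (e w).
  move=> wr; rewrite -lee_fin mean_indic; last exact: open_block_measurable.
  by apply: typical_prob; [exact: uniq_segment|exact: segment_D|exact: size_segment].
have seg_below w w' : w \in r -> w' \in r -> [set` segment v w] `&` below w' = set0.
  move=> wr wr'; apply/seteqP; split => // x [/= /segment_depth[_ xw] [h1 _]].
  move: wr wr'; rewrite !(mem_desc lf) => /andP[_ /eqP dw] /andP[_ /eqP dw'].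
  have : (depth x <= depth w)%N by rewrite -xw depth_anc geq_minr.
  by rewrite dw -dw' leqNgt h1.
have eh w : w \in r -> mean P (fun a => e w a * h w a) = mean P (e w) * mean P (h w).
  move=> wr; apply: (mean_indep (@segment_D v w) (@below_D w) (seg_below w w wr wr)).
  - exact: open_block_in.
  - exact: random_flow_in.
  - exact: be.
  - exact: bh.
  - exact: e0.
  - exact: h0.
have ehh w w' : w \in r -> w' \in r -> w != w' ->
    mean P (fun a => e w a * h w a * h w' a) = mean P (e w) * mean P (h w) * mean P (h w').
  move=> wr wr' ww; rewrite -eh //.
  apply: (@mean_indep ([set` segment v w] `|` below w) (below w')).
  - by move=> x [/segment_D|/below_D].
  - exact: below_D.
  - rewrite setIUl seg_below // set0U; apply/seteqP; split => // x [[_ xw] [_ xw']].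
    case/eqP: ww; move: wr wr'; rewrite !(mem_desc lf) => /andP[_ /eqP dw] /andP[_ /eqP dw'].
    by rewrite -xw -xw' dw dw'.
  - apply: measurable_funM; first by apply: open_block_in; exact: subsetUl.
    exact: (measurable_in_sub (@subsetUr _ _ _) (@random_flow_in n j.+1 w)).
  - exact: random_flow_in.
  - by apply: bounded_mul; [exact: be|exact: bh].
  - exact: bh.
  - by move=> a; exact: mulr_ge0.
  - exact: h0.
pose g w := u ^+ (2 * k j.+1) / u ^+ 2 * flow (c / u) k full n j.+1 w.
have gh w : w \in r -> 0 <= g w <= mean P (h w).
  by move=> _; rewrite IH andbT mulr_ge0 ?(flow_ge0 _ cuv) // divr_ge0 ?exprn_ge0 // ltW.
have := second_moment (uniq_desc _ _) be bh e01 h01 b0 b1 q0 qe eh ehh gh.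
have -> : mean P (fun a => Num.min 1 (b * \sum_(i <- r) e i a * h i a)) = mean P (random_flow n.+1 j v).
  by apply: eq_mean => a; rewrite random_flowS.
apply: le_trans.
pose F := \sum_(w <- r) flow (c / u) k full n j.+1 w.
have gF : \sum_(w <- r) g w = u ^+ (2 * k j) * F.
  rewrite /g -mulr_sumr; congr (_ * _); rewrite /k addnS mulnS addnC exprD mulfK //.
  by rewrite gt_eqF // exprn_gt0.
have F0 : 0 <= F by apply: sumr_ge0 => w _; exact: flow_ge0.
have q2 : q / 2 = u ^+ k j / u ^+ 2 by rewrite /q mulrAC [2 * _]mulrC mulfK // pnatr_eq0.
have uk : 0 < u ^+ k j by exact: exprn_gt0.
have u2 : 0 < u ^+ 2 by exact: exprn_gt0.
have uk1 : u ^+ k j <= 1 by rewrite exprn_ile1 // ltW.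
rewrite -/r gF q2 /= -/F.
have -> : (c / u) ^- k j = u ^+ k j * b.
  by rewrite /b expr_div_n invf_div.
have -> : u ^+ (2 * k j) = u ^+ k j * u ^+ k j by rewrite mul2n -addnn exprD.
set U := u ^+ k j in uk uk1 *.
rewrite [leLHS]mulrAC [leRHS]mulrAC ler_pM2r ?invr_gt0 // -[leLHS]mulrA ler_pM2l //.
(* Since [U <= 1], it may be taken inside the cap: [U min(1, x) <= min(1, U x)]. *)
rewrite le_min; apply/andP; split.
  apply: mulr_ile1 => //; [exact: ltW|rewrite le_min ler01 /= !mulr_ge0 // ltW //|by rewrite ge_min lexx].
apply: (@le_trans _ _ (U * (U * b * F))); first by rewrite ler_pM2l // ge_min lexx orbT.
by rewrite le_eqVlt; apply/orP; left; apply/eqP; ring.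
Qed.

Lemma prob_bigcap (r : seq T) (N : nat) (E : T -> set Omega) (p : T -> R) : uniq r ->
  (forall v, v \in r -> depth v = N) -> (forall v, v \in r -> sigma X (below v) (E v)) ->
  (forall v, v \in r -> (P (E v) <= (p v)%:E)%E) -> (forall v, 0 <= p v) ->
  (P (\bigcap_(v in [set` r]) E v) <= (\prod_(v <- r) p v)%:E)%E.
Proof.
(* Measurability of the intersection is proved along with the bound, since the induction step needs
   it for independence. *)
move=> + + + + p0; suff h : uniq r -> (forall v, v \in r -> depth v = N) ->
    (forall v, v \in r -> sigma X (below v) (E v)) -> (forall v, v \in r -> (P (E v) <= (p v)%:E)%E) ->
    sigma X (\bigcup_(v in [set` r]) below v) (\bigcap_(v in [set` r]) E v) /\
    (P (\bigcap_(v in [set` r]) E v) <= (\prod_(v <- r) p v)%:E)%E.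
  by move=> ur dr sr pr; have [] := h ur dr sr pr.
elim: r => [_ _ _ _|v r IH /= /andP[vr ur] dr sr pr].
  have -> : \bigcap_(v in [set` [::]]) E v = setT by apply/seteqP; split.
  split; last by rewrite big_nil probability_setT.
  exact: (@measurableT _ (g_sigma_algebraType (cyl X (\bigcup_(v in [set` [::]]) below v)))).
have capE : \bigcap_(i in [set` v :: r]) E i = E v `&` \bigcap_(i in [set` r]) E i.
  apply/seteqP; split => a.
    move=> h; split; first by apply: h; rewrite /= inE eqxx.
    by move=> i ir; apply: h; rewrite /= inE ir orbT.
  by move=> [h1 h2] i /=; rewrite inE => /orP[/eqP ->//|ir]; exact: h2.
have sub1 : below v `<=` \bigcup_(i in [set` v :: r]) below i.
  by move=> x xv; exists v => //=; rewrite inE eqxx.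
have sub2 : \bigcup_(i in [set` r]) below i `<=` \bigcup_(i in [set` v :: r]) below i.
  by move=> x [i ir xi]; exists i => //=; rewrite inE ir orbT.
have inr i : i \in r -> i \in v :: r by move=> ir; rewrite inE ir orbT.
have [IH1 IH2] := IH ur (fun i ir => dr i (inr i ir)) (fun i ir => sr i (inr i ir)) (fun i ir => pr i (inr i ir)).
have sv : sigma X (below v) (E v) by apply: sr; rewrite inE eqxx.
rewrite capE; split.
  apply: (@measurableI _ (g_sigma_algebraType (cyl X (\bigcup_(i in [set` v :: r]) below i)))).
    exact: sigma_sub sub1 _ sv.
  exact: sigma_sub sub2 _ IH1.
have disj : below v `&` \bigcup_(i in [set` r]) below i = set0.
  apply/seteqP; split => // x [[_ xv] [i /= ir [_ xi]]].
  have dv : depth v = N by apply: dr; rewrite inE eqxx.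
  have di : depth i = N by apply: dr; rewrite inE ir orbT.
  by move: ir; rewrite -xi di -dv xv (negbTE vr).
rewrite (indep_sigma X_indep (@below_D v) _ disj sv IH1); last by move=> x [i _ /below_D].
rewrite big_cons EFinM; apply: lee_pmul => //; apply: pr; by rewrite inE eqxx.
Qed.

Variable dl : R.
Hypothesis dl0 : 0 < dl.
Hypothesis flow_cut_bound : forall A : seq T, origin \notin A -> hits A ->
  dl <= \sum_(v <- A) (c / u) ^- depth v.

(** The limit of the deterministic flows, which decrease in [n]. *)
Let phi v := inf (range (fun n => flow (c / u) k full n 0 v)).

Let cu0 : 0 < c / u. Proof. by rewrite divr_gt0. Qed.

Let phi_le n v : phi v <= flow (c / u) k full n 0 v.
Proof.
apply: ge_inf; last by exists n.
by exists 0 => _ [i _ <-]; exact: flow_ge0.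
Qed.

Let phi_ge0 v : 0 <= phi v.
Proof.
apply: lb_le_inf; first by exists (flow (c / u) k full 0 0 v); exists 0%N.
by move=> _ [i _ <-]; exact: flow_ge0.
Qed.

Let phi_approx (r : seq T) (e : R) : 0 < e -> exists n, forall v, v \in r -> flow (c / u) k full n 0 v <= phi v + e.
Proof.
move=> e0; have /choice[n nP] : forall v, exists n, flow (c / u) k full n 0 v < phi v + e.
  move=> v; have [|_ [n _ <-] h] := @inf_adherent R (range (fun n => flow (c / u) k full n 0 v)) e e0.
    split; first by exists (flow (c / u) k full 0 0 v); exists 0%N.
    by exists 0 => _ [i _ <-]; exact: flow_ge0.
  by exists n.
exists (\max_(v <- r) n v)%N => v vr; apply: le_trans (ltW (nP v)).
by apply: (flow_antitone _ cu0); rewrite (big_rem v vr) /= leq_maxl.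
Qed.

(** The level is finite, so one horizon approximates all the limits at once. *)
Let phi_sum N : (0 < N)%N -> dl * (c / u) ^+ N <= \sum_(v <- lvl T N) phi v.
Proof.
move=> N0; apply/ler_addgt0Pr => e e0.
pose e' := e / ((size (lvl T N))%:R + 1).
have [|n nP] := phi_approx (lvl T N) (_ : 0 < e'); first by rewrite divr_gt0.
apply: le_trans (flow_level_sum lf k cu0 n N0 flow_cut_bound) _.
apply: (@le_trans _ _ (\sum_(v <- lvl T N) (phi v + e'))).
  by rewrite big_seq [leRHS]big_seq; apply: ler_sum => v; exact: nP.
rewrite big_split /= lerD2l big_const_seq count_predT iter_addr_0 -[leLHS]mulr_natr.
by rewrite /e' mulrAC ler_pdivrMr // ler_pM2l // lerDl.
Qed.

Let cc := u ^+ (2 * k 0) / u ^+ 2.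

Let cc0 : 0 < cc. Proof. by rewrite divr_gt0 ?exprn_gt0. Qed.

(** The threshold is half of the guaranteed mean of the flow, so failure has probability less than 1
    when [phi v > 0]. *)
Let dead v := \bigcup_n [set a | random_flow n 0 v a < cc * phi v / 2].

Let dead_sigma v : sigma X (below v) (dead v).
Proof.
apply: (@bigcupT_measurable _ (g_sigma_algebraType (cyl X (below v)))) => n.
apply: (@measurable_lt _ (g_sigma_algebraType (cyl X (below v)))).
exact: random_flow_in.
Qed.

(** The flow is at most [th] on [F n] and at most 1 off it, while its mean is at least [2 th]; the
    events increase with [n], so the bound passes to their union. *)
Let dead_prob v : (P (dead v) <= (1 - cc * phi v / 2)%:E)%E.
Proof.
pose F n := [set a | random_flow n 0 v a < cc * phi v / 2].
have mF n : measurable (F n) by apply: measurable_lt; exact: (measurable_inE (@random_flow_in n 0 v)).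
have nd : nondecreasing_seq F.
  move=> n n' nn; apply/subsetPset => a /= h; apply: le_lt_trans h.
  exact: flow_antitone.
have cv := nondecreasing_cvg_mu (mu := P) mF (bigcupT_measurable F mF) nd.
apply: (cvge_le _ cv); apply: nearW => n /=.
set th := cc * phi v / 2; have bF := bounded_indic R (mF n).
have bK := random_flow_bounded n 0 v.
have : mean P (random_flow n 0 v) <= mean P (fun a => cst (1 + th) a + (-1) * \1_(F n) a).
  apply: mean_le => //; first by apply: bounded_add; [exact: bounded_cst|exact: bounded_scale].
  move=> a; rewrite indicE; case: (boolP (a \in F n)); rewrite ?inE ?notin_setE /F /= => h.
    by rewrite mulr1 addrAC subrr add0r ltW.
  rewrite mulr0 addr0; have /andP[_ h1] := random_flow01 n 0 v a; apply: le_trans h1 _.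
  by rewrite lerDl divr_ge0 // mulr_ge0 ?phi_ge0 // ltW.
rewrite (mean_add P (bounded_cst _ _) (bounded_scale _ bF)) (mean_cst P) (mean_scale P _ bF) => h1.
have h2 : cc * phi v <= mean P (random_flow n 0 v).
  by apply: le_trans (mean_flow_ge n 0 v); rewrite ler_wpM2l ?phi_le // ltW.
rewrite -mean_indic // lee_fin.
have e2 : cc * phi v = 2 * th by rewrite /th [RHS]mulrC divfK.
by rewrite e2 in h2; have := le_trans h2 h1; set q := mean _ _; lra.
Qed.

(* Each vertex v of a high level is good with probability at least cc * phi v / 2, these
   events are independent, and the sum of phi over the level grows geometrically. *)
Lemma survive : {ae P, forall a, exists (v : T) (th : R), 0 < th /\ forall n, th <= random_flow n 0 v a}.
Proof.
apply: ae_of_small => e e0.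
have l1 : 1 < c / u by rewrite ltr_pdivlMr // mul1r (le_lt_trans u1).
have a0 : 0 < cc * dl / 2 by rewrite divr_gt0 // mulr_gt0.
have [N0 N0P] : exists K, forall n, (K <= n)%N -> (c / u)^-1 ^+ n <= e * (cc * dl / 2).
  apply: geometric_small; first by rewrite invr_ge0 ltW.
    by rewrite invf_lt1.
  exact: mulr_gt0.
pose N := N0.+1; pose r := [seq v <- lvl T N | 0 < phi v].
have rsum : dl * (c / u) ^+ N <= \sum_(v <- r) phi v.
  rewrite big_filter big_mkcond /=; apply: le_trans (phi_sum (ltn0Sn N0)) _.
  by apply: ler_sum => v _; case: ifPn => //; rewrite -leNgt.
pose F := \bigcap_(v in [set` r]) dead v.
have th1 v : 0 <= 1 - cc * phi v / 2.
  by rewrite -lee_fin; apply: le_trans (dead_prob v).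
exists F.
  apply: fin_bigcap_measurable; first exact: finite_seq.
  by move=> v _; exact: (sigma_measurable (@dead_sigma v)).
split.
  have := @prob_bigcap r N dead (fun v => 1 - cc * phi v / 2) (filter_uniq _ (uniq_lvl T N)) _ _ _ th1.
  move=> h; apply: le_trans (h _ _ _) _ => //.
    by move=> v; rewrite mem_filter (mem_lvl lf) => /andP[_ /eqP].
  (* The product is at most [expR (- z) <= 1 / z], with [z] a constant times [(c / u)^N], and [N]
     was chosen to make this at most [e]. *)
  rewrite lee_fin; apply: (@le_trans _ _ (expR (- (cc / 2 * \sum_(v <- r) phi v)))).
    rewrite mulr_sumr -sumrN expR_sum; apply: ler_prod => v _; rewrite th1 /=.
    by apply: le_trans (expR_ge1Dx _); rewrite mulrAC.
  apply: (@le_trans _ _ (expR (- (cc * dl / 2 * (c / u) ^+ N)))).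
    have -> : cc * dl / 2 * (c / u) ^+ N = cc / 2 * (dl * (c / u) ^+ N) by ring.
    by rewrite ler_expR lerN2 ler_wpM2l // divr_ge0 // ltW.
  have z0 : 0 < cc * dl / 2 * (c / u) ^+ N by rewrite mulr_gt0 // exprn_gt0.
  rewrite expRN; apply: (@le_trans _ _ (cc * dl / 2 * (c / u) ^+ N)^-1).
    rewrite lef_pV2 ?posrE ?expR_gt0 //; apply: le_trans (expR_ge1Dx _); by rewrite lerDr.
  rewrite invfM ler_pdivrMl // [leRHS]mulrC -exprVn; apply: N0P.
  exact: leqnSn.
apply: aeW => a nF.
have /existsNP[v /not_implyP[vr vd]] := nF.
exists v, (cc * phi v / 2); split.
  have : v \in r by []; rewrite mem_filter => /andP[p0 _].
  by rewrite divr_gt0 // mulr_gt0.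
by move=> n; rewrite leNgt; apply/negP => h; apply: vd; exists n.
Qed.

End Percolation.

(** * Choice of the tolerances and the lower bound for the dimension *)

Section Survival.
Variables (R : realType) (T : rooted_tree).
Hypothesis lf : locally_finite T.
Context d (Omega : measurableType d) (P : probability Omega R).
Context d' (Omega' : measurableType d') (P' : probability Omega' R).
Variables (X : T -> {RV P >-> R}) (X0 : {RV P' >-> R}).
Let D : set T := [set v : T | v <> origin].
Hypothesis X_indep : mutually_independent D X.
Hypothesis X_law : forall v : T, v <> origin -> same_law (X v) X0.

(* The tolerance of the blocks tends to 0 slowly enough for their lengths. *)
Lemma slow_index (K : nat -> nat) (m : nat) : (K 0 <= m)%N -> exists g : nat -> nat,
  (forall j, K (g j) <= m + j)%N /\ forall i, exists N, forall j, (N <= j)%N -> (i <= g j)%N.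
Proof.
move=> K0.
(* The index taken at [j] is the largest [i <= j] with [K i <= m + j]; the restriction to [i <= j]
   makes the search finite. *)
have /choice[g gP] : forall j, exists i, (K i <= m + j)%N /\
    forall i', (i' <= j)%N -> (K i' <= m + j)%N -> (i' <= i)%N.
  move=> j; have h : (K (@ord0 j) <= m + j)%N by apply: leq_trans K0 _; exact: leq_addr.
  exists (nat_of_ord [arg max_(i > @ord0 j | (K i <= m + j)%N) i]).
  case: arg_maxnP => //= i Ki iP; split => // i' i'j Ki'.
  by have := iP (inord i'); rewrite inordK //; apply.
exists g; split => [j|i]; first by case: (gP j).
exists (maxn i (K i)) => j; rewrite geq_max => /andP[ij Kj]; have [_] := gP j; apply => //.
by apply: leq_trans Kj _; rewrite leq_addl.
Qed.

Lemma steady_blocks (y M u v : R) : 0 < u -> u < v -> steady D X y v M ->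
  exists (eps : nat -> R) (m : nat), [/\ (0 < m)%N, eps @ \oo --> (0 : R) &
    forall j (l : seq T), uniq l -> [set` l] `<=` D -> size l = (m + j)%N ->
      ((2 * u ^+ (m + j) / u ^+ 2)%:E <= P (typical X y M (eps j) l))%E].
Proof.
move=> u0 uv st; have v0 : 0 < v by exact: lt_trans uv.
have /choice[K KP] : forall n : nat, exists K, forall l : seq T, uniq l -> [set` l] `<=` D -> (K <= size l)%N ->
    ((v ^+ size l)%:E <= P (typical X y M n.+1%:R^-1 l))%E.
  by move=> n; apply: st; rewrite invr_gt0 ltr0n.
(* Beyond [K1] the passage from [v] to [u] pays for the factor [2 / u^2]. *)
have [K1 K1P] : exists K, forall k, (K <= k)%N -> (u / v) ^+ k <= u ^+ 2 / 2.
  apply: geometric_small; first by rewrite divr_ge0 ?ltW.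
    by rewrite ltr_pdivrMr // mul1r.
  by rewrite divr_gt0 ?exprn_gt0.
pose m := maxn (maxn (K 0) K1) 1.
have [g [gK gN]] := @slow_index K m (leq_trans (leq_maxl _ _) (leq_maxl _ _)).
exists (fun j => (g j).+1%:R^-1), m; split.
- by rewrite leq_max orbT.
- apply/cvgrPdist_le => e e0.
  have [i iP] : exists i : nat, e^-1 <= i%:R.
    by exists (Num.bound e^-1); apply/ltW/archi_boundP; rewrite invr_ge0 ltW.
  have [N NP] := gN i; exists N => // j /= /NP ij; rewrite sub0r normrN ger0_norm ?invr_ge0 //.
  rewrite -[leRHS]invrK lef_pV2 ?posrE ?invr_gt0 ?ltr0n //; apply: le_trans iP _.
  by rewrite ler_nat (leq_trans ij).
- move=> j l ul lD sl; apply: le_trans (KP (g j) l ul lD _); last by rewrite sl.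
  rewrite lee_fin sl ler_pdivrMr ?exprn_gt0 // mulrC -ler_pdivlMr //.
  rewrite -mulrA mulrC -ler_pdivrMr ?exprn_gt0 // -expr_div_n; apply: K1P.
  by apply: leq_trans (leq_addr _ _); rewrite !leq_max leqnn orbT.
Qed.

Lemma hausdorff_lower (s0 : boundary T) (y u l a : R) : 0 < u -> u <= 1 -> tiltable X0 y u ->
  (l%:E < branching_number R T)%E -> 0 < a -> expR a < u * l ->
  {ae P, forall w, forall b, 0 < b -> b < a ->
    hausdorff_measure (@boundary_dist R T) b (rays_lim_eq (fun v => X v w) y%:E) <> 0%E}.
Proof.
move=> u0 u1 [B [t [L [mB BL L0 ut tmin]]]] lbr a0 al.
have st := tilted_steady X_indep X_law mB BL L0 u0 ut tmin.
have l0 : 0 < l by rewrite -(pmulr_rgt0 _ u0) (lt_trans _ al) // expR_gt0.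
(* Below [u], to leave room in [steady_blocks], and above [expR a / l], so that the flow parameter
   [expR a / v] stays below [br]. *)
pose v := (u + expR a / l) / 2.
have vl : expR a / l < u by rewrite ltr_pdivrMr.
have vu : v < u by rewrite /v; lra.
have lv : expR a / l < v by rewrite /v; lra.
have v0 : 0 < v by apply: lt_trans lv; rewrite divr_gt0 ?expR_gt0.
have v1 : v <= 1 by apply: le_trans (ltW vu) u1.
have [eps [m [m0 eps0 tp]]] := steady_blocks v0 vu st.
have c1 : 1 < expR a by rewrite expR_gt1.
have cv0 : 0 < expR a / v by rewrite divr_gt0 ?expR_gt0.
have cvl : ((expR a / v)%:E < branching_number R T)%E.
  by apply: lt_trans lbr; rewrite lte_fin ltr_pdivrMr // mulrC -ltr_pdivrMr.
have [dl dl0 dlP] := branching_flow cv0 cvl.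
have := survive lf X_indep m0 c1 v0 v1 tp dl0 dlP.
apply: filterS => w [s1 [th [th0 thP]]] b b0 ba.
have k0 j : (0 < m + j)%N by rewrite addn_gt0 m0.
have gr := @linear_growth R T s1 m.
apply: (@hausdorff_positive R T lf (fun j => (m + j)%N) s1 k0 gr a b th _ _ s0 b0 ba th0 thP) => s ss open.
apply: (open_ray_lim (M := `|y| + L) k0 gr eps0 ss) => j.
have := open j; rewrite inE /open_block /typical /segment /= depth_ray; exact.
Qed.

End Survival.

(** * The theorem *)

(** Almost sure statements can be combined over countably many parameters only; the rationals,
    listed by decoding integers, separate any two extended reals. *)
Lemma dense_sequence (R : realType) : exists q : nat -> R,
  forall a b : \bar R, (a < b)%E -> exists n, (a < (q n)%:E < b)%E.
Proof.
exists (fun n => ratr (odflt 0 (choice.unpickle n))) => a b ab.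
have [x [y [xy ax yb]]] : exists x y : R, [/\ x < y, (a <= x%:E)%E & (y%:E <= b)%E].
  case: a b ab => [a| |] [b| |] //.
  - by rewrite lte_fin => ab; exists a, b.
  - by exists a, (a + 1); rewrite ltrDl leey.
  - by exists (b - 1), b; rewrite gtrBl leNye.
  - by exists 0, 1; rewrite leNye leey.
have [r] := rat_in_itvoo xy; rewrite in_itv /= => /andP[xr ry].
exists (choice.pickle r); rewrite choice.pickleK /=; apply/andP; split.
  by apply: le_lt_trans ax _; rewrite lte_fin.
by apply: lt_le_trans yb; rewrite lte_fin.
Qed.

Section HausdorffMonotone.
Variables (R : realType) (T : rooted_tree).
Implicit Types (E F : set (boundary T)) (a : R).
Notation dist := (@boundary_dist R T).

Lemma hausdorff_measure_le a E F : E `<=` F -> (hausdorff_measure dist a E <= hausdorff_measure dist a F)%E.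
Proof.
move=> EF; apply: ge_ereal_sup => _ [dl dl0 <-].
apply: le_trans (ereal_sup_ubound (ex_intro2 _ _ dl dl0 erefl)).
apply: ereal_inf_le_tmp => _ [U [FU dU] <-]; exists U => //; split => //.
exact: subset_trans EF FU.
Qed.

Lemma hausdorff_measure_ge0 a E : (0 <= hausdorff_measure dist a E)%E.
Proof.
apply: le_trans (hausdorff_premeasure_ge0 a 1 E) _.
by apply: ereal_sup_ubound; exists 1 => //=; exact: ltr01.
Qed.

Lemma hausdorff_measure_set0 a : 0 < a -> hausdorff_measure dist a set0 = 0%E.
Proof.
move=> a0; apply: (hausdorff_zero (G := fun=> [::]) a0) => //.
by rewrite eseries0 ?ltry // => n _ _; rewrite big_nil.
Qed.

Lemma hausdorff_dim_le E F : E `<=` F -> (hausdorff_dim dist E <= hausdorff_dim dist F)%E.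
Proof.
move=> EF; apply: ereal_inf_le_tmp => _ [a [a0 aF] <-]; exists a => //; split => //.
apply/eqP; rewrite eq_le hausdorff_measure_ge0 andbT.
by rewrite -aF; exact: hausdorff_measure_le.
Qed.

Lemma rays_lim_limsup (x : T -> R) (l : \bar R) s : rays_lim_eq x l s -> limn_esup (ray_average x s) = l.
Proof. by move/cvg_limn_einf_sup => [_ ->]. Qed.

Lemma rays_lim_eq_sub (x : T -> R) (l : \bar R) : rays_lim_eq x l `<=` rays_limsup_le x l.
Proof. by move=> s /rays_lim_limsup; rewrite /rays_limsup_le /= => ->. Qed.

Lemma ray_infima_eq (x : T -> R) (z : \bar R) :
  (forall s, z <= limn_esup (ray_average x s))%E ->
  (forall y : R, (z < y%:E)%E -> exists2 l, (l <= y%:E)%E & exists s, rays_lim_eq x l s) ->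
  ereal_inf [set limn_esup (ray_average x s) | s in [set: boundary T]]
    = ereal_inf [set l | exists s, rays_lim_eq x l s] /\
  ereal_inf [set l | exists s, rays_lim_eq x l s] = z.
Proof.
move=> lo hi; set A := ereal_inf _; set B := ereal_inf _.
have zA : (z <= A)%E by apply: le_ereal_inf_tmp => _ [s _ <-].
have AB : (A <= B)%E.
  by apply: ereal_inf_le_tmp => l [s /rays_lim_limsup sl]; exists s.
have Bz : (B <= z)%E.
  apply/lee_addgt0Pr => e e0.
  case: z lo hi zA => [z| |] lo hi zA; [|by rewrite addye ?leey|].
    have [|l ly [s sl]] := hi (z + e); first by rewrite lte_fin ltrDl.
    by apply: le_trans ly; apply: ereal_inf_lbound; exists s.
  (* For [z = -oo] adding [e] gives nothing; instead, a real number below [B] would bound some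
     attained limit and contradict the infimum. *)
  rewrite addNye; have [-> //|BNy] := eqVneq B -oo%E.
  have [q qP] := dense_sequence R; have [|n /andP[nB Bn]] := qP -oo%E B; first by rewrite lt_neqAle eq_sym BNy leNye.
  have [|l ly [s sl]] := hi (q n); first exact: nB.
  have : (B <= (q n)%:E)%E by apply: le_trans ly; apply: ereal_inf_lbound; exists s.
  by rewrite leNgt Bn.
have AzE : A = z by apply/eqP; rewrite eq_le zA (le_trans AB).
have BzE : B = z by apply/eqP; rewrite eq_le Bz -AzE AB.
by rewrite AzE BzE.
Qed.

End HausdorffMonotone.

Section RateInverse.
Variables (R : realType) (T : rooted_tree).
Context d' (Omega' : measurableType d') (P' : probability Omega' R).
Variable X0 : {RV P' >-> R}.
Variable s0 : boundary T.
Let br := branching_number R T.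

Lemma branching_cases : br = +oo%E \/ exists2 b : R, 1 <= b & br = b%:E.
Proof.
have := branching_ge1 R s0; rewrite -/br; case: br => [b| |] //; last by left.
by rewrite lee_fin => b1; right; exists b.
Qed.

Lemma rate_below_inv (y : R) : (y%:E < rate_inv X0 br^-1)%E ->
  (exists2 b : R, br = b%:E & (rate X0 y < b^-1%:E)%E) \/ rate X0 y = 0%E.
Proof.
have [brE|[b b1 brE]] := branching_cases; rewrite brE.
  rewrite invey /rate_inv eqxx => h; right; apply/eqP/negPn/negP => r0.
  have rp : (0 < rate X0 y)%E by rewrite lt_neqAle eq_sym r0 rate_ge0.
  by move: h; rewrite ltNge => /negP; apply; apply: ereal_inf_lbound; exists y.
have b0 : 0 < b by exact: lt_le_trans b1.
rewrite inver gt_eqF // /rate_inv eqe invr_eq0 gt_eqF // => /ereal_sup_gt[_ [y' y'b <-]].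
rewrite lte_fin => yy'; left; exists b => //.
exact: le_lt_trans (rate_nd X0 (ltW yy')) y'b.
Qed.

Lemma rate_above_inv (y : R) : (rate_inv X0 br^-1 < y%:E)%E ->
  (0 < rate X0 y)%E /\ forall b : R, br = b%:E -> (b^-1%:E <= rate X0 y)%E.
Proof.
have [brE|[b b1 brE]] := branching_cases; rewrite brE.
  rewrite invey /rate_inv eqxx => /ereal_inf_lt[_ [y' y'0 <-]]; rewrite lte_fin => yy'.
  by split => //; apply: lt_le_trans y'0 (rate_nd X0 (ltW yy')).
have b0 : 0 < b by exact: lt_le_trans b1.
rewrite inver gt_eqF // /rate_inv eqe invr_eq0 gt_eqF // => h.
have h1 : (b^-1%:E <= rate X0 y)%E.
  rewrite leNgt; apply/negP => yb; move: h; rewrite ltNge => /negP; apply.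
  by apply: ereal_sup_ubound; exists y.
split; last by move=> _ [<-].
by apply: lt_le_trans h1; rewrite lte_fin invr_gt0.
Qed.

(** Above the critical speed the rate is at least [1 / br]; strictness comes from strict
    monotonicity when [br > 1]. When [br = 1], a rate of 1 left of the mean forces the rate to be 1
    everywhere, which is excluded. *)
Lemma supercritical_rate (y : R) : ~ (br = 1%E /\ forall y : R, rate X0 y = 1%E) ->
  (rate_inv X0 br^-1 < y%:E)%E -> (y%:E < sup_truncated_mean X0)%E ->
  exists2 a : R, 0 < a & ((expR a)%:E < rate X0 y * br)%E.
Proof.
move=> ndeg zy ymu.
have [brE|[b b1 brE]] := branching_cases.
  by exists 1 => //; rewrite brE gt0_muley ?ltry //; case: (rate_above_inv zy).
have b0 : 0 < b by exact: lt_le_trans b1.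
suff h : (b^-1%:E < rate X0 y)%E.
  move: h; rewrite brE (rate_fin X0 y); set r := fine _.
  rewrite lte_fin -[b^-1]mul1r ltr_pdivrMr // => rb.
  exists (ln (r * b) / 2); first by rewrite divr_gt0 // ln_gt0.
  rewrite -EFinM lte_fin -[ltRHS]lnK ?posrE; last by apply: lt_trans rb.
  by rewrite ltr_expR ltr_pdivrMr // ltr_pMr ?ln_gt0 // ltr1n.
have [q qP] := dense_sequence R; have [n /andP[zn ny]] := qP _ _ zy.
rewrite lte_fin in ny; have [_ /(_ b brE) h] := rate_above_inv zn.
have [bE|b1'] := eqVneq b 1.
  case: ndeg; split; first by rewrite brE bE.
  move=> y'; apply/eqP; rewrite eq_le rate_le1 leNgt; apply/negP => /rate_lt1 lt1.
  have : (rate X0 (q n) < 1)%E by apply: lt1; apply: lt_trans ymu; rewrite lte_fin.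
  by rewrite ltNge; move: h; rewrite bE invr1 => ->.
apply: (rate_increasing ny _ _ h); first by rewrite invr_gt0.
by rewrite invf_lt1 // lt_neqAle eq_sym b1'.
Qed.

Lemma supercritical_split (y a : R) : ((expR a)%:E < rate X0 y * br)%E ->
  exists u l : R, [/\ 0 < u, u <= 1, (u%:E < rate X0 y)%E, (l%:E < br)%E & expR a < u * l].
Proof.
have := rate_le1 X0 y; have := rate_ge0 X0 y.
rewrite (rate_fin X0 y); set r := fine _; rewrite !lee_fin => r0 r1.
have p0 := expR_gt0 a; set p := expR a in p0 *.
have [brE|[b b1 brE]] := branching_cases; rewrite brE.
  have [->|rn0] := eqVneq r 0; first by rewrite mul0e lte_fin ltNge ltW.
  have rp : 0 < r by rewrite lt_neqAle eq_sym rn0.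
  (* When [br] is infinite any real [l] is allowed; this one gives [u * l = 2 expR a]. *)
  move=> _; exists (r / 2), (2 * (p / (r / 2))); split; rewrite ?ltry //.
  - by rewrite divr_gt0.
  - by lra.
  - by rewrite lte_fin; lra.
  - by rewrite mulrCA mulrC [_ * (p / _)]mulrC divfK ?gt_eqF ?divr_gt0 //; lra.
rewrite -EFinM lte_fin => rb; have b0 : 0 < b by exact: lt_le_trans b1.
have pb : p / b < r by rewrite ltr_pdivrMr.
pose u := (r + p / b) / 2; have ur : u < r by rewrite /u; lra.
have bu : p / b < u by rewrite /u; lra.
have u0 : 0 < u by apply: lt_trans bu; rewrite divr_gt0.
have pu : p / u < b by rewrite ltr_pdivrMr // mulrC -ltr_pdivrMr.
exists u, ((b + p / u) / 2); split => //.
- by apply: le_trans (ltW ur) r1.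
- by rewrite lte_fin; lra.
- by rewrite mulrC -ltr_pdivrMr //; lra.
Qed.

End RateInverse.

Section Conclusion.
Variables (R : realType) (T : rooted_tree).
Hypothesis lf : locally_finite T.
Context d (Omega : measurableType d) (P : probability Omega R).
Context d' (Omega' : measurableType d') (P' : probability Omega' R).
Variables (X : T -> {RV P >-> R}) (X0 : {RV P' >-> R}).
Hypothesis X_indep : mutually_independent [set v : T | v <> origin] X.
Hypothesis X_law : forall v : T, v <> origin -> same_law (X v) X0.
Variable s0 : boundary T.
Let br := branching_number R T.
Notation x w := (fun v => X v w).
Notation mu := (sup_truncated_mean X0).

(** The upper half is the strong law; the lower half follows from geometric bounds on the
    probability that vertices of [s0] are slow, available because the rate is below 1 left of
    [m]. *)
Lemma lln_ray (m : R) : mu = m%:E -> (forall y : R, y < m -> (rate X0 y < 1)%E) ->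
  {ae P, forall w, rays_lim_eq (x w) m%:E s0}.
Proof.
move=> mE lt1.
have upper (k : nat) : {ae P, forall w, exists N, forall n, (N <= n)%N ->
    partial_sum (x w) (s0 n) <= (m + k.+1%:R^-1) * n%:R}.
  have k0 : (0 : R) < k.+1%:R^-1 by rewrite invr_gt0 ltr0n.
  have inj : injective (fun n => s0 n.+1) by move=> i j /ray_inj[].
  have := lln_upper X_indep X_law inj (@ray_neq0 T s0) mE k0.
  apply: filterS => w [N NP]; exists N => n /NP.
  by rewrite partial_sumE sum_root_path_ray big_mkord.
have lower (k : nat) : {ae P, forall w, exists N, forall n, (N <= n)%N ->
    (m - k.+1%:R^-1) * n%:R <= partial_sum (x w) (s0 n)}.
  set y := m - _; have ym : y < m by rewrite /y gtrBl invr_gt0 ltr0n.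
  have := lt1 y ym; have := rate_ge0 X0 y.
  rewrite (rate_fin X0 y); set r := fine _; rewrite lee_fin lte_fin => r0 r1.
  have yu : (rate X0 y < ((r + 1) / 2)%:E)%E by rewrite (rate_fin X0 y) lte_fin -/r; lra.
  have u0 : 0 <= (r + 1) / 2 by lra.
  have u1 : (r + 1) / 2 < 1 by lra.
  have := @borel_cantelli_geometric _ _ _ P (fun n => slow X y (s0 n)) _ u0 u1.
  move=> h; have := h (fun n => slow_measurable X y (s0 n)).
  have sp n : (P (slow X y (s0 n)) <= (((r + 1) / 2) ^+ n)%:E)%E.
    by have := slow_prob X_indep X_law (s0 n) yu; rewrite depth_ray.
  move=> /(_ sp); apply: filterS => w [N NP]; exists N => n /NP /negP.
  rewrite -ltNge sum_sub_const depth_ray subr_gt0; exact: ltW.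
have := ae_foralln lower; apply: filterS2 (ae_foralln upper) => w up lo.
rewrite /rays_lim_eq /= /ray_average; apply: cvg_EFin; first exact: nearW.
apply/cvgrPdist_le => e e0.
have [k kP] : exists k : nat, k.+1%:R^-1 <= e.
  exists (Num.bound e^-1); rewrite -[leRHS]invrK lef_pV2 ?posrE ?invr_gt0 ?ltr0n //.
  have := archi_boundP (ltW (_ : 0 < e^-1)); rewrite invr_gt0 => /(_ e0) /ltW h.
  by apply: le_trans h _; rewrite ler_nat.
have [N1 N1P] := up k; have [N2 N2P] := lo k.
exists (maxn (maxn N1 N2) 1) => // n /=; rewrite !geq_max => /andP[/andP[n1 n2] n0].
have nr : (0 : R) < n%:R by rewrite ltr0n.
rewrite depth_ray ler_distlC; apply/andP; split.
  by rewrite ler_pdivlMr //; apply: le_trans (N2P n n2); rewrite ler_pM2r // lerD2l lerN2.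
by rewrite ler_pdivrMr //; apply: le_trans (N1P n n1) _; rewrite ler_pM2r // lerD2l.
Qed.

Lemma limsup_ge_inv :
  {ae P, forall w, forall s, (rate_inv X0 br^-1 <= limn_esup (ray_average (x w) s))%E}.
Proof.
have [q qP] := dense_sequence R.
have h (n : nat) : {ae P, forall w, ((q n)%:E < rate_inv X0 br^-1)%E ->
    forall s, ((q n)%:E <= limn_esup (ray_average (x w) s))%E}.
  have [lt|nlt] := boolP ((q n)%:E < rate_inv X0 br^-1)%E; last exact: aeW.
  apply: filterS (limsup_ge_rate lf X_indep X_law s0 (rate_below_inv s0 lt)) => w h _.
  exact: h.
apply: filterS (ae_foralln h) => w {}h s; rewrite leNgt; apply/negP => lt.
have [n /andP[n1 n2]] := qP _ _ lt.
by have := h n n2 s; rewrite leNgt n1.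
Qed.

Lemma hausdorff_lower_rate (y a : R) : (y%:E < mu)%E -> 0 < a -> ((expR a)%:E < rate X0 y * br)%E ->
  {ae P, forall w, forall b, 0 < b -> b < a ->
    hausdorff_measure (@boundary_dist R T) b (rays_lim_eq (x w) y%:E) <> 0%E}.
Proof.
move=> ymu a0 /(supercritical_split s0)[u [l [u0 u1 ur lbr al]]].
exact: (hausdorff_lower lf X_indep X_law s0 u0 u1 (tiltable_rate ymu u0 ur) lbr a0 al).
Qed.

Let nonempty_of_measure (E : set (boundary T)) (a : R) : 0 < a ->
  (forall b, 0 < b -> b < a -> hausdorff_measure (@boundary_dist R T) b E <> 0%E) -> exists s, E s.
Proof.
move=> a0 h; apply: contrapT => /forallNP E0.
have a2 : 0 < a / 2 by rewrite divr_gt0.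
apply: (h (a / 2) a2); first by rewrite ltr_pdivrMr // ltr_pMr // ltr1n.
have -> : E = set0 by apply/seteqP; split => // s /E0.
exact: hausdorff_measure_set0.
Qed.

Lemma slow_ray (y : R) : ~ (br = 1%E /\ forall y : R, rate X0 y = 1%E) ->
  (rate_inv X0 br^-1 < y%:E)%E ->
  {ae P, forall w, exists2 l, (l <= y%:E)%E & exists s, rays_lim_eq (x w) l s}.
Proof.
move=> ndeg zy; have br1 := branching_ge1 R s0.
have [mulez|zmu] := leP mu (rate_inv X0 br^-1); last first.
  have [q qP] := dense_sequence R.
  have [|n /andP[zn]] := qP (rate_inv X0 br^-1) (Order.min y%:E mu); first by rewrite lt_min zy.
  rewrite lt_min => /andP[ny nmu].
  have [a a0 al] := supercritical_rate s0 ndeg zn nmu.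
  apply: filterS (hausdorff_lower_rate nmu a0 al) => w /(nonempty_of_measure a0)[s sP].
  by exists (q n)%:E; [exact: ltW|exists s].
case muE : mu mulez => [m| |].
- move=> mz; apply: filterS (lln_ray muE _) => [w sl|y' y'm].
    by exists m%:E; [exact: le_trans mz (ltW zy)|exists s0].
  have /(rate_below_inv s0)[[b bE rb]|->] : (y'%:E < rate_inv X0 br^-1)%E.
    by apply: lt_le_trans mz; rewrite lte_fin.
    apply: lt_le_trans rb _; rewrite lee_fin.
    rewrite bE lee_fin in br1.
    by rewrite invf_le1 // (lt_le_trans _ br1).
  by rewrite lte_fin.
- by rewrite leye_eq => /eqP ze; rewrite ze in zy; move: zy; rewrite ltNge leey.
(* Here the rate is 1 everywhere, so nondegeneracy forces [br > 1]. *)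
- move=> _; have bgt1 : (1 < br)%E.
    rewrite lt_neqAle br1 andbT eq_sym; apply/eqP => b1; apply: ndeg; split => // y'.
    exact: rate_heavy.
  have [q qP] := dense_sequence R; have [n /andP[l1 lbr]] := qP _ _ bgt1.
  set l := q n in l1 lbr; rewrite lte_fin in l1.
  have l0 : 0 < l by exact: lt_trans l1.
  have li : l^-1 < 1 by rewrite invf_lt1.
  have lip : 0 < l^-1 by rewrite invr_gt0.
  (* Midway between [l^-1] and 1, so that [u < 1] while [u * l > 1]. *)
  pose u := (1 + l^-1) / 2.
  have u0 : 0 < u by rewrite /u; lra.
  have u1 : u < 1 by rewrite /u; lra.
  have ul : u * l = (l + 1) / 2 by rewrite /u mulrAC mulrDl mul1r mulVf ?gt_eqF.
  have ul1 : 1 < u * l by rewrite ul; lra.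
  have [y' y'y tl] := tiltable_heavy y muE u0 u1.
  pose a := ln (u * l) / 2; have a0 : 0 < a by rewrite divr_gt0 // ln_gt0.
  have al : expR a < u * l.
    rewrite -[ltRHS]lnK ?posrE; last by apply: lt_trans ul1.
    by rewrite ltr_expR ltr_pdivrMr // ltr_pMr ?ln_gt0 // ltr1n.
  apply: filterS (hausdorff_lower lf X_indep X_law s0 u0 (ltW u1) tl lbr a0 al) => w.
  by move=> /(nonempty_of_measure a0)[s sP]; exists y'%:E; [rewrite lee_fin|exists s].
Qed.

Lemma limit_speed : ~ (br = 1%E /\ forall y : R, rate X0 y = 1%E) ->
  {ae P, forall w,
    ereal_inf [set limn_esup (ray_average (x w) s) | s in [set: boundary T]]
      = ereal_inf [set l | exists s, rays_lim_eq (x w) l s] /\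
    ereal_inf [set l | exists s, rays_lim_eq (x w) l s] = rate_inv X0 br^-1}.
Proof.
move=> ndeg; have [q qP] := dense_sequence R.
have h (n : nat) : {ae P, forall w, (rate_inv X0 br^-1 < (q n)%:E)%E ->
    exists2 l, (l <= (q n)%:E)%E & exists s, rays_lim_eq (x w) l s}.
  have [lt|nlt] := boolP (rate_inv X0 br^-1 < (q n)%:E)%E; last exact: aeW.
  by apply: filterS (slow_ray ndeg lt).
apply: filterS2 (ae_foralln h) limsup_ge_inv => w {}h lo.
apply: ray_infima_eq lo _ => y /qP[n /andP[n1 n2]].
by have [l ln sl] := h n n1; exists l => //; exact: le_trans ln (ltW n2).
Qed.

Lemma dim_lower (y : R) : (y%:E < mu)%E ->
  {ae P, forall w, (lne (rate X0 y * br) <=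
    hausdorff_dim (@boundary_dist R T) (rays_lim_eq (x w) y%:E))%E}.
Proof.
move=> ymu; have [q qP] := dense_sequence R.
have p0 : (0 <= rate X0 y * br)%E.
  by rewrite mule_ge0 ?rate_ge0 // (le_trans _ (branching_ge1 R s0)).
have h (n : nat) : {ae P, forall w, 0 < q n -> ((q n)%:E < lne (rate X0 y * br))%E ->
    forall b, 0 < b -> b < q n ->
    hausdorff_measure (@boundary_dist R T) b (rays_lim_eq (x w) y%:E) <> 0%E}.
  have [/andP[n0 lt]|nlt] := boolP ((0 < q n) && ((q n)%:E < lne (rate X0 y * br))%E).
    apply: filterS (hausdorff_lower_rate ymu n0 _) => [w h _ _ //|].
    by rewrite -[ltRHS]lneK ?in_itv /= ?p0 ?leey // -/(expeR (q n)%:E) lte_expeR.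
  by apply: aeW => w n0 lt; move: nlt; rewrite n0 lt.
apply: filterS (ae_foralln h) => w {}h; apply: le_ereal_inf_tmp => _ [a [a0 aE] <-].
rewrite leNgt; apply/negP => /qP[n /andP[an nl]]; rewrite lte_fin in an.
exact: (h n (lt_trans a0 an) nl a a0 an).
Qed.

Lemma dim_upper (y : R) : (rate_inv X0 br^-1 <= y%:E)%E ->
  ~ (rate X0 y = 0%E /\ br = +oo%E) ->
  {ae P, forall w, (hausdorff_dim (@boundary_dist R T) (rays_limsup_le (x w) y%:E)
    <= lne (rate X0 y * br))%E}.
Proof.
move=> zy nd; have [brE|[b b1 brE]] := branching_cases R s0.
  rewrite -/br in brE; apply: aeW => w; rewrite brE gt0_muley /= ?leey //.
  rewrite lt_neqAle eq_sym rate_ge0 andbT; apply/eqP => r0; exact: nd.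
rewrite -/br in brE; have b0 : 0 < b by exact: lt_le_trans b1.
(* By right continuity a product below 1 would persist at some [y' > y], and [rate_inv] would be at
   least [y']. The logarithm is therefore nonnegative, so that every exponent above it is positive,
   as [hausdorff_dim] requires. *)
have rb1 : (1 <= rate X0 y * br)%E.
  rewrite leNgt; apply/negP; rewrite brE -lte_pdivlMr // mul1e => /rate_rcont[y' yy' y'b].
  move: zy; rewrite leNgt => /negP; apply.
  apply: (@lt_le_trans _ _ y'%:E); first by rewrite lte_fin.
  rewrite brE inver gt_eqF // /rate_inv eqe invr_eq0 gt_eqF //.
  by apply: ereal_sup_ubound; exists y'.
have [q qP] := dense_sequence R.
have h (n : nat) : {ae P, forall w, (lne (rate X0 y * br) < (q n)%:E)%E ->
    hausdorff_measure (@boundary_dist R T) (q n) (rays_limsup_le (x w) y%:E) = 0%E}.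
  have [lt|nlt] := boolP (lne (rate X0 y * br) < (q n)%:E)%E; last exact: aeW.
  have n0 : 0 < q n by rewrite -lte_fin; apply: le_lt_trans lt; rewrite lne_ge0.
  have : (rate X0 y * br < (expR (q n))%:E)%E.
    rewrite -[ltLHS]lneK; last by rewrite in_itv /= leey andbT (le_trans _ rb1).
    by rewrite -/(expeR (q n)%:E) lte_expeR.
  (* Room above [y] is needed: a limsup of at most [y] makes the vertices of a ray eventually slow
     only for speeds [y' > y]. *)
  rewrite brE -lte_pdivlMr // => /rate_rcont[y' yy'].
  rewrite lte_pdivlMr // => y'b.
  by apply: filterS (hausdorff_upper X_indep X_law s0 n0 yy' brE y'b).
apply: filterS (ae_foralln h) => w {}h; rewrite leNgt; apply/negP => /qP[n /andP[n1 n2]].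
move: n2; rewrite ltNge => /negP; apply; apply: ereal_inf_lbound; exists (q n) => //; split; last exact: h.
by rewrite -lte_fin; apply: le_lt_trans n1; rewrite lne_ge0.
Qed.

End Conclusion.

Local Open Scope ereal_scope.

(* [X v] is attached to the edge e(v), v <> origin; [X origin] is never used. *)
Theorem theorem4 (R : realType) (T : rooted_tree)
  (d : measure_display) (Omega : measurableType d) (P : probability Omega R)
  (d' : measure_display) (Omega' : measurableType d')
  (P' : probability Omega' R)
  (X : T -> {RV P >-> R}) (X0 : {RV P' >-> R})
  (T_infinite : infinite_set [set: T])
  (T_locally_finite : locally_finite T)
  (X_indep : mutually_independent [set v : T | v <> origin] X)
  (X_law : forall v : T, v <> origin -> same_law (X v) X0)
  (nondegenerate :
    ~ (branching_number R T = 1 /\ forall y : R, rate X0 y = 1)) :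
  {ae P, forall w,
    let x := fun v => X v w in
    ereal_inf [set limn_esup (ray_average x s) | s in [set: boundary T]]
      = ereal_inf [set l | exists s, rays_lim_eq x l s] /\
    ereal_inf [set l | exists s, rays_lim_eq x l s]
      = rate_inv X0 (branching_number R T)^-1} /\
  forall y : R,
    rate_inv X0 (branching_number R T)^-1 <= y%:E ->
    y%:E < sup_truncated_mean X0 ->
    ~ (rate X0 y = 0 /\ branching_number R T = +oo) ->
    {ae P, forall w,
      let x := fun v => X v w in
      hausdorff_dim (@boundary_dist R T) (rays_limsup_le x y%:E)
        = hausdorff_dim (@boundary_dist R T) (rays_lim_eq x y%:E) /\
      hausdorff_dim (@boundary_dist R T) (rays_lim_eq x y%:E)
        = lne (rate X0 y * branching_number R T)}.
Proof.
have [s0 _] := konig T_locally_finite T_infinite.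
split; first exact: (limit_speed T_locally_finite X_indep X_law s0 nondegenerate).
move=> y zy ymu nd.
have lo := dim_lower T_locally_finite X_indep X_law s0 ymu.
apply: filterS2 lo (dim_upper X_indep X_law s0 zy nd) => w lo up /=.
have sub := hausdorff_dim_le R (@rays_lim_eq_sub R T (fun v => X v w) y%:E).
split; apply/eqP; rewrite eq_le.
  by rewrite sub (le_trans up lo).
by rewrite lo (le_trans sub up).
Qed.
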